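(* Let $M$ be an oriented Riemannian 4-manifold, let $f:S_M\to M$ be its unit tangent sphere bundle with the metric and orientation described in the context, and let $\phi=\alpha+\mu\wedge\beta-\alpha_2\in\Omega^3(S_M)$ be the canonical $G_2$ structure 3-form. Then $$\mathrm{d}*\phi=-f^*\mathrm{Vol}_M\wedge(\mathit{Ric}\,U)^\flat .$$ In particular, $(S_M,\phi)$ is co-calibrated if, and only if, $M$ is an Einstein manifold.
   Context: Setting. $(M,\langle\,,\rangle)$ is an oriented smooth Riemannian 4-manifold with Levi-Civita connection $\nabla$, curvature $R^\nabla_{X,Y}=[\nabla_X,\nabla_Y]-\nabla_{[X,Y]}$ and volume form $\mathrm{Vol}_M$. $S_M=\{u\in TM:\ \|u\|=1\}$ and $f:S_M\to M$ is the projection. Let $U$ be the tautological section of $f^*TM\to S_M$, $U_u=u$. The vertical bundle $\mathcal V=\ker \mathrm{d}f$ is identified with the subbundle $U^\perp\subset f^*TM$, i.e. $\mathcal V_u=u^\perp\subset T_{f(u)}M$. The Levi-Civita connection gives a splitting $TS_M=\mathcal V\oplus\mathcal H^\nabla$, with $\mathcal H^\nabla=\{X\in TS_M:\ (f^*\nabla)_XU=0\}$, and $\mathcal H^\nabla$ is identified with $f^*TM$ via $\mathrm{d}f$. Write $X=X^v+X^h$ for the decomposition of a vector; $X^v=(f^*\nabla)_XU$. The metric on $S_M$ makes $\mathcal V\perp\mathcal H^\nabla$ and restricts to $f^*\langle\,,\rangle$ on each of $\mathcal H^\nabla\cong f^*TM$ and $\mathcal V\subset f^*TM$. Let $\theta$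 be the map $\mathcal H^\nabla\to f^*TM$ given by $\mathrm{d}f$ (regarded as taking values in the copy of $f^*TM$ that contains $\mathcal V$), extended by $0$ on $\mathcal V$. Let $e_0=\theta^tU\in\mathcal H^\nabla$ be the horizontal vector field with $\theta e_0=U$. Adapted frames: complete $e_0$ locally to an orthonormal frame $e_0,e_1,e_2,e_3$ of $\mathcal H^\nabla$, direct for the orientation of $M$, and set $e_{i+3}=\theta e_i\in\mathcal V$ for $i=1,2,3$. $S_M$ is oriented by declaring $e_0,e_1,\dots,e_6$ to be direct; $*$ is the corresponding Hodge star and $\mathrm{Vol}_{S_M}$ the volume form. With dual coframe $e^0,\dots,e^6$ and $e^{ij\cdots}=e^i\wedge e^j\wedge\cdots$, the following are globally defined forms on $S_M$ (independent of the adapted frame): $\mu=e^0$, i.e. $\mu(X)=\langle U,\theta X\rangle$; $\beta=e^{14}+e^{25}+e^{36}$, i.e. $\beta(X,Y)=\langle\theta X,Y^v\rangle-\langle\theta Y,X^v\rangle$; $\alpha=e^{456}$, i.e. $\alpha(X,Y,Z)=\mathrm{Vol}_M(U,X^v,Y^v,Z^v)$; $\alpha_2=e^{126}+e^{234}+e^{315}$. The form $\phi=\alpha+\mu\wedge\beta-\alpha_2$ defines a $G_2$ structure on $S_M$ inducing the metric on $S_M$ for which $\mathcal V\perp\mathcal H^\nabla$ and which restricts to $f^*\langle\,,\rangle$ on each of $\mathcal H^\nabla\cong f^*TM$ and $\mathcal V\subset f^*TM$. The Ricci tensor of $M$ is $r(X,Y)=\mathrm{Tr}\,(W\mapsto R^\nabla_{W,X}Y)=\langle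 \mathit{Ric}\,X,Y\rangle$, with $\mathit{Ric}$ a symmetric endomorphism of $TM$. $(\mathit{Ric}\,U)^\flat$ is the 1-form on $S_M$ given at $u$ by $Y\mapsto\langle \mathit{Ric}\,u,Y^v\rangle$; it vanishes on $\mathcal H^\nabla$. Co-calibrated means $\delta\phi=0$, equivalently $\mathrm{d}*\phi=0$. $M$ is Einstein if $\mathit{Ric}_x=s\,\mathrm{Id}$ for all $x\in M$ for some scalar $s$ (which, $M$ having dimension 4, is automatically locally constant if allowed to depend on $x$). *)

(* Defs.v *)
From HB Require Import structures.
From mathcomp Require Import all_boot all_order all_algebra fingroup perm.
From mathcomp Require Import all_classical all_reals all_analysis.
From mathcomp Require Import ring.

Set Implicit Arguments.
Unset Strict Implicit.
Unset Printing Implicit Defensive.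
Import Order.TTheory GRing.Theory Num.Theory.
Import numFieldNormedType.Exports.
Local Open Scope classical_set_scope.
Local Open Scope ring_scope.

Definition smooth_on (R : realType) (V W : normedModType R) (D : set V)
    (f : V -> W) : Prop :=
  forall (vs : seq V) (x : V), D x ->
    differentiable (foldr (fun v (h : V -> W) y => 'D_v h y) f vs) x.

(** ** Oriented Riemannian manifolds *)

Record chart (R : realType) (M : topologicalType) (n : nat) := Chart {
  chart_dom : set M;
  chart_map :> M -> 'rV[R]_n;
  chart_inv : 'rV[R]_n -> M;
  chart_dom_open : open chart_dom;
  chart_img_open : open (chart_map @` chart_dom);
  chartK : forall p, chart_dom p -> chart_inv (chart_map p) = p;
  chart_continuous : {within chart_dom, continuous chart_map};
  chart_inv_continuous : {within chart_map @` chart_dom, continuous chart_inv}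
}.

Definition chart_img (R : realType) (M : topologicalType) (n : nat)
  (c : chart R M n) : set 'rV[R]_n := c @` chart_dom c.

Definition overlap (R : realType) (M : topologicalType) (n : nat)
  (c d : chart R M n) : set 'rV[R]_n := c @` (chart_dom c `&` chart_dom d).

Definition transition (R : realType) (M : topologicalType) (n : nat)
  (c d : chart R M n) : 'rV[R]_n -> 'rV[R]_n := d \o chart_inv c.

Record oriented_atlas (R : realType) (M : topologicalType) (n : nat) :=
  OrientedAtlas {
  atlas_index : Type;
  atlas_chart :> atlas_index -> chart R M n;
  atlas_cover : forall p, exists i, chart_dom (atlas_chart i) p;
  atlas_smooth : forall i j,
    smooth_on (overlap (atlas_chart i) (atlas_chart j))
              (transition (atlas_chart i) (atlas_chart j));
  atlas_oriented : forall i j x,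
    overlap (atlas_chart i) (atlas_chart j) x ->
    0 < \det (jacobian (transition (atlas_chart i) (atlas_chart j)) x)
}.

(* Vectors are rows, so [jacobian] acts on the right. *)
Record riemannian_metric (R : realType) (M : topologicalType) (n : nat)
    (A : oriented_atlas R M n) := RiemannianMetric {
  metric :> atlas_index A -> 'rV[R]_n -> 'M[R]_n;
  metric_smooth : forall i, smooth_on (chart_img (A i)) (metric i);
  metric_sym : forall i x, chart_img (A i) x -> (metric i x)^T = metric i x;
  metric_pos : forall i x (v : 'rV[R]_n), chart_img (A i) x -> v != 0 ->
    0 < (v *m metric i x *m v^T) 0 0;
  metric_compat : forall i j x, overlap (A i) (A j) x ->
    let tau := transition (A i) (A j) in
    metric i x = jacobian tau x *m metric j (tau x) *m (jacobian tau x)^T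
}.

(** ** Riemannian geometry in a chart *)

Section LocalGeometry.
Variables (R : realType) (n : nat) (g : 'rV[R]_n -> 'M[R]_n).
Implicit Types (x v w : 'rV[R]_n) (X Y Z : 'rV[R]_n -> 'rV[R]_n).

Definition inner v w x : R := (v *m g x *m w^T) 0 0.

(* Koszul's formula on constant fields: the vector [nabla_v w] at [x]. *)
Definition christoffel x v w : 'rV[R]_n :=
  2^-1 *: (\row_l ('D_v (inner w 'e_l) x + 'D_w (inner v 'e_l) x
                   - 'D_'e_l (inner v w) x)) *m invmx (g x).

Definition nabla X Y x : 'rV[R]_n := 'D_(X x) Y x + christoffel x (X x) (Y x).

Definition lie_bracket X Y x : 'rV[R]_n := 'D_(X x) Y x - 'D_(Y x) X x.

Definition curvature X Y Z x : 'rV[R]_n :=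
  nabla X (nabla Y Z) x - nabla Y (nabla X Z) x - nabla (lie_bracket X Y) Z x.

(* Trace of [W |-> R_{W,v} w]; the curvature is tensorial, so the arguments
   may be extended by constant fields. *)
Definition ricci x v w : R :=
  \sum_k curvature (cst 'e_k) (cst v) (cst w) x 0 k.

(* The matrix, acting on rows from the right, such that
   [ricci x v w = <Ric v, w>]. *)
Definition ric x : 'M[R]_n :=
  (\matrix_(i, j) ricci x 'e_i 'e_j) *m invmx (g x).

Definition volume x (V : 'M[R]_n) : R := Num.sqrt (\det (g x)) * \det V.

End LocalGeometry.

Definition einstein (R : realType) (M : topologicalType) (n : nat)
    (A : oriented_atlas R M n) (g : riemannian_metric A) : Prop :=
  exists s : M -> R, forall i p, chart_dom (A i) p ->
    ric (g i) (A i p) = (s p)%:M.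

(** ** Differential forms on open subsets of R^n *)

(* A [k]-covector takes its [k] arguments as the rows of a matrix. *)
Definition covector (R : realType) (n k : nat) := 'M[R]_(k, n) -> R.

Definition wedge (R : realType) (n k l : nat)
    (a : covector R n k) (b : covector R n l) : covector R n (k + l) :=
  fun X => (k`! * l`!)%:R^-1 * \sum_(s : 'S_(k + l))
    (-1) ^+ s * a (usubmx (row_perm s X)) * b (dsubmx (row_perm s X)).

Definition ext_d (R : realType) (n k : nat)
    (w : 'rV[R]_n -> covector R n k) (z : 'rV[R]_n) : covector R n k.+1 :=
  fun X => \sum_(i < k.+1)
    (-1) ^+ i * 'D_(row i X) (fun y => w y (row' i X)) z.

Definition pullback (R : realType) (m n k : nat) (h : 'rV[R]_m -> 'rV[R]_n)
    (w : 'rV[R]_n -> covector R n k) (z : 'rV[R]_m) : covector R m k :=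
  fun X => w (h z) (X *m jacobian h z).

(* Hodge star for the Gram matrix [G] and the standard orientation:
   [( *w)_J = sqrt (det G) / k! * w^I eps_{IJ}]; row [i] of [invmx G] is
   the gradient of the [i]-th coordinate. *)
Definition hodge (R : realType) (n k l : nat) (e : (k + l)%N = n)
    (G : 'M[R]_n) (w : covector R n k) : covector R n l :=
  fun X => Num.sqrt (\det G) / k`!%:R * \sum_(I : {ffun 'I_k -> 'I_n})
    w (rowsub I (invmx G)) *
    \det (castmx (e, erefl n) (col_mx (rowsub I 1%:M) X)).

(** ** The tangent bundle of a 4-manifold in a chart *)

(* [p = row_mx x u] is the vector [u] at [x]; the rows of [X : 'M_(k, 4 + 4)]
   are vectors tangent to [TM] at [p]. *)
Section TangentBundle.
Variables (R : realType) (g : 'rV[R]_4 -> 'M[R]_4) (p : 'rV[R]_(4 + 4)).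

Definition base : 'rV[R]_4 := lsubmx p.
Definition taut : 'rV[R]_4 := rsubmx p.

Definition horizontal k (X : 'M[R]_(k, 4 + 4)) : 'M[R]_(k, 4) := lsubmx X.

Definition vertical k (X : 'M[R]_(k, 4 + 4)) : 'M[R]_(k, 4) :=
  \matrix_(a < k) (row a (rsubmx X)
                   + christoffel g base (row a (lsubmx X)) taut).

Definition gram k (X : 'M[R]_(k, 4 + 4)) : 'M[R]_k :=
  horizontal X *m g base *m (horizontal X)^T
  + vertical X *m g base *m (vertical X)^T.

(* The rows of [E] are [theta e_0 = u, theta e_1, theta e_2, theta e_3]. *)
Definition adapted_frame (E : 'M[R]_4) : Prop :=
  [/\ row 0 E = taut, E *m g base *m E^T = 1%:M & 0 < \det E].

(* Column [i] lists the values of [e^i] on the rows of [X]. *)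
Definition coframe (E : 'M[R]_4) k (X : 'M[R]_(k, 4 + 4)) : 'M[R]_(k, 7) :=
  row_mx (horizontal X *m g base *m E^T)
         (@rsubmx R k 1 3 (vertical X *m g base *m E^T)).

(* The value of [e^{I_0} /\ e^{I_1} /\ ...] on the rows of [X]. *)
Definition coframe_monomial (E : 'M[R]_4) k (I : k.-tuple 'I_7) :
    covector R (4 + 4) k :=
  fun X => \det (colsub (tnth I) (coframe E X)).

Definition mu : covector R (4 + 4) 1 := fun X =>
  (taut *m g base *m (horizontal X)^T) 0 0.

Definition beta : covector R (4 + 4) 2 := fun X =>
  (horizontal X *m g base *m (vertical X)^T) 0 1
  - (horizontal X *m g base *m (vertical X)^T) 1 0.

Definition alpha : covector R (4 + 4) 3 := fun X =>
  volume g base (col_mx taut (vertical X)).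

(* [Vol (U, X^v, theta Y, theta Z)] summed over the position of the vertical
   slot; see [alpha2_coframe]. *)
Definition alpha2 : covector R (4 + 4) 3 := fun X =>
  \sum_(c < 3) volume g base (col_mx taut
    (\matrix_(a < 3) if a == c then row a (vertical X)
                     else row a (horizontal X))).


Lemma volume_coframe E (V : 'M[R]_(3, 4)) : adapted_frame E ->
  volume g base (col_mx taut V)
  = \det (@rsubmx R 3 1 3 (V *m g base *m E^T)).
Proof.
case=> E0 Eg Epos; have En0 := lt0r_neq0 Epos.
have detE : \det (g base) = ((\det E)^-1) ^+ 2.
  have /(congr1 determinant) := Eg; rewrite !det_mulmx det_tr det1 => h.
  by rewrite -[LHS](mulKf En0) -[X in _^-1 * X](mulfK En0) h mul1r expr2.
rewrite /volume detE sqrtr_sqr gtr0_norm ?invr_gt0//.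
have -> : (\det E)^-1 * \det (col_mx taut V : 'M[R]_4)
          = \det ((col_mx taut V : 'M[R]_4) *m g base *m E^T).
  by rewrite !det_mulmx det_tr detE expr2 mulrA divfK// mulrC.
have -> : (col_mx taut V : 'M[R]_4) *m g base *m E^T =
   block_mx (1%:M : 'M[R]_1) 0 (@lsubmx R 3 1 3 (V *m g base *m E^T))
     (@rsubmx R 3 1 3 (V *m g base *m E^T)).
  rewrite -[LHS]/(@mulmx R (1 + 3) 4 4
    (@mulmx R (1 + 3) 4 4 (col_mx taut V) (g base)) E^T).
  rewrite !mul_col_mx block_mxEv hsubmxK; apply: (congr2 (@col_mx R 1 3 4)) => //.
  rewrite -E0 -!row_mul Eg; apply/rowP=> j.
  by rewrite !mxE; case: splitP => k jk; rewrite !mxE ?ord1 -val_eqE/= jk ?ord1.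
by rewrite (@det_lblock _ 1 3) det1 mul1r.
Qed.

Lemma alpha2_coframe E (X : 'M[R]_(3, 4 + 4)) : adapted_frame E ->
  let e i j k : covector R (4 + 4) 3 :=
    coframe_monomial E [tuple inord i; inord j; inord k] in
  alpha2 X = e 1%N 2%N 6%N X + e 2%N 3%N 4%N X + e 3%N 1%N 5%N X.
Proof.
move=> hE e.
rewrite /alpha2 !big_ord_recl big_ord0 !(volume_coframe _ hE).
rewrite /e /coframe_monomial.
set H := horizontal X *m g base *m E^T.
set V := vertical X *m g base *m E^T.
have mixE c : (\matrix_(a < 3) if a == c then row a (vertical X)
      else row a (horizontal X)) *m g base *m E^T
    = \matrix_(a < 3) (if a == c then row a V else row a H).
  by apply/row_matrixP=> a; rewrite !row_mul !rowK /V /H; case: eqP => _; rewrite ?row_mul /vertical ?rowK.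
rewrite !mixE.
have coE : coframe E X = row_mx H (@rsubmx R 3 1 3 V) by [].
clearbody H V.
have coh a (i : nat) : (i < 4)%N -> coframe E X a (inord i) = H a (inord i).
  move=> i4; rewrite coE mxE; case: splitP => k; rewrite inordK ?(ltn_trans i4)//.
    by move=> ->; congr (H _ _); apply: val_inj; rewrite /= inordK.
  by move=> ik; rewrite ik in i4.
have cov a (i : nat) : (3 < i < 7)%N ->
    coframe E X a (inord i) = V a (inord (i - 3)).
  case/andP=> i3 i7; rewrite coE mxE; case: splitP => k; rewrite inordK//.
    by move=> ik; have := ltn_ord k; rewrite -ik ltnNge i3.
  move=> ->; rewrite mxE; congr (V _ _); apply: val_inj.
  by rewrite /= [(4 + k)%N]addnC -addnBA// addn1 inordK// ltnS ltn_ord.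
have det3 (A : 'M[R]_3) : \det A =
    A 0 0 * (A 1 1 * A 2 2 - A 1 2 * A 2 1)
    - A 0 1 * (A 1 0 * A 2 2 - A 1 2 * A 2 0)
    + A 0 2 * (A 1 0 * A 2 1 - A 1 1 * A 2 0).
  pose f (i j : nat) := A (inord i) (inord j).
  have AE i j : A i j = f i j by rewrite /f !inord_val.
  rewrite (expand_det_row _ 0) !big_ord_recl big_ord0 /cofactor.
  rewrite !(expand_det_row _ 0) !big_ord_recl !big_ord0 /cofactor !det_mx11.
  rewrite !mxE !AE /= /bump /=.
  by ring.
have rsE c a (b : 'I_3) :
    @rsubmx R 3 1 3 (\matrix_(i < 3) (if i == c then row i V else row i H)) a b
    = if a == c then V a (inord b.+1) else H a (inord b.+1).
  rewrite !mxE (_ : rshift 1 b = inord b.+1); first by case: ifP => _; rewrite mxE.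
  by apply: val_inj; rewrite /= inordK ?add1n// ltnS.
have colE (I : 3.-tuple 'I_7) a b :
    colsub (tnth I) (coframe E X) a b = coframe E X a (nth ord0 I b).
  by rewrite mxE (tnth_nth ord0).
rewrite !det3 !rsE !colE -!val_eqE/=.
rewrite !(coh _ 1%N)// !(coh _ 2%N)// !(coh _ 3%N)//.
rewrite !(cov _ 4%N)// !(cov _ 5%N)// !(cov _ 6%N)//=.
ring.
Qed.

Definition phi_form : covector R (4 + 4) 3 := fun X =>
  alpha X + wedge mu beta X - alpha2 X.

Definition base_volume : covector R (4 + 4) 4 := fun X =>
  volume g base (horizontal X).

Definition ric_flat : covector R (4 + 4) 1 := fun X =>
  (taut *m ric g base *m g base *m (vertical X)^T) 0 0.

End TangentBundle.

(** ** The unit tangent sphere bundle *)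

Section SphereBundle.
Variables (R : realType) (M : topologicalType) (A : oriented_atlas R M 4).
Variable g : riemannian_metric A.

(* The inverse of a direct chart of [S_M] lying over a chart of [M]. *)
Record sphere_param := SphereParam {
  sp_index : atlas_index A;
  sp_dom : set 'rV[R]_7;
  sp_map :> 'rV[R]_7 -> 'rV[R]_(4 + 4);
  sp_open : open sp_dom;
  sp_smooth : smooth_on sp_dom sp_map;
  sp_base : forall z, sp_dom z -> chart_img (A sp_index) (base (sp_map z));
  sp_unit : forall z, sp_dom z ->
    inner (g sp_index) (taut (sp_map z)) (taut (sp_map z)) (base (sp_map z))
    = 1;
  sp_inj : forall y z, sp_dom y -> sp_dom z -> sp_map y = sp_map z -> y = z;
  sp_direct : forall z, sp_dom z -> exists2 E,
    adapted_frame (g sp_index) (sp_map z) E &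
    0 < \det (coframe (g sp_index) (sp_map z) E (jacobian sp_map z))
}.

(* A form on [S_M], given by its expression in every direct parametrization;
   [sp_dom] is where that expression is meaningful. *)
Definition sform (k : nat) := sphere_param -> 'rV[R]_7 -> covector R 7 k.

Definition sform_eq k (v w : sform k) : Prop :=
  forall c z, sp_dom c z -> v c z =1 w c z.

Definition restrict k
    (w : atlas_index A -> 'rV[R]_(4 + 4) -> covector R (4 + 4) k) : sform k :=
  fun c => pullback c (w (sp_index c)).

Definition sform0 k : sform k := fun _ _ _ => 0.

Definition sform_opp k (w : sform k) : sform k := fun c z X => - w c z X.

Definition sform_wedge k l (v : sform k) (w : sform l) : sform (k + l) :=
  fun c z => wedge (v c z) (w c z).

Definition sform_d k (w : sform k) : sform k.+1 := fun c => ext_d (w c).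

Definition sform_star k l (e : (k + l = 7)%N) (w : sform k) : sform l :=
  fun c z => hodge e (gram (g (sp_index c)) (c z) (jacobian c z)) (w c z).

Fact codiff_degree k l : (k.+1 + l = 7)%N -> (l.+1 + k = 7)%N.
Proof. by rewrite !addSn addnC. Qed.

(* In dimension 7, [delta = (-1)^k * d *] on [k]-forms. *)
Definition sform_codiff k l (e : (k.+1 + l = 7)%N) (w : sform k.+1) : sform k :=
  fun c z X => (-1) ^+ k.+1 *
    sform_star (codiff_degree e) (sform_d (sform_star e w)) c z X.

Definition phi : sform 3 := restrict (fun i => phi_form (g i)).

Definition pullback_vol : sform 4 := restrict (fun i => base_volume (g i)).

Definition ric_taut_flat : sform 1 := restrict (fun i => ric_flat (g i)).

Definition cocalibrated : Prop :=
  sform_eq (sform_codiff (erefl : (3 + 4 = 7)%N) phi) (@sform0 2).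

End SphereBundle.

Arguments phi {R M A} g.
Arguments pullback_vol {R M A} g.
Arguments ric_taut_flat {R M A} g.
Arguments cocalibrated {R M A} g.

(* Main.v *)
(* In a direct parametrization [c = (x, u)] of [S_M], put [th X = D_X x] and
   [nu X = nabla_X u]. Reading off [*phi] in an adapted frame shows that it is the
   antisymmetrization of
     Vol (th, th, th, th) / 24 - <th, nu> <th, nu> / 2 - <u, th> Vol (u, th, nu, nu) / 2.
   The exterior derivative of an antisymmetrization is the antisymmetrization of
   the derivative. As [nabla] is metric and torsion free, the terms containing
   [nabla_X (th Y)] cancel, and those containing [nabla_X (nu Y)] only involve
   [R (th X, th Y) u]. The first Bianchi identity kills the contribution of
   [<th, nu> <th, nu>], products with too many vertical factors vanish, and the
   rest contracts to minus the sum over [k = 1, 2, 3] of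
   [<Ric u, theta e_k> e^{0123} /\ e^{k+3}].

   These three 5-forms have linearly independent Hodge duals, so [delta phi = 0]
   says that [Ric u] is proportional to [u] for every unit vector [u] (through each
   of them passes a direct parametrization), that is, that [Ric] is scalar at every
   point. The scalar is the same in all charts because the Ricci tensor transforms
   tensorially. *)

(* No adapted frame is ever differentiated. A direct parametrization only provides a frame at each
   point separately, so frames serve to check pointwise identities, and what gets differentiated is
   the frame-free expression of [*phi]. The rules needed are therefore those for covariant
   derivatives along the map [x]: product rules for [inner] and [volume], and commutators equal to
   curvature. After differentiation, [nabla th] and [nabla nu] enter a purely algebraic argument as
   arrays [S] and [N], known only through the symmetry of [S] and the antisymmetric part of [N].
   Forms are alternating sums over permutations, so most cancellations come from a transposition
   fixing the summand or from a repeated index in a list of numbers, settled by computation. The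
   contraction produces [ricci] with its arguments in the other order, so its symmetry has to be
   established. Co-calibration speaks of parametrizations; to exploit it, one is built around every
   unit vector. It normalizes by a square root, and its smoothness is obtained from an algebra of
   functions stable under differentiation. *)
Require Import Defs.
From mathcomp Require Import all_boot all_order all_algebra fingroup perm.
From mathcomp Require Import all_classical all_reals all_analysis.
From mathcomp Require Import ring lra.

Set Implicit Arguments.
Unset Strict Implicit.
Unset Printing Implicit Defensive.
Import Order.TTheory GRing.Theory Num.Theory.
Import numFieldNormedType.Exports.
Local Open Scope classical_set_scope.
Local Open Scope ring_scope.

(** * Calculus of matrix-valued functions *)

Section Schwarz.
Variables (R : realType) (V : normedModType R).
Implicit Types (f : V -> R) (v w z : V).

Lemma is_derive_line f v z (s : R) : differentiable f (s *: v + z) ->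
  is_derive s 1 (fun t : R => f (t *: v + z)) ('D_v f (s *: v + z)).
Proof.
move=> df.
have aff : is_diff s (fun t : R => t *: v + z) (fun t => t *: v).
  have := is_diffD (is_diff_scalel s v) (is_diff_cst z s).
  by rewrite addr0.
have dc : is_diff s (f \o (fun t : R => t *: v + z))
     ('d f (s *: v + z) \o (fun t => t *: v)).
  by apply: is_diff_comp; exact: differentiableP.
apply: DeriveDef.
  exact/diff_derivable/(@ex_diff _ _ _ _ _ _ _ dc).
rewrite deriveE; last exact: (@ex_diff _ _ _ _ _ _ _ dc).
by rewrite (@diff_val _ _ _ _ _ _ _ dc)/= scale1r deriveE.
Qed.

(** The mean value theorem along [v], applied to the increment of [f] in direction [w], leaves a
    difference of two values of ['D_v f] near [z]. These are compared by the first-order expansion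
    of ['D_v f] at [z], so no continuity of second derivatives enters. *)
Lemma second_difference_le f v w z (e : R) : 0 < e ->
  (\forall y \near z, differentiable f y) -> differentiable ('D_v f) z ->
  \forall h \near 0^'+,
    `|f (h *: v + (h *: w + z)) - f (h *: w + z) - f (h *: v + z) + f z
      - h ^+ 2 * 'D_w ('D_v f) z| <= e * h ^+ 2.
Proof.
move=> e0 fd gd; set g := 'D_v f.
(* The two expansion errors are at most [e / C] times [h * (|v| + |w|)] and [h * |v|], which add up
   to less than [h * C]; the [1] keeps [C] positive. *)
pose C := 2 * `|v| + `|w| + 1.
have C0 : 0 < C by rewrite ltr_wpDl ?addr_ge0 ?mulr_ge0.
have e'0 : 0 < e / C by rewrite divr_gt0.
have /nbhs_ballP[d1 /= d10 gz] : \forall k \near (0 : V),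
    `|g (k + z) - g z - 'd g z k| <= e / C * `|k|.
  have /diff_locally := gd; rewrite -[g]/('D_v f).
  set o := 'o _ => gE.
  have /eqoP/(_ _ e'0) := littleo_eqo o.
  apply: filterS => k; have := congr1 (@^~ k) gE; rewrite /= => ->.
  rewrite -![(_ + _ : _ -> _) _]/(_ + _) /cst /=.
  by rewrite (_ : _ - 'd _ _ k = o k)//; ring.
have /nbhs_ballP[d2 /= d20 fz] := fd.
pose d := Num.min d1 d2.
have d0 : 0 < d by rewrite lt_min d10.
near=> h.
have h0 : 0 < h by near: h; exact: nbhs_right_gt.
have hd : h * C < d.
  by rewrite -ltr_pdivlMr//; near: h; apply: nbhs_right_lt; rewrite divr_gt0.
have small s a : 0 <= s <= h -> (a = 0 \/ a = h) ->
    `|s *: v + a *: w| <= h * (`|v| + `|w|).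
  move=> /andP[s0 sh] ab.
  rewrite (le_trans (ler_normD _ _))// !normrZ mulrDr lerD// ler_wpM2r//.
    by rewrite ger0_norm.
  by case: ab => ->; rewrite ?normr0 ?(ltW h0)// gtr0_norm.
have small2 : h * (`|v| + `|w|) < d.
  apply: le_lt_trans hd; rewrite ler_wpM2l ?(ltW h0)// /C.
  by have := normr_ge0 v; lra.
have fdiff s a : 0 <= s <= h -> (a = 0 \/ a = h) ->
    differentiable f (s *: v + (a *: w + z)).
  move=> sh ab; apply: fz; rewrite -ball_normE /ball_/= addrA opprD addrCA subrr addr0 normrN.
  apply: le_lt_trans (small _ _ sh ab) _; apply: lt_le_trans small2 _.
  by rewrite ge_min lexx orbT.
(* The increment in direction [w] as a function of the [v]-coordinate. Writing [0 *: w] gives both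
   terms the same shape, so that [fdiff] and [est] cover them at once. *)
pose k s := f (s *: v + (h *: w + z)) - f (s *: v + (0 *: w + z)).
have kd s : 0 <= s <= h -> is_derive s 1 k
    (g (s *: v + (h *: w + z)) - g (s *: v + (0 *: w + z))).
  move=> sh; apply: is_deriveB; apply: is_derive_line; apply: fdiff => //.
    by right.
  by left.
have kc : {within `[0, h], continuous k}.
  apply: derivable_within_continuous => s; rewrite in_itv/= => sh.
  exact: (@ex_derive _ _ _ _ _ _ _ (kd _ sh)).
have kd' s : s \in `]0, h[ -> is_derive s 1 k
    (g (s *: v + (h *: w + z)) - g (s *: v + (0 *: w + z))).
  by rewrite in_itv/= => /andP[s0 sh]; apply: kd; rewrite !ltW.
have [c] := MVT h0 kd' kc.
rewrite in_itv/= => /andP[c0 ch] kE.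
have ch' : 0 <= c <= h by rewrite !ltW.
have est a : (a = 0 \/ a = h) ->
    `|g (c *: v + (a *: w + z)) - g z - 'd g z (c *: v + a *: w)|
      <= e / C * `|c *: v + a *: w|.
  move=> ab; rewrite addrA; apply: gz.
  rewrite -ball_normE /ball_/= sub0r normrN.
  apply: le_lt_trans (small _ _ ch' ab) _; apply: lt_le_trans small2 _.
  by rewrite ge_min lexx.
have e1 := est h (or_intror erefl); have e2 := est 0 (or_introl erefl).
have -> : f (h *: v + (h *: w + z)) - f (h *: w + z) - f (h *: v + z) + f z
    = k h - k 0 by rewrite /k !scale0r !add0r; ring.
rewrite kE subr0 deriveE// -/g.
have lin : 'd g z (c *: v + h *: w) = 'd g z (c *: v + 0 *: w) + h * 'd g z w.
  by rewrite scale0r addr0 !linearD !linearZ.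
have -> : (g (c *: v + (h *: w + z)) - g (c *: v + (0 *: w + z))) * h
    - h ^+ 2 * 'd g z w
  = h * ((g (c *: v + (h *: w + z)) - g z - 'd g z (c *: v + h *: w))
         - (g (c *: v + (0 *: w + z)) - g z - 'd g z (c *: v + 0 *: w))).
  by rewrite lin; ring.
rewrite normrM (gtr0_norm h0) expr2 mulrCA ler_wpM2l ?(ltW h0)//.
apply: le_trans (ler_normB _ _) _; apply: le_trans (lerD e1 e2) _.
rewrite -mulrDr -mulrA ler_wpM2l ?(ltW e0)//.
rewrite ler_pdivrMl// mulrC.
apply: (@le_trans _ _ (h * (`|v| + `|w|) + h * `|v|)).
  apply: lerD; first exact: (small _ _ ch' (or_intror erefl)).
  by rewrite scale0r addr0 normrZ ger0_norm ?(ltW c0)// ler_wpM2r// ltW.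
rewrite -mulrDr ler_wpM2l ?(ltW h0)// /C; lra.
Unshelve. all: by end_near. Qed.

(** Young's form of the theorem. The second difference is symmetric in the two directions and lies
    within [e / 2 * h ^+ 2] of [h ^+ 2] times either mixed derivative. *)
Lemma Schwarz f v w z :
  (\forall y \near z, differentiable f y) ->
  differentiable ('D_v f) z -> differentiable ('D_w f) z ->
  'D_v ('D_w f) z = 'D_w ('D_v f) z.
Proof.
move=> fd dv dw; apply/eqP; rewrite eq_le; apply/andP.
suff le a b : differentiable ('D_a f) z -> differentiable ('D_b f) z ->
    'D_a ('D_b f) z <= 'D_b ('D_a f) z by split; exact: le.
move=> da db; apply/ler_addgt0Pl => e e0.
have e20 : 0 < e / 2 by rewrite divr_gt0.
have A := second_difference_le b e20 fd da.
have B := second_difference_le a e20 fd db.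
have [h [[h0 +] +]] := filter_ex (filterI (filterI (nbhs_right_gt 0) A) B).
have -> : h *: b + (h *: a + z) = h *: a + (h *: b + z) by rewrite addrCA.
have : 0 < h ^+ 2 by rewrite exprn_gt0.
move: ('D_a _ z) ('D_b _ z) (f _) (f _) (f _) (f _) (h ^+ 2) => p q a1 a2 a3 a4 k k0 {A B}.
rewrite !ler_norml => /andP[_ H2] /andP[H1 _].
by rewrite -(ler_pM2l k0); lra.
Qed.

End Schwarz.

Section MatrixDerivatives.
Variables (R : realType) (V : normedModType R).
Implicit Types (z v : V).

(** Most formulas for derivatives below hold only on an open set, so differentiability has to pass
    along equality of germs. The differential of [f] serves for [g]. *)
Lemma near_eq_differentiable (W : normedModType R) (f g : V -> W) z :
  {near z, f =1 g} -> differentiable f z -> differentiable g z.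
Proof.
move=> fg df; have dc : continuous ('d f z) by exact: diff_continuous.
have fgz : f z = g z by exact: nbhs_singleton fg.
have gE : g \o shift z = cst (g z) + 'd f z +o_ 0 id.
  apply/eqaddoP => e e0.
  have /eqaddoP/(_ e e0) := diff_locally df.
  have fg0 : \forall h \near (0 : V), f (h + z) = g (h + z).
    have /nbhs_ballP[d /= d0 fgd] := fg; apply/nbhs_ballP; exists d => // h.
    rewrite -!ball_normE /ball_/= sub0r normrN => hd; apply: fgd.
    by rewrite -ball_normE /ball_/= opprD addrCA subrr addr0 normrN.
  move=> H; move: fg0; apply: filterS2 H => h.
  rewrite -![(_ - _ : _ -> _) _]/(_ - _) -![(_ + _ : _ -> _) _]/(_ + _) /= /cst.
  by rewrite -fgz => + fgh; rewrite /= fgh.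
have dE := diff_unique dc gE.
by apply/diff_locallyP; rewrite dE.
Qed.

Lemma is_derive_mx m n (A : V -> 'M[R]_(m, n)) (dA : 'M[R]_(m, n)) z v :
  (forall i j, is_derive z v (fun y => A y i j) (dA i j)) ->
  is_derive z v A dA.
Proof.
move=> dAij.
have dv : derivable A z v.
  by apply/derivable_mxP => i j; exact: (@ex_derive _ _ _ _ _ _ _ (dAij i j)).
apply: DeriveDef => //; rewrite derive_mx//; apply/matrixP => i j; rewrite mxE.
exact: (@derive_val _ _ _ _ _ _ _ (dAij i j)).
Qed.

Lemma is_derive_entry m n (A : V -> 'M[R]_(m, n)) (dA : 'M[R]_(m, n)) z v i j :
  is_derive z v A dA -> is_derive z v (fun y => A y i j) (dA i j).
Proof.
case=> dv <-; rewrite derive_mx// mxE; apply: derivableP.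
exact/(derivable_mxP A z v).1.
Qed.

Lemma is_derive_bigsum (W : normedModType R) (I : Type) (r : seq I) (P : pred I)
    (f : I -> V -> W) (df : I -> W) z v :
  (forall i, is_derive z v (f i) (df i)) ->
  is_derive z v (fun y => \sum_(i <- r | P i) f i y) (\sum_(i <- r | P i) df i).
Proof.
move=> dfi; rewrite -fct_sumE.
by elim/big_ind2 : _ => // [|] *; [exact: is_derive_cst|exact: is_deriveD].
Qed.

Lemma is_deriveM' (f g : V -> R) (df dg : R) z v :
  is_derive z v f df -> is_derive z v g dg ->
  is_derive z v (fun y => f y * g y) (df * g z + f z * dg).
Proof.
move=> hf hg; apply: (is_derive_eq (is_deriveM hf hg)).
by rewrite /= addrC [df * _]mulrC.
Qed.

Lemma is_derive_mulmx m n p (A : V -> 'M[R]_(m, n)) (B : V -> 'M[R]_(n, p))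
    dA dB z v :
  is_derive z v A dA -> is_derive z v B dB ->
  is_derive z v (fun y => A y *m B y) (dA *m B z + A z *m dB).
Proof.
move=> hA hB; apply: is_derive_mx => i j.
rewrite (_ : (fun _ => _) = (fun y => \sum_k A y i k * B y k j)); last first.
  by apply/funext => y; rewrite mxE.
rewrite !mxE -big_split/=; apply: is_derive_bigsum => k.
by apply: is_deriveM'; exact: is_derive_entry.
Qed.

Lemma is_derive_trmx m n (A : V -> 'M[R]_(m, n)) dA z v :
  is_derive z v A dA -> is_derive z v (fun y => (A y)^T) dA^T.
Proof.
move=> hA; apply: is_derive_mx => i j; rewrite mxE.
by under eq_fun do rewrite mxE; exact: is_derive_entry.
Qed.

Lemma differentiable_bigsum (W : normedModType R) (I : Type) (r : seq I)
    (P : pred I) (f : I -> V -> W) z :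
  (forall i, differentiable (f i) z) ->
  differentiable (fun y => \sum_(i <- r | P i) f i y) z.
Proof.
move=> dfi; rewrite -fct_sumE.
elim/big_ind : _ => //.
by move=> *; exact: differentiableD.
Qed.

Lemma differentiable_bigprod (I : Type) (r : seq I)
    (P : pred I) (f : I -> V -> R) z :
  (forall i, differentiable (f i) z) ->
  differentiable (fun y => \prod_(i <- r | P i) f i y) z.
Proof.
move=> dfi; rewrite -fct_prodE.
elim/big_ind : _ => //.
by move=> *; exact: differentiableM.
Qed.

Lemma differentiable_mx m n (A : V -> 'M[R]_(m, n)) z :
  (forall i j, differentiable (fun y => A y i j) z) -> differentiable A z.
Proof.
move=> dA; rewrite (_ : A = (fun y => \sum_i \sum_j A y i j *: delta_mx i j)).
  do 2 apply: differentiable_bigsum => ?.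
  exact: differentiableZl.
by apply/funext => y; exact: matrix_sum_delta.
Qed.

Lemma differentiable_entry m n (A : V -> 'M[R]_(m, n)) z i j :
  differentiable A z -> differentiable (fun y => A y i j) z.
Proof.
move=> dA; apply: (@differentiable_comp _ _ _ _ A (fun N : 'M[R]_(m, n) => N i j)) => //.
exact: differentiable_coord.
Qed.

Lemma differentiable_det n (A : V -> 'M[R]_n) z :
  differentiable A z -> differentiable (fun y => \det (A y)) z.
Proof.
move=> dA; apply: differentiable_bigsum => s.
apply: differentiableM; first exact: differentiable_cst.
by apply: differentiable_bigprod => i; exact: differentiable_entry.
Qed.

Lemma differentiable_mulmx m n p (A : V -> 'M[R]_(m, n)) (B : V -> 'M[R]_(n, p)) z :
  differentiable A z -> differentiable B z ->
  differentiable (fun y => A y *m B y) z.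
Proof.
move=> dA dB; apply: differentiable_mx => i j.
under eq_fun do rewrite mxE.
apply: differentiable_bigsum => k.
by apply: differentiableM; exact: differentiable_entry.
Qed.

(** Cramer's rule: near [z] the inverse is the adjugate divided by the determinant, both polynomial
    in the entries. *)
Lemma differentiable_invmx n (A : V -> 'M[R]_n) z :
  differentiable A z -> (\forall y \near z, A y \in unitmx) ->
  differentiable (fun y => invmx (A y)) z.
Proof.
move=> dA uA.
apply: (@near_eq_differentiable _ (fun y => (\det (A y))^-1 *: \adj (A y))).
  by near=> y; rewrite /invmx ifT//; near: y.
have := nbhs_singleton uA; rewrite unitmxE unitfE => d0.
apply: differentiable_mx => i j; under eq_fun do rewrite !mxE.
apply: differentiableM; first by apply: differentiableV => //; exact: differentiable_det.
apply: differentiableM; first exact: differentiable_cst.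
apply: differentiable_det; apply: differentiable_mx => k l.
by under eq_fun do rewrite !mxE; exact: differentiable_entry.
Unshelve. all: by end_near. Qed.

Lemma is_derive_bigprod (I : finType) (f : I -> V -> R) (df : I -> R) z v :
  (forall i, is_derive z v (f i) (df i)) ->
  is_derive z v (fun y => \prod_i f i y)
    (\sum_k \prod_i (if i == k then df i else f i z)).
Proof.
move=> hf.
(* The induction is restricted to lists without repetition: at a repeated index the test [i == k]
   would replace several factors at once. *)
have H (r : seq I) : uniq r ->
    is_derive z v (fun y => \prod_(i <- r) f i y)
    (\sum_(k <- r) \prod_(i <- r) (if i == k then df i else f i z)).
  elim: r => [_|i r IH /= /andP[ir ur]].
    under eq_fun do rewrite big_nil; rewrite big_nil; exact: is_derive_cst.
  under eq_fun do rewrite big_cons.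
  apply: (is_derive_eq (is_deriveM' (hf i) (IH ur))).
  rewrite big_cons big_cons eqxx; congr (_ * _ + _).
    rewrite !big_seq; apply: eq_bigr => j jr.
    by case: eqP => // ji; rewrite -ji jr in ir.
  rewrite big_distrr/= !big_seq; apply: eq_bigr => j jr.
  by rewrite big_cons; case: eqP => // ij; rewrite ij jr in ir.
exact: H (index_enum_uniq _).
Qed.

Lemma is_derive_det n (A : V -> 'M[R]_n) dA z v :
  is_derive z v A dA ->
  is_derive z v (fun y => \det (A y))
    (\sum_k \det (\matrix_i (if i == k then row i dA else row i (A z)))).
Proof.
move=> hA; rewrite /determinant exchange_big/=.
apply: is_derive_bigsum => s; rewrite -big_distrr/=.
rewrite (_ : (fun y => _) = (fun y => (-1) ^+ s *: \prod_i A y i (s i))); last first.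
  by apply/funext.
apply: (@is_deriveZ _ _ _ (fun y => \prod_i A y i (s i))).
have := @is_derive_bigprod _ (fun i y => A y i (s i)) (fun i => dA i (s i)) z v.
move=> /(_ (fun i => is_derive_entry i (s i) hA)) H.
apply: (is_derive_eq H); apply: eq_bigr => k _; apply: eq_bigr => i _.
by rewrite !mxE; case: ifP; rewrite mxE.
Qed.

End MatrixDerivatives.

Lemma is_derive_comp_diff (R : realType) (U V W : normedModType R)
    (f : V -> W) (x : U -> V) z v :
  differentiable x z -> differentiable f (x z) ->
  is_derive z v (f \o x) ('D_('D_v x z) f (x z)).
Proof.
move=> dx df; have dfx : differentiable (f \o x) z by exact: differentiable_comp.
apply: DeriveDef; first exact: diff_derivable.
by rewrite !deriveE// diff_comp.
Qed.

(** With the product rule above, this is Jacobi's formula: expanding the [k]-th summand along its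
    replaced row gives the [k]-th diagonal entry of [B *m \adj A]. *)
Lemma det_replace_tr (R : comNzRingType) n (A B : 'M[R]_n) :
  \sum_k \det (\matrix_i (if i == k then row i B else row i A))
  = \tr (B *m \adj A).
Proof.
rewrite /mxtrace; apply: eq_bigr => k _.
rewrite (expand_det_row _ k) mxE; apply: eq_bigr => j _.
rewrite !mxE eqxx mxE; congr (_ * _); rewrite /cofactor; congr (_ * \det _).
apply/matrixP => a b; rewrite !mxE.
by rewrite eq_sym (negbTE (neq_lift _ _)) mxE.
Qed.

Lemma is_derive_diff (R : realType) (U V : normedModType R) (f : V -> U) v z :
  differentiable f z -> is_derive z v f ('D_v f z).
Proof. by move=> df; exact/derivableP/diff_derivable. Qed.

(** * Connection and curvature in a chart *)

Lemma Schwarz_mx (R : realType) (V : normedModType R) m n (f : V -> 'M[R]_(m, n))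
    v w z :
  (\forall y \near z, differentiable f y) ->
  differentiable ('D_v f) z -> differentiable ('D_w f) z ->
  'D_v ('D_w f) z = 'D_w ('D_v f) z.
Proof.
move=> fd dv dw.
have entryE u : \forall y \near z, forall i j, 'D_u f y i j = 'D_u (fun y => f y i j) y.
  near=> y => i j; rewrite derive_mx ?mxE//; apply: diff_derivable; near: y; exact: fd.
have entry_diff u i j : differentiable ('D_u f) z ->
    differentiable ('D_u (fun y => f y i j)) z.
  move=> du; apply: (@near_eq_differentiable _ _ _ (fun y => 'D_u f y i j)).
    by near=> y; rewrite (near (entryE u) y).
  exact: differentiable_entry.
have DDE u1 u2 i j : differentiable ('D_u2 f) z ->
    'D_u1 ('D_u2 f) z i j = 'D_u1 ('D_u2 (fun y => f y i j)) z.
  move=> du2; rewrite derive_mx ?mxE; last exact: diff_derivable.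
  apply: near_eq_derive; near=> y; exact: (near (entryE u2) y).
apply/matrixP => i j; have fdij : \forall y \near z, differentiable (fun y => f y i j) y.
  by apply: filterS fd => y; exact: differentiable_entry.
have E := Schwarz fdij (entry_diff _ i j dv) (entry_diff _ i j dw).
exact: etrans (etrans (DDE v w i j dw) E) (esym (DDE w v i j dv)).
Unshelve. all: by end_near. Qed.

(** * Koszul's formula and the Christoffel symbols *)

Section Koszul.
Variables (R : realType) (n : nat) (d : 'rV[R]_n -> 'M[R]_n).
Implicit Types (v w a b c : 'rV[R]_n).

(** The value that [<nabla_v w, c>] must have on constant fields. Here [d v] stands for the
    derivative of the metric along [v], kept abstract so that the algebra is free of calculus. *)
Definition koszul v w c : R := 2^-1 * ((w *m d v *m c^T) 0 0
  + (v *m d w *m c^T) 0 0 - (v *m d c *m w^T) 0 0).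

Lemma scalar_mx_sym (A : 'M[R]_n) a b : A^T = A ->
  (a *m A *m b^T) 0 0 = (b *m A *m a^T) 0 0.
Proof.
move=> As; transitivity ((a *m A *m b^T)^T 0 0); first by rewrite [RHS]mxE.
by rewrite !trmx_mul trmxK As mulmxA.
Qed.

Hypothesis d_sym : forall v, (d v)^T = d v.
Hypothesis dD : forall v w, d (v + w) = d v + d w.
Hypothesis dZ : forall k v, d (k *: v) = k *: d v.

Lemma koszulC v w c : koszul v w c = koszul w v c.
Proof.
by rewrite /koszul (scalar_mx_sym v w (d_sym c)) [X in X - _]addrC.
Qed.

Lemma koszulDr v a b c : koszul v (a + b) c = koszul v a c + koszul v b c.
Proof.
rewrite /koszul dD (_ : (a + b)^T = a^T + b^T); last exact: linearD.
rewrite !(mulmxDl, mulmxDr).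
rewrite [(a *m _ *m _ + _) 0 0]mxE [(v *m d a *m _ + _) 0 0]mxE.
by rewrite [(v *m d c *m _ + _) 0 0]mxE; ring.
Qed.

Lemma koszulZr v k a c : koszul v (k *: a) c = k * koszul v a c.
Proof.
rewrite /koszul dZ (_ : (k *: a)^T = k *: a^T); last exact: linearZ.
rewrite -!(scalemxAl, scalemxAr).
rewrite [(_ *: (a *m _ *m _)) 0 0]mxE [(_ *: (v *m d a *m _)) 0 0]mxE.
by rewrite [(_ *: (v *m d c *m _)) 0 0]mxE; ring.
Qed.

(** The algebraic source of metric compatibility: [koszul v a b] plays the role of
    [<nabla_v a, b>]. *)
Lemma koszul_metric v a b :
  (a *m d v *m b^T) 0 0 = koszul v a b + koszul v b a.
Proof.
by rewrite /koszul (scalar_mx_sym b a (d_sym v)); field.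
Qed.

End Koszul.

(** The set [D] is a parameter because the same results are applied on whole chart images and on
    overlaps of two charts. The positive determinant allows both inverting [g] and taking the volume
    density. *)
Record local_metric (R : realType) (n : nat) (g : 'rV[R]_n -> 'M[R]_n)
    (D : set 'rV[R]_n) : Prop := LocalMetric {
  local_open : open D;
  local_smooth : smooth_on D g;
  local_sym : forall x, D x -> (g x)^T = g x;
  local_det : forall x, D x -> 0 < \det (g x)
}.

Section Christoffel.
Variables (R : realType) (n : nat) (g : 'rV[R]_n -> 'M[R]_n) (D : set 'rV[R]_n).
Hypothesis gD : local_metric g D.
Implicit Types (x v w a b : 'rV[R]_n).

Lemma nearD x : D x -> \forall y \near x, D y.
Proof. by move=> Dx; exact: open_nbhs_nbhs (conj (local_open gD) Dx). Qed.

Lemma metric_diff x : D x -> differentiable g x.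
Proof. by move=> Dx; exact: (local_smooth gD [::] Dx). Qed.

Lemma metric_diff2 x v : D x -> differentiable ('D_v g) x.
Proof. by move=> Dx; exact: (local_smooth gD [:: v] Dx). Qed.

Lemma derive_inner x v a b : D x ->
  'D_v (inner g a b) x = (a *m 'D_v g x *m b^T) 0 0.
Proof.
move=> Dx; apply: derive_val; apply: is_derive_entry.
have hg : is_derive x v g ('D_v g x) by apply/derivableP/diff_derivable/metric_diff.
apply: (is_derive_eq (is_derive_mulmx (is_derive_mulmx (is_derive_cst a x v) hg)
  (is_derive_cst b^T x v))).
by rewrite mul0mx add0r mulmx0 addr0.
Qed.

Lemma derive_metric_sym x v : D x -> ('D_v g x)^T = 'D_v g x.
Proof.
move=> Dx; have hg : is_derive x v g ('D_v g x).
  by apply/derivableP/diff_derivable/metric_diff.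
have /@derive_val <- := is_derive_trmx hg.
by apply: near_eq_derive; apply: filterS (nearD Dx) => y; exact: (local_sym gD).
Qed.

Lemma metric_unit x : D x -> g x \in unitmx.
Proof. by move=> Dx; rewrite unitmxE unitfE lt0r_neq0// (local_det gD). Qed.

Lemma inner_sym x a b : D x -> inner g a b x = inner g b a x.
Proof. by move=> Dx; apply: scalar_mx_sym; exact: (local_sym gD). Qed.

Lemma derive_metricDv x v w : D x -> 'D_(v + w) g x = 'D_v g x + 'D_w g x.
Proof. by move=> Dx; rewrite !deriveE ?linearD//; exact: metric_diff. Qed.

Lemma derive_metricZ x (k : R) v : D x -> 'D_(k *: v) g x = k *: 'D_v g x.
Proof. by move=> Dx; rewrite !deriveE ?linearZ//; exact: metric_diff. Qed.

Lemma derive_metric_delta x v : D x ->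
  'D_v g x = \sum_i v 0 i *: 'D_(delta_mx 0 i) g x.
Proof.
move=> Dx; rewrite deriveE; last exact: metric_diff.
rewrite {1}(row_sum_delta v) linear_sum; apply: eq_bigr => i _.
by rewrite linearZ/= deriveE//; exact: metric_diff.
Qed.

(** Pairing with [b] cancels the factor [invmx (g x)] of the definition; the components on basis
    vectors add up to the value at [b] because the derivative of [g] is linear in its direction. *)
Lemma christoffel_koszul x v w b : D x ->
  inner g (christoffel g x v w) b x = koszul (fun u => 'D_u g x) v w b.
Proof.
move=> Dx.
rewrite /inner /christoffel mulmxKV ?metric_unit// -scalemxAl mxE; congr (_ * _).
rewrite (derive_metric_delta b Dx) mulmx_sumr mulmx_suml summxE.
have -> : (\row_l ('D_v (inner g w (delta_mx 0 l)) x
      + 'D_w (inner g v (delta_mx 0 l)) x - 'D_(delta_mx 0 l) (inner g v w) x))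
   = \row_l ((w *m 'D_v g x *m (delta_mx 0 l : 'rV[R]_n)^T) 0 0
      + (v *m 'D_w g x *m (delta_mx 0 l : 'rV[R]_n)^T) 0 0
      - (v *m 'D_(delta_mx 0 l) g x *m w^T) 0 0).
  apply: eq_mx => i l; congr (_ + _ - _); exact: derive_inner.
move: ('D_v g x) ('D_w g x) (fun l : 'I_n => 'D_(delta_mx 0 l) g x) => P Q S.
have col0 (c : 'rV[R]_n) (A : 'M[R]_n) :
    (c *m A *m b^T) 0 0 = \sum_l (c *m A *m (delta_mx 0 l : 'rV[R]_n)^T) 0 0 * b 0 l.
  rewrite mxE; apply: eq_bigr => l _; rewrite trmx_delta -colE [in RHS]mxE.
  by rewrite [b^T _ _]mxE.
rewrite mxE (col0 w) (col0 v) -sumrN -!big_split/=.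
apply: eq_bigr => l _; rewrite [b^T _ _]mxE [X in X * _]mxE.
rewrite -scalemxAr -scalemxAl [X in _ = _ - X]mxE; ring.
Qed.

Lemma inner_eqP x a b : D x -> (forall c, inner g a c x = inner g b c x) -> a = b.
Proof.
move=> Dx ab; have gx := metric_unit Dx.
rewrite -[a](mulmxK gx) -[b](mulmxK gx); congr (_ *m _).
apply/rowP => l; have := ab (delta_mx 0 l : 'rV[R]_n).
by rewrite /inner trmx_delta -!colE !mxE.
Qed.

Lemma innerDl x a b c : inner g (a + b) c x = inner g a c x + inner g b c x.
Proof. by rewrite /inner !mulmxDl mxE. Qed.

Lemma innerZl x k a c : inner g (k *: a) c x = k * inner g a c x.
Proof. by rewrite /inner -!scalemxAl mxE. Qed.

Lemma christoffelC x v w : D x -> christoffel g x v w = christoffel g x w v.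
Proof.
move=> Dx; apply: (inner_eqP Dx) => c.
apply: etrans (christoffel_koszul v w c Dx) _.
apply: etrans _ (esym (christoffel_koszul w v c Dx)).
by apply: koszulC => u; exact: derive_metric_sym.
Qed.

Lemma christoffelDr x v a b : D x ->
  christoffel g x v (a + b) = christoffel g x v a + christoffel g x v b.
Proof.
move=> Dx; apply: (inner_eqP Dx) => c.
apply: etrans (christoffel_koszul v (a + b) c Dx) _.
apply: etrans _ (esym (innerDl _ _ _ _)).
apply: etrans _ (esym (congr2 +%R (christoffel_koszul v a c Dx)
  (christoffel_koszul v b c Dx))).
by apply: koszulDr => u t; exact: derive_metricDv.
Qed.

Lemma christoffelZr x v k a : D x ->
  christoffel g x v (k *: a) = k *: christoffel g x v a.
Proof.
move=> Dx; apply: (inner_eqP Dx) => c.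
apply: etrans (christoffel_koszul v (k *: a) c Dx) _.
apply: etrans _ (esym (innerZl _ _ _ _)).
apply: etrans _ (esym (congr1 ( *%R k) (christoffel_koszul v a c Dx))).
by apply: koszulZr => u t; exact: derive_metricZ.
Qed.

Lemma christoffelDl x v w a : D x ->
  christoffel g x (v + w) a = christoffel g x v a + christoffel g x w a.
Proof.
move=> Dx; rewrite (christoffelC (v + w) a Dx) (christoffelC v a Dx).
by rewrite (christoffelC w a Dx) (christoffelDr a v w Dx).
Qed.

Lemma christoffelZl x k v a : D x ->
  christoffel g x (k *: v) a = k *: christoffel g x v a.
Proof.
move=> Dx; rewrite (christoffelC (k *: v) a Dx) (christoffelC v a Dx).
exact: christoffelZr.
Qed.

Lemma christoffel0l x a : D x -> christoffel g x 0 a = 0.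
Proof. by move=> Dx; have := christoffelZl 0 0 a Dx; rewrite !scale0r. Qed.

Lemma christoffel0r x a : D x -> christoffel g x a 0 = 0.
Proof. by move=> Dx; rewrite (christoffelC a 0 Dx) (christoffel0l a Dx). Qed.

Lemma derive_metric x v a b : D x -> (a *m 'D_v g x *m b^T) 0 0 =
  inner g (christoffel g x v a) b x + inner g a (christoffel g x v b) x.
Proof.
move=> Dx; have E := inner_sym (christoffel g x v b) a Dx.
apply: etrans _ (congr1 (fun t => inner g (christoffel g x v a) b x + t) E).
apply: etrans _ (esym (congr2 +%R (christoffel_koszul v a b Dx)
  (christoffel_koszul v b a Dx))).
by apply: koszul_metric => u; exact: derive_metric_sym.
Qed.

Lemma christoffel_sumr x v (I : Type) (r : seq I) (P : pred I) (f : I -> 'rV_n) :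
  D x -> christoffel g x v (\sum_(i <- r | P i) f i)
    = \sum_(i <- r | P i) christoffel g x v (f i).
Proof.
move=> Dx; elim/big_rec2: _ => [|i a b _ <-]; first exact: christoffel0r.
exact: christoffelDr.
Qed.

(** The connection matrix in direction [v], acting on rows from the right. *)
Definition christoffel_mx x v : 'M[R]_n :=
  \matrix_i christoffel g x v (delta_mx 0 i).

Lemma christoffel_mxE x v w : D x -> christoffel g x v w = w *m christoffel_mx x v.
Proof.
move=> Dx; rewrite {1}(row_sum_delta w) (christoffel_sumr _ _ _ _ Dx) mulmx_sum_row.
by apply: eq_bigr => i _; rewrite rowK christoffelZr.
Qed.

Lemma christoffel_mxl x v w : D x ->
  christoffel g x v w = v *m \matrix_i christoffel g x (delta_mx 0 i) w.
Proof.
move=> Dx; have E : \matrix_i christoffel g x (delta_mx 0 i) w = christoffel_mx x w.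
  apply: eq_mx => i j.
  exact: (congr1 (fun r : 'rV_n => r 0 j) (christoffelC (delta_mx 0 i) w Dx)).
by rewrite E; exact: etrans (christoffelC v w Dx) (christoffel_mxE w v Dx).
Qed.

(** Separates the dependence on the point from that on the two vectors, so that the product and
    chain rules apply when all three vary along a map. *)
Lemma christoffel_delta x v w : D x -> christoffel g x v w =
  \sum_i \sum_j (v 0 i * w 0 j) *: christoffel g x (delta_mx 0 i) (delta_mx 0 j).
Proof.
move=> Dx; rewrite {1}(row_sum_delta v) (christoffelC _ _ Dx) (christoffel_sumr _ _ _ _ Dx).
apply: eq_bigr => i _; rewrite (christoffelZr _ _ _ Dx) (christoffelC _ _ Dx).
rewrite {1}(row_sum_delta w) (christoffel_sumr _ _ _ _ Dx) scaler_sumr.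
by apply: eq_bigr => j _; rewrite (christoffelZr _ _ _ Dx) scalerA.
Qed.

Lemma christoffel_diff x v w : D x ->
  differentiable (fun y => christoffel g y v w) x.
Proof.
move=> Dx; rewrite /christoffel; apply: differentiable_mulmx; last first.
  apply: differentiable_invmx; first exact: metric_diff.
  by apply: filterS (nearD Dx) => y; exact: metric_unit.
have di c a b : differentiable (fun y => 'D_c (inner g a b) y) x.
  apply: (@near_eq_differentiable _ _ _ (fun y => (a *m 'D_c g y *m b^T) 0 0)).
    by apply: filterS (nearD Dx) => y Dy; rewrite (derive_inner c a b Dy).
  apply: differentiable_entry; apply: differentiable_mulmx; last exact: differentiable_cst.
  apply: differentiable_mulmx; first exact: differentiable_cst.
  exact: metric_diff2.
apply: differentiableZ; apply: differentiable_mx => i j.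
under eq_fun do rewrite mxE.
by apply: differentiableB => //; apply: differentiableD.
Qed.

End Christoffel.

(** * Covariant derivatives along a map *)

Section AlongMap.
Variables (R : realType) (n : nat) (g : 'rV[R]_n -> 'M[R]_n) (D : set 'rV[R]_n).
Hypothesis gD : local_metric g D.
Variables (V : normedModType R).
Implicit Types (x s t : V -> 'rV[R]_n) (z W Z : V) (p v w a b : 'rV[R]_n).

(* [nabla_W s] for the vector field [s] along the map [x]. *)
Definition cov x s W z : 'rV[R]_n :=
  'D_W s z + christoffel g (x z) ('D_W x z) (s z).

Lemma near_map x z : differentiable x z -> D (x z) -> \forall y \near z, D (x y).
Proof.
move=> dx Dx; have := differentiable_continuous dx; apply.
exact: nearD gD _ Dx.
Qed.

Lemma is_derive_metric x W z : differentiable x z -> D (x z) ->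
  is_derive z W (fun y => g (x y)) ('D_('D_W x z) g (x z)).
Proof. by move=> dx Dx; apply: is_derive_comp_diff => //; exact: metric_diff gD _ Dx. Qed.

(** The derivative of the Gram matrix splits by [derive_metric] into two Christoffel terms, which
    complete the ordinary derivatives of [s] and [t] to covariant ones. *)
Lemma is_derive_inner x s t W z : differentiable x z -> D (x z) ->
  differentiable s z -> differentiable t z ->
  is_derive z W (fun y => inner g (s y) (t y) (x y))
    (inner g (cov x s W z) (t z) (x z) + inner g (s z) (cov x t W z) (x z)).
Proof.
move=> dx Dx /(is_derive_diff W) ds /(is_derive_diff W) dt.
have dg := is_derive_metric W dx Dx.
have H := is_derive_entry 0 0 (is_derive_mulmx (is_derive_mulmx ds dg)
  (is_derive_trmx dt)).
apply: (is_derive_eq H); rewrite /cov.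
have := derive_metric gD ('D_W x z) (s z) (t z) Dx.
move: ('D_('D_W x z) g (x z)) (christoffel _ _ _ (s z)) (christoffel _ _ _ (t z))
  ('D_W s z) ('D_W t z) => dgx cs ct s' t'.
rewrite /inner linearD/= !(mulmxDl, mulmxDr) => E.
have DE (A B : 'M[R]_1) : (A + B) 0 0 = A 0 0 + B 0 0 by rewrite mxE.
by rewrite !DE E; ring.
Qed.

Lemma derive_christoffel_delta p v a b : D p ->
  'D_v (fun q => christoffel g q a b) p =
  \sum_i \sum_j (a 0 i * b 0 j) *:
    'D_v (fun q => christoffel g q (delta_mx 0 i) (delta_mx 0 j)) p.
Proof.
move=> Dp; apply: derive_val.
apply: (@near_eq_is_derive _ _ _ (fun q => \sum_i \sum_j (a 0 i * b 0 j) *: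
    christoffel g q (delta_mx 0 i) (delta_mx 0 j))).
  by apply: filterS (nearD gD Dp) => q Dq; rewrite [RHS](christoffel_delta gD _ _ Dq).
apply: is_derive_bigsum => i; apply: is_derive_bigsum => j.
apply: (@is_deriveZ _ _ _ (fun q => christoffel g q (delta_mx 0 i) (delta_mx 0 j))).
exact: is_derive_diff (christoffel_diff gD _ _ Dp).
Qed.

Lemma is_derive_christoffel x s t W z : differentiable x z -> D (x z) ->
  differentiable s z -> differentiable t z ->
  is_derive z W (fun y => christoffel g (x y) (s y) (t y))
    ('D_('D_W x z) (fun q => christoffel g q (s z) (t z)) (x z)
     + christoffel g (x z) ('D_W s z) (t z)
     + christoffel g (x z) (s z) ('D_W t z)).
Proof.
move=> dx Dx /(is_derive_diff W) ds /(is_derive_diff W) dt.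
rewrite (derive_christoffel_delta _ _ _ Dx) (christoffel_delta gD _ (t z) Dx).
rewrite (christoffel_delta gD (s z) _ Dx) -!big_split/=.
apply: (@near_eq_is_derive _ _ _ (fun y => \sum_i \sum_j (s y 0 i * t y 0 j) *:
    christoffel g (x y) (delta_mx 0 i) (delta_mx 0 j))).
  by apply: filterS (near_map dx Dx) => y Dy; rewrite [RHS](christoffel_delta gD _ _ Dy).
apply: is_derive_bigsum => i; rewrite -!big_split/=; apply: is_derive_bigsum => j.
set K := fun q => christoffel g q (delta_mx 0 i) (delta_mx 0 j).
have dK : is_derive z W (fun y => K (x y)) ('D_('D_W x z) K (x z)).
  apply: is_derive_comp_diff => //; exact: (christoffel_diff gD _ _ Dx).
apply: is_derive_mx => k l; rewrite [k]ord1.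
rewrite (_ : (fun y => _) = (fun y => s y 0 i * t y 0 j * K (x y) 0 l)); last first.
  by apply/funext => y; rewrite mxE.
have H := is_deriveM' (is_deriveM' (is_derive_entry 0 i ds) (is_derive_entry 0 j dt))
  (is_derive_entry 0 l dK).
apply: (is_derive_eq H); rewrite -/(K (x z)).
move: ('D_W s z) ('D_W t z) ('D_('D_W x z) K (x z)) (K (x z)) => s' t' k1 k2.
by rewrite !mxE; ring.
Qed.

Lemma christoffel_along_diff x s t z : differentiable x z -> D (x z) ->
  differentiable s z -> differentiable t z ->
  differentiable (fun y => christoffel g (x y) (s y) (t y)) z.
Proof.
move=> dx Dx ds dt.
apply: (@near_eq_differentiable _ _ _ (fun y => \sum_i \sum_j (s y 0 i * t y 0 j) *:
    christoffel g (x y) (delta_mx 0 i) (delta_mx 0 j))).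
  by apply: filterS (near_map dx Dx) => y Dy; exact: esym (christoffel_delta gD _ _ Dy).
apply: differentiable_bigsum => i; apply: differentiable_bigsum => j.
have dK : differentiable (fun y => christoffel g (x y) (delta_mx 0 i) (delta_mx 0 j)) z.
  apply: (@differentiable_comp _ _ _ _ x
    (fun q => christoffel g q (delta_mx 0 i) (delta_mx 0 j))) => //.
  exact: (christoffel_diff gD _ _ Dx).
apply: differentiable_mx => k l.
rewrite (_ : (fun y => _) = (fun y => s y 0 i * t y 0 j *
    christoffel g (x y) (delta_mx 0 i) (delta_mx 0 j) k l)); last first.
  by apply/funext => y; rewrite mxE.
by apply: differentiableM; [apply: differentiableM|]; exact: differentiable_entry.
Qed.

Lemma cov_differentiable x s Z z : differentiable x z -> D (x z) ->
  differentiable ('D_Z x) z -> differentiable s z -> differentiable ('D_Z s) z ->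
  differentiable (cov x s Z) z.
Proof.
by move=> dx Dx dZx ds dZs; apply: differentiableD => //; exact: christoffel_along_diff.
Qed.

(** Constant fields commute and have zero ordinary derivative, so the bracket term drops out and
    [nabla] reduces to [christoffel]. *)
Lemma curvature_cst p v w a : D p ->
  curvature g (cst v) (cst w) (cst a) p =
   'D_v (fun q => christoffel g q w a) p + christoffel g p v (christoffel g p w a)
   - ('D_w (fun q => christoffel g q v a) p
      + christoffel g p w (christoffel g p v a)).
Proof.
move=> Dp; rewrite /curvature.
have nab c : nabla g (cst c) (cst a) = (fun q => christoffel g q c a).
  by apply/funext => q; rewrite /nabla derive_cst add0r.
have lie : lie_bracket (cst v) (cst w) p = 0 by rewrite /lie_bracket !derive_cst subrr.
have -> : nabla g (lie_bracket (cst v) (cst w)) (cst a) p = 0.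
  by rewrite /nabla derive_cst add0r lie (christoffel0l gD _ Dp).
by rewrite subr0 !nab.
Qed.

Lemma cov_diff x s Z z : differentiable x z -> D (x z) ->
  differentiable ('D_Z x) z -> differentiable s z -> differentiable ('D_Z s) z ->
  forall W, is_derive z W (cov x s Z) ('D_W ('D_Z s) z +
    ('D_('D_W x z) (fun q => christoffel g q ('D_Z x z) (s z)) (x z)
     + christoffel g (x z) ('D_W ('D_Z x) z) (s z)
     + christoffel g (x z) ('D_Z x z) ('D_W s z))).
Proof.
move=> dx Dx dZx ds dZs W.
apply: is_deriveD; first exact: is_derive_diff.
exact: is_derive_christoffel.
Qed.

(** The directions [W] and [Z] are constant, so no bracket appears. Second derivatives of [x] and of
    [s] cancel by [Schwarz_mx], the terms with one derivative of [s] cancel in pairs, and what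
    remains is the curvature on constant fields. This covers both the curvature of [u] along a
    parametrization and the change of chart. *)
Lemma curvature_along x s W Z z : D (x z) ->
  (\forall y \near z, differentiable x y) ->
  (\forall y \near z, differentiable s y) ->
  differentiable ('D_Z x) z -> differentiable ('D_W x) z ->
  differentiable ('D_Z s) z -> differentiable ('D_W s) z ->
  cov x (cov x s Z) W z - cov x (cov x s W) Z z =
  curvature g (cst ('D_W x z)) (cst ('D_Z x z)) (cst (s z)) (x z).
Proof.
move=> Dx ndx nds dZx dWx dZs dWs.
have dx := nbhs_singleton ndx; have ds := nbhs_singleton nds.
have F W' Z' : differentiable ('D_Z' x) z -> differentiable ('D_Z' s) z ->
    cov x (cov x s Z') W' z = 'D_W' ('D_Z' s) z +
    ('D_('D_W' x z) (fun q => christoffel g q ('D_Z' x z) (s z)) (x z)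
     + christoffel g (x z) ('D_W' ('D_Z' x) z) (s z)
     + christoffel g (x z) ('D_Z' x z) ('D_W' s z))
    + (christoffel g (x z) ('D_W' x z) ('D_Z' s z)
      + christoffel g (x z) ('D_W' x z) (christoffel g (x z) ('D_Z' x z) (s z))).
  move=> dZ'x dZ's; apply: (congr2 +%R); last exact: (christoffelDr gD _ _ _ Dx).
  exact: (@derive_val _ _ _ _ _ _ _ (cov_diff dx Dx dZ'x ds dZ's W')).
apply: etrans (congr2 (fun a b => a - b) (F W Z dZx dZs) (F Z W dWx dWs)) _.
apply: etrans _ (esym (curvature_cst _ _ _ Dx)).
have Ex := Schwarz_mx ndx dWx dZx; have Es := Schwarz_mx nds dWs dZs.
move: Ex Es.
generalize ('D_W ('D_Z s) z) ('D_Z ('D_W s) z) ('D_W ('D_Z x) z) ('D_Z ('D_W x) z).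
move=> A1 A2 B1 B2 -> -> {F}.
generalize ('D_('D_W x z) (fun q => christoffel g q ('D_Z x z) (s z)) (x z)).
generalize ('D_('D_Z x z) (fun q => christoffel g q ('D_W x z) (s z)) (x z)).
generalize (christoffel g (x z) B1 (s z)).
generalize (christoffel g (x z) ('D_W x z) ('D_Z s z)).
generalize (christoffel g (x z) ('D_Z x z) ('D_W s z)).
generalize (christoffel g (x z) ('D_W x z) (christoffel g (x z) ('D_Z x z) (s z))).
generalize (christoffel g (x z) ('D_Z x z) (christoffel g (x z) ('D_W x z) (s z))).
clear => P1 P2 P3 P4 P5 P6 P7; apply/rowP => i; rewrite !mxE; ring.
Qed.

End AlongMap.

(** * The volume form along a map *)

Section VolumeAlong.
Variables (R : realType) (n : nat) (g : 'rV[R]_n -> 'M[R]_n) (D : set 'rV[R]_n).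
Hypothesis gD : local_metric g D.
Variables (V : normedModType R).

(** Metric compatibility reads [dg = G *m g + g *m G^T] with [G] the connection matrix, so Jacobi's
    formula gives [2 * det g * tr G] for the derivative of [det g]; the square root removes the
    factor 2. *)
Lemma is_derive_sqrt_det (x : V -> 'rV[R]_n) W z : differentiable x z -> D (x z) ->
  is_derive z W (fun y => Num.sqrt (\det (g (x y))))
    (Num.sqrt (\det (g (x z))) * \tr (christoffel_mx g (x z) ('D_W x z))).
Proof.
move=> dx Dx; have dg := is_derive_metric gD W dx Dx.
set G := christoffel_mx _ _ _.
have dgE : 'D_('D_W x z) g (x z) = G *m g (x z) + g (x z) *m G^T.
  apply/matrixP => i j.
  have := derive_metric gD ('D_W x z) (delta_mx 0 i) (delta_mx 0 j) Dx.
  have -> := christoffel_mxE gD ('D_W x z) (delta_mx 0 i) Dx.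
  have -> := christoffel_mxE gD ('D_W x z) (delta_mx 0 j) Dx.
  rewrite -/G /inner.
  generalize ('D_('D_W x z) g (x z)) (g (x z)) G => P Q S.
  have E (A : 'M[R]_n) : ((delta_mx 0 i : 'rV_n) *m A *m (delta_mx 0 j : 'rV_n)^T) 0 0 = A i j.
    by rewrite trmx_delta -rowE -colE !mxE.
  rewrite E trmx_mul !mulmxA.
  rewrite -(mulmxA _ S Q) -(mulmxA _ Q S^T) !E => ->.
  by rewrite !mxE.
have d0 := local_det gD Dx.
have dd := is_derive_det dg.
rewrite det_replace_tr dgE mulmxDl raddfD/= in dd.
have trG : \tr (G *m g (x z) *m \adj (g (x z)) + g (x z) *m G^T *m \adj (g (x z)))
    = 2 * \det (g (x z)) * \tr G.
  rewrite raddfD/= -mulmxA mul_mx_adj mxtrace_mulC mul_scalar_mx mxtraceZ.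
  rewrite [X in _ + X]mxtrace_mulC mulmxA mul_adj_mx mul_scalar_mx mxtraceZ mxtrace_tr.
  by ring.
rewrite -raddfD/= trG in dd.
have ddet : differentiable (fun y => \det (g (x y))) z.
  apply: differentiable_det; apply: (@differentiable_comp _ _ _ _ x g) => //.
  exact: (metric_diff gD Dx).
have sd : differentiable (Num.sqrt : R -> R) (\det (g (x z))).
  by apply/derivable1_diffP; exact: (@ex_derive _ _ _ _ _ _ _ (is_derive1_sqrt d0)).
have := is_derive_comp_diff W ddet sd.
have -> := @derive_val _ _ _ _ _ _ _ dd => H; apply: (is_derive_eq H).
set h := \det (g (x z)); rewrite -/h in d0 sd *.
rewrite deriveE// -[2 * h * _]mulr1 linearZ/= -deriveE//.
have -> := derive_sqrt d0.
have h2 : h = Num.sqrt h ^+ 2 by rewrite sqr_sqrtr// ltW.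
have s0 : Num.sqrt h != 0 by rewrite gt_eqF// sqrtr_gt0.
rewrite /GRing.scale/= {1}h2; move: s0; clear; move: (Num.sqrt h) => s s0.
by field.
Qed.

(** The volume form is parallel. The trace of [G] contributed by the density equals the contribution
    of the Christoffel parts of the rows, since [tr (S *m G *m \adj S)] is [det S * tr G]. *)
Lemma is_derive_volume (x : V -> 'rV[R]_n) (r : 'I_n -> V -> 'rV[R]_n) W z :
  differentiable x z -> D (x z) -> (forall i, differentiable (r i) z) ->
  is_derive z W (fun y => volume g (x y) (\matrix_i r i y))
   (\sum_k volume g (x z)
      (\matrix_i if i == k then cov g x (r i) W z else r i z)).
Proof.
move=> dx Dx dr; have ds := is_derive_sqrt_det W dx Dx.
pose S' : 'M[R]_n := \matrix_i 'D_W (r i) z.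
have dS : is_derive z W (fun y => \matrix_i r i y) S'.
  apply: is_derive_mx => i j; rewrite (_ : (fun y => _) = (fun y => r i y 0 j)).
    by rewrite mxE; apply: is_derive_entry; exact: is_derive_diff.
  by apply/funext => y; rewrite mxE.
have H := is_deriveM' ds (is_derive_det dS).
apply: (is_derive_eq H) => {H}; rewrite det_replace_tr /volume -big_distrr/=.
set G := christoffel_mx _ _ _; set S := \matrix_i r i z.
have -> : \sum_k \det (\matrix_i (if i == k then cov g x (r i) W z else r i z))
   = \tr ((S' + S *m G) *m \adj S).
  rewrite -det_replace_tr; apply: eq_bigr => k _; congr (\det _).
  apply/row_matrixP => i; rewrite !rowK; case: ifP => // _.
  rewrite linearD/= rowK row_mul rowK; congr (_ + _).
  exact: (christoffel_mxE gD _ _ Dx).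
rewrite mulmxDl raddfD/= -(mulmxA S) (mxtrace_mulC S) -mulmxA mul_adj_mx.
by rewrite mul_mx_scalar mxtraceZ; ring.
Qed.

End VolumeAlong.

(** * Multilinearity and symmetries of the curvature *)

Section CurvatureTensor.
Variables (R : realType) (n : nat) (g : 'rV[R]_n -> 'M[R]_n) (D : set 'rV[R]_n).
Hypothesis gD : local_metric g D.
Implicit Types (p u v w a b : 'rV[R]_n).

Definition riem p v w a : 'rV[R]_n := curvature g (cst v) (cst w) (cst a) p.

Let DG p v a b := 'D_v (fun q => christoffel g q a b) p.
Let Gam p := christoffel g p.

Lemma riemE p v w a : D p -> riem p v w a =
  DG p v w a + Gam p v (Gam p w a) - (DG p w v a + Gam p w (Gam p v a)).
Proof. exact: curvature_cst. Qed.

Lemma DGC p v a b : D p -> DG p v a b = DG p v b a.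
Proof.
move=> Dp; apply: near_eq_derive; apply: filterS (nearD gD Dp) => q Dq.
exact: (christoffelC gD _ _ Dq).
Qed.

Lemma DGDv p u v a b : D p -> DG p (u + v) a b = DG p u a b + DG p v a b.
Proof.
move=> Dp; have d := christoffel_diff gD a b Dp.
by rewrite /DG (deriveE _ d) (deriveE u d) (deriveE v d) linearD.
Qed.

Lemma DGZv p k v a b : D p -> DG p (k *: v) a b = k *: DG p v a b.
Proof.
move=> Dp; have d := christoffel_diff gD a b Dp.
by rewrite /DG (deriveE _ d) (deriveE v d) linearZ.
Qed.

Lemma DGDr p v w a b : D p -> DG p v w (a + b) = DG p v w a + DG p v w b.
Proof.
move=> Dp; apply: derive_val.
apply: (@near_eq_is_derive _ _ _ (fun q => christoffel g q w a + christoffel g q w b)).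
  by apply: filterS (nearD gD Dp) => q Dq; exact: (esym (christoffelDr gD _ _ _ Dq)).
by apply: is_deriveD; exact: (is_derive_diff _ (christoffel_diff gD _ _ Dp)).
Qed.

Lemma DGZr p v w k a : D p -> DG p v w (k *: a) = k *: DG p v w a.
Proof.
move=> Dp; apply: derive_val.
apply: (@near_eq_is_derive _ _ _ (fun q => k *: christoffel g q w a)).
  by apply: filterS (nearD gD Dp) => q Dq; exact: (esym (christoffelZr gD _ _ _ Dq)).
apply: (@is_deriveZ _ _ _ (fun q => christoffel g q w a)).
exact: (is_derive_diff _ (christoffel_diff gD _ _ Dp)).
Qed.

Lemma riemN p v w a : D p -> riem p v w a = - riem p w v a.
Proof. by move=> Dp; rewrite (riemE _ _ _ Dp) (riemE w v _ Dp) opprB. Qed.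

Lemma riemDr p v w a b : D p -> riem p v w (a + b) = riem p v w a + riem p v w b.
Proof.
move=> Dp; rewrite !(riemE _ _ _ Dp) /Gam.
rewrite (DGDr v _ _ _ Dp) (DGDr w _ _ _ Dp).
rewrite (christoffelDr gD v a b Dp) (christoffelDr gD w a b Dp).
rewrite (christoffelDr gD v _ _ Dp) (christoffelDr gD w _ _ Dp).
generalize (DG p v w a) (DG p v w b) (DG p w v a) (DG p w v b).
generalize (christoffel g p v (christoffel g p w a)) (christoffel g p v (christoffel g p w b)).
generalize (christoffel g p w (christoffel g p v a)) (christoffel g p w (christoffel g p v b)).
by clear => *; apply/rowP => i; rewrite !mxE; ring.
Qed.

Lemma riemZr p v w k a : D p -> riem p v w (k *: a) = k *: riem p v w a.
Proof.
move=> Dp; rewrite !(riemE _ _ _ Dp) /Gam.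
rewrite (DGZr v _ _ _ Dp) (DGZr w _ _ _ Dp).
rewrite (christoffelZr gD v k a Dp) (christoffelZr gD w k a Dp).
rewrite (christoffelZr gD v _ _ Dp) (christoffelZr gD w _ _ Dp).
generalize (DG p v w a) (DG p w v a).
generalize (christoffel g p v (christoffel g p w a)) (christoffel g p w (christoffel g p v a)).
by clear => *; apply/rowP => i; rewrite !mxE; ring.
Qed.

Lemma riemDl p u v w a : D p -> riem p (u + v) w a = riem p u w a + riem p v w a.
Proof.
move=> Dp; rewrite !(riemE _ _ _ Dp) /Gam.
rewrite (DGDv u v _ _ Dp) (DGC w (u + v) _ Dp) (DGC w u _ Dp) (DGC w v _ Dp).
rewrite (DGDr w _ _ _ Dp).
rewrite (christoffelDl gD u v a Dp) (christoffelDl gD u v _ Dp).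
rewrite (christoffelDr gD w _ _ Dp).
generalize (DG p w a u) (DG p w a v) (DG p u w a) (DG p v w a).
generalize (christoffel g p w (christoffel g p u a)) (christoffel g p w (christoffel g p v a)).
generalize (christoffel g p u (christoffel g p w a)) (christoffel g p v (christoffel g p w a)).
by clear => *; apply/rowP => i; rewrite !mxE; ring.
Qed.

Lemma riemZl p k v w a : D p -> riem p (k *: v) w a = k *: riem p v w a.
Proof.
move=> Dp; rewrite !(riemE _ _ _ Dp) /Gam.
rewrite (DGZv k v _ _ Dp) (DGC w (k *: v) _ Dp) (DGC w v _ Dp).
rewrite (DGZr w _ _ _ Dp).
rewrite (christoffelZl gD k v a Dp) (christoffelZl gD k v _ Dp).
rewrite (christoffelZr gD w _ _ Dp).
generalize (DG p v w a) (DG p w a v).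
generalize (christoffel g p v (christoffel g p w a)) (christoffel g p w (christoffel g p v a)).
by clear => *; apply/rowP => i; rewrite !mxE; ring.
Qed.

(** Torsion freeness: the Christoffel symbol and its derivatives are symmetric in the lower
    arguments, which cancels all terms of the cyclic sum in pairs. *)
Lemma riem_bianchi p u v w : D p -> riem p u v w + riem p v w u + riem p w u v = 0.
Proof.
move=> Dp; rewrite !(riemE _ _ _ Dp) /Gam.
rewrite (DGC u w v Dp) (DGC v u w Dp) (DGC w v u Dp).
rewrite (christoffelC gD w v Dp) (christoffelC gD u w Dp) (christoffelC gD v u Dp).
generalize (DG p u v w) (DG p v w u) (DG p w u v).
generalize (christoffel g p u (christoffel g p v w)).
generalize (christoffel g p v (christoffel g p w u)).
generalize (christoffel g p w (christoffel g p u v)).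
by clear => *; apply/rowP => i; rewrite !mxE; ring.
Qed.

End CurvatureTensor.

(** * Skewness of the curvature and the Ricci tensor *)

Section RicciTensor.
Variables (R : realType) (n : nat) (g : 'rV[R]_n -> 'M[R]_n) (D : set 'rV[R]_n).
Hypothesis gD : local_metric g D.
Implicit Types (p u v w a b : 'rV[R]_n).

(** For constant [a] and [b], the second derivatives of the function [<a, b>] along [v] and [w]
    commute. Expanded by metric compatibility along the identity map, their difference loses the
    mixed terms and becomes [<R a, b> + <a, R b>]. *)
Lemma riem_skew p v w a b : D p ->
  inner g (riem g p v w a) b p = - inner g a (riem g p v w b) p.
Proof.
move=> Dp; pose s c e := fun q : 'rV[R]_n => christoffel g q c e.
have sd c e : differentiable (s c e) p by exact: (christoffel_diff gD _ _ Dp).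
have dh c : \forall q \near p,
    'D_c (inner g a b) q = inner g (s c a q) b q + inner g a (s c b q) q.
  apply: filterS (nearD gD Dp) => q Dq.
  exact: etrans (derive_inner gD _ _ _ Dq) (derive_metric gD _ _ _ Dq).
have id_diff : differentiable (id : 'rV[R]_n -> 'rV[R]_n) p by exact: ex_diff.
have cst_diff e : differentiable (cst e : 'rV[R]_n -> 'rV[R]_n) p.
  exact: differentiable_cst.
have ddh c e : 'D_e ('D_c (inner g a b)) p =
    inner g (cov g id (s c a) e p) b p + inner g (s c a p) (s e b p) p
    + (inner g (s e a p) (s c b p) p + inner g a (cov g id (s c b) e p) p).
  apply: etrans (near_eq_derive _ (dh c)) _; apply: derive_val.
  have covc f : cov g id (cst f) e p = s e f p.
    by rewrite /cov derive_cst add0r derive_id.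
  rewrite -(covc a) -(covc b); apply: is_deriveD.
    exact: (is_derive_inner gD e id_diff Dp (sd c a) (cst_diff b)).
  exact: (is_derive_inner gD e id_diff Dp (cst_diff a) (sd c b)).
have dd c : differentiable ('D_c (inner g a b)) p.
  apply: (@near_eq_differentiable _ _ _ (fun y => (a *m 'D_c g y *m b^T) 0 0)).
    by apply: filterS (nearD gD Dp) => y Dy; exact: (esym (derive_inner gD _ _ _ Dy)).
  apply: differentiable_entry; apply: differentiable_mulmx; last exact: differentiable_cst.
  apply: differentiable_mulmx; first exact: differentiable_cst.
  exact: (metric_diff2 gD _ Dp).
have nd : \forall y \near p, differentiable (inner g a b) y.
  apply: filterS (nearD gD Dp) => y Dy.
  apply: differentiable_entry; apply: differentiable_mulmx; last exact: differentiable_cst.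
  apply: differentiable_mulmx; first exact: differentiable_cst.
  exact: (metric_diff gD Dy).
have := Schwarz nd (dd v) (dd w).
have -> := ddh w v; have -> := ddh v w.
have rE e : riem g p v w e = cov g id (s w e) v p - cov g id (s v e) w p.
  by apply: etrans (riemE gD v w e Dp) _; rewrite /cov !derive_id.
rewrite (rE a) (rE b).
generalize (cov g id (s w a) v p) (cov g id (s v a) w p) (cov g id (s w b) v p)
  (cov g id (s v b) w p) (s w a p) (s w b p) (s v a p) (s v b p).
clear; move=> c1 c2 c3 c4 s1 s2 s3 s4.
rewrite /inner (_ : (c3 - c4)^T = c3^T - c4^T); last exact: linearB.
rewrite mulmxBl mulmxBl mulmxBr.
have BE (A B : 'M[R]_1) : (A - B) 0 0 = A 0 0 - B 0 0 by rewrite !mxE.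
rewrite !BE; lra.
Qed.

Definition ricci_mx p v w : 'M[R]_n := \matrix_k riem g p (delta_mx 0 k) v w.

Lemma riem_mx p u v w : D p -> riem g p u v w = u *m ricci_mx p v w.
Proof.
move=> Dp; have Z0 a b : riem g p 0 a b = 0.
  by have := riemZl gD 0 0 a b Dp; rewrite !scale0r.
have S (I : Type) (r : seq I) (f : I -> 'rV_n) :
    riem g p (\sum_(i <- r) f i) v w = \sum_(i <- r) riem g p (f i) v w.
  elim/big_rec2: _ => [|i a b _ <-]; first exact: Z0.
  exact: (riemDl gD _ _ _ _ Dp).
rewrite {1}(row_sum_delta u) S mulmx_sum_row; apply: eq_bigr => i _.
by rewrite rowK; exact: (riemZl gD _ _ _ _ Dp).
Qed.

Lemma riem_suml p (I : Type) (r : seq I) (a : I -> R) (e : I -> 'rV_n) v w : D p ->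
  riem g p (\sum_(i <- r) a i *: e i) v w = \sum_(i <- r) a i *: riem g p (e i) v w.
Proof.
move=> Dp; elim/big_rec2: _ => [|i x y _ <-].
  by have := riemZl gD 0 0 v w Dp; rewrite !scale0r.
apply: etrans (riemDl gD _ _ _ _ Dp) _; congr (_ + _); exact: (riemZl gD _ _ _ _ Dp).
Qed.

Lemma riem_sumr p (I : Type) (r : seq I) (a : I -> R) (e : I -> 'rV_n) v w : D p ->
  riem g p v (\sum_(i <- r) a i *: e i) w = \sum_(i <- r) a i *: riem g p v (e i) w.
Proof.
move=> Dp; apply: etrans (riemN gD _ _ _ Dp) _.
apply: etrans (congr1 -%R (riem_suml _ _ _ _ _ Dp)) _; rewrite -sumrN.
apply: eq_bigr => i _; rewrite -scalerN; congr (_ *: _).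
exact: esym (riemN gD _ _ _ Dp).
Qed.

Lemma ricciE p v w : ricci g p v w = \tr (ricci_mx p v w).
Proof. by rewrite /mxtrace; apply: eq_bigr => k _; rewrite [RHS]mxE. Qed.

Lemma ricciDl p a b w : D p -> ricci g p (a + b) w = ricci g p a w + ricci g p b w.
Proof.
move=> Dp; rewrite /ricci -big_split; apply: eq_bigr => k _.
suff -> : curvature g (cst (delta_mx 0 k)) (cst (a + b)) (cst w) p =
  riem g p (delta_mx 0 k) a w + riem g p (delta_mx 0 k) b w by rewrite mxE.
apply: etrans (riemN gD _ _ _ Dp) _; rewrite (riemDl gD _ _ _ _ Dp).
by rewrite (riemN gD a _ _ Dp) (riemN gD b _ _ Dp) -opprD opprK.
Qed.

Lemma ricciZl p k a w : D p -> ricci g p (k *: a) w = k * ricci g p a w.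
Proof.
move=> Dp; rewrite /ricci big_distrr; apply: eq_bigr => i _.
suff -> : curvature g (cst (delta_mx 0 i)) (cst (k *: a)) (cst w) p =
  k *: riem g p (delta_mx 0 i) a w by rewrite mxE.
apply: etrans (riemN gD _ _ _ Dp) _; rewrite (riemZl gD _ _ _ _ Dp).
by rewrite (riemN gD a _ _ Dp) -scalerN opprK.
Qed.

(** The inverse of an orthonormal frame [E] is [G *m E^T], so this is invariance of the trace under
    conjugation. *)
Lemma mxtrace_orthonormal (G E L : 'M[R]_n) : E *m G *m E^T = 1%:M ->
  \tr L = \sum_k (row k E *m L *m G *m (row k E)^T) 0 0.
Proof.
move=> EG; have EE : G *m E^T *m E = 1%:M by apply: mulmx1C; rewrite mulmxA.
rewrite -[L in LHS]mulmx1 -EE !mulmxA mxtrace_mulC !mulmxA /mxtrace.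
apply: eq_bigr => k _; rewrite -(row_mul k E) -(row_mul k (E *m L)) [LHS]mxE [RHS]mxE.
by apply: eq_bigr => j _; rewrite [row k _ 0 j]mxE [E^T j k]mxE [(row k E)^T j 0]mxE [row k E 0 j]mxE.
Qed.

Lemma ricci_orthonormal p v w (E : 'M[R]_n) : D p -> E *m g p *m E^T = 1%:M ->
  ricci g p v w = \sum_k inner g (riem g p (row k E) v w) (row k E) p.
Proof.
move=> Dp Eg; rewrite ricciE (mxtrace_orthonormal _ Eg); apply: eq_bigr => k _.
by rewrite (riem_mx _ _ _ Dp).
Qed.

(* Contracting the Bianchi identity, [ricci v w - ricci w v] is the trace of
   the skew endomorphism [R_{v,w}]. *)
Lemma ricciC p v w (E : 'M[R]_n) : D p -> E *m g p *m E^T = 1%:M ->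
  ricci g p v w = ricci g p w v.
Proof.
move=> Dp Eg; rewrite !(ricci_orthonormal _ _ Dp Eg); apply: eq_bigr => k _.
set e := row k E.
have skew0 : inner g (riem g p v w e) e p = 0.
  have := riem_skew v w e e Dp; rewrite [in RHS](inner_sym gD _ _ Dp); lra.
have -> : riem g p e v w = riem g p e w v - riem g p v w e.
  have := riem_bianchi gD e v w Dp.
  rewrite (riemN gD w e v Dp).
  generalize (riem g p e v w) (riem g p e w v) (riem g p v w e).
  by clear => x y z /rowP xyz; apply/rowP => i; have := xyz i; rewrite !mxE; lra.
move: skew0; generalize (riem g p v w e) (riem g p e w v); clear => r q.
by rewrite -[q - r]addrC -scaleN1r innerDl innerZl => ->; rewrite mulr0 add0r.
Qed.

Lemma ricciDr p a b v : D p -> ricci g p v (a + b) = ricci g p v a + ricci g p v b.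
Proof.
move=> Dp; rewrite /ricci -big_split; apply: eq_bigr => k _.
have E := riemDr gD (delta_mx 0 k) v a b Dp.
by apply: etrans (congr1 (fun r : 'rV_n => r 0 k) E) _; rewrite mxE.
Qed.

Lemma ricciZr p k a v : D p -> ricci g p v (k *: a) = k * ricci g p v a.
Proof.
move=> Dp; rewrite /ricci big_distrr; apply: eq_bigr => i _.
have E := riemZr gD (delta_mx 0 i) v k a Dp.
by apply: etrans (congr1 (fun r : 'rV_n => r 0 i) E) _; rewrite mxE.
Qed.

Lemma ric_ricci p v w : D p -> (v *m ric g p *m g p *m w^T) 0 0 = ricci g p v w.
Proof.
move=> Dp; rewrite /ric -(mulmxA v) mulmxKV ?(metric_unit gD Dp)//.
have suml (r : seq 'I_n) (f : 'I_n -> 'rV_n) b :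
    ricci g p (\sum_(i <- r) f i) b = \sum_(i <- r) ricci g p (f i) b.
  elim/big_rec2: _ => [|i x y _ <-]; last exact: ricciDl.
  by have := ricciZl 0 0 b Dp; rewrite scale0r mul0r.
have sumr (r : seq 'I_n) (f : 'I_n -> 'rV_n) b :
    ricci g p b (\sum_(i <- r) f i) = \sum_(i <- r) ricci g p b (f i).
  elim/big_rec2: _ => [|i x y _ <-]; last exact: ricciDr.
  by have := ricciZr 0 0 b Dp; rewrite scale0r mul0r.
rewrite [in RHS](row_sum_delta v) suml [in RHS](row_sum_delta w) mxE.
under [RHS]eq_bigr => i _ do rewrite sumr.
rewrite exchange_big/=; apply: eq_bigr => j _; rewrite [w^T _ _]mxE mxE big_distrl/=.
apply: eq_bigr => i _; rewrite [X in _ * X * _]mxE (ricciZl _ _ _ Dp) (ricciZr _ _ _ Dp).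
by rewrite mulrCA mulrA mulrC mulrA.
Qed.

End RicciTensor.

(** * Alternating sums and the Hodge star *)

Section AlternatingSums.
Variables (R : numFieldType) (k : nat).
Implicit Types (F : ('I_k -> 'I_k) -> R).

(** The summand takes arbitrary self-maps of the index set, not only permutations, so that
    reindexing is plain composition [s \o t] and slots can be addressed one by one. *)
Definition altsum F : R := \sum_(s : 'S_k) (-1) ^+ s * F s.

Lemma eq_altsum F (G : ('I_k -> 'I_k) -> R) : (forall s : 'S_k, F s = G s) -> altsum F = altsum G.
Proof. by move=> FG; apply: eq_bigr => s _; rewrite FG. Qed.

Lemma altsumD F (G : ('I_k -> 'I_k) -> R) : altsum (fun s => F s + G s) = altsum F + altsum G.
Proof. by rewrite -big_split; apply: eq_bigr => s _; rewrite mulrDr. Qed.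

Lemma altsumZ a F : altsum (fun s => a * F s) = a * altsum F.
Proof. by rewrite big_distrr; apply: eq_bigr => s _; rewrite mulrCA. Qed.

Lemma altsum_sum (I : Type) (r : seq I) (P : pred I) (G : I -> ('I_k -> 'I_k) -> R) :
  altsum (fun s => \sum_(i <- r | P i) G i s) = \sum_(i <- r | P i) altsum (G i).
Proof.
by rewrite /altsum exchange_big; apply: eq_bigr => s _; rewrite big_distrr.
Qed.

Lemma altsum_perm (t : 'S_k) F :
  altsum (fun s => F (s \o t)) = (-1) ^+ t * altsum F.
Proof.
rewrite /altsum big_distrr [RHS](reindex_inj (mulgI t))/=.
apply: eq_bigr => s _; rewrite odd_permM signr_addb mulrA.
rewrite (mulrA _ ((-1) ^+ t)) -expr2 sqrr_sign mul1r; congr (_ * F _).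
by apply/funext => i; rewrite permM.
Qed.

Lemma altsum_tperm (i j : 'I_k) F : i != j ->
  altsum (fun s => F (s \o tperm i j)) = - altsum F.
Proof. by move=> ij; rewrite altsum_perm odd_tperm ij expr1 mulN1r. Qed.

(** The transposition makes the sum equal to its opposite. This disposes of every term that is
    symmetric in two slots. *)
Lemma altsum_eq0 (i j : 'I_k) F : i != j ->
  (forall s : 'S_k, F (s \o tperm i j) = F s) -> altsum F = 0.
Proof.
move=> ij Fij; have := altsum_tperm F ij; rewrite (eq_altsum Fij).
by move/eqP; rewrite -subr_eq0 opprK -mulr2n mulrn_eq0 => /eqP.
Qed.

Lemma altsum_det (M : 'M[R]_k) : altsum (fun s => \prod_i M (s i) i) = \det M.
Proof.
by rewrite -det_tr; apply: eq_bigr => s _; congr (_ * _); apply: eq_bigr => i _; rewrite mxE.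
Qed.

End AlternatingSums.

(** Permutations are grouped by the image [i] of slot 0, as in a Laplace expansion; the sign splits
    off [(-1) ^+ i]. The right-hand side has the shape of [ext_d], where row [i] is singled out. *)
Lemma altsum_lift (R : numFieldType) k (F : ('I_k.+1 -> 'I_k.+1) -> R) :
  altsum F = \sum_(i < k.+1) (-1) ^+ i * altsum (fun s : 'I_k -> 'I_k =>
    F (fun j => if unlift ord0 j is Some j' then lift i (s j') else i)).
Proof.
rewrite /altsum (partition_big (fun s : 'S_k.+1 => s ord0) xpredT)//=.
apply: eq_bigr => i _; rewrite (reindex (lift_perm ord0 i)) /=; last first.
  (* [ulsf j s] is [s] with [j] deleted from the source and [s j] from the target, both renumbered;
     it inverts [lift_perm]. *)
  pose ulsf j (s : 'S_k.+1) (m : 'I_k) := odflt m (unlift (s j) (s (lift j m))).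
  have ulsfK j (s : 'S_k.+1) m : lift (s j) (ulsf j s m) = s (lift j m).
    rewrite /ulsf; have:= neq_lift j m.
    by rewrite -(can_eq (permK s)) => /unlift_some[] ? ? ->.
  have inj_ulsf (s : 'S_k.+1) : injective (ulsf ord0 s).
    by move=> m1 m2 /(congr1 (lift (s ord0))); rewrite !ulsfK => /perm_inj /lift_inj.
  exists (fun s => perm (inj_ulsf s)) => [s _ | s].
    by apply/permP=> j; rewrite permE /ulsf lift_perm_id lift_perm_lift liftK.
  rewrite inE => /eqP <-; apply/permP => j.
  by case: (unliftP ord0 j) => [j'|] ->; rewrite ?lift_perm_id ?lift_perm_lift ?permE ?ulsfK.
rewrite big_distrr; apply: eq_big => [s|s _]; first by rewrite lift_perm_id eqxx.
rewrite odd_lift_perm /= signr_addb signr_odd -mulrA; congr (_ * (_ * F _)).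
apply/funext => j; case: unliftP => [j'|] ->; first by rewrite lift_perm_lift.
by rewrite lift_perm_id.
Qed.

(** The row that [ext_d] removes is the direction of differentiation and becomes slot 0 in
    [altsum_lift]. The remaining rows are constant vectors, hence only the dependence of [F] on the
    point is differentiated. *)
Lemma ext_d_altsum (R : realType) (n k : nat) (w : 'rV[R]_n -> covector R n k)
    (F : 'rV[R]_n -> ('I_k -> 'rV[R]_n) -> R)
    (dF : 'rV[R]_n -> ('I_k -> 'rV[R]_n) -> R) z (X : 'M[R]_(k.+1, n)) :
  (\forall y \near z, forall Y, w y Y = altsum (fun s => F y (fun i => row (s i) Y))) ->
  (forall v Y, is_derive z v (fun y => F y Y) (dF v Y)) ->
  ext_d w z X = altsum (fun s : 'I_k.+1 -> 'I_k.+1 =>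
    dF (row (s ord0) X) (fun i => row (s (lift ord0 i)) X)).
Proof.
move=> wF dFE; rewrite altsum_lift /ext_d; apply: eq_bigr => i _; congr (_ * _).
apply: derive_val.
apply: (@near_eq_is_derive _ _ _ (fun y => altsum (fun s => F y (fun j => row (s j) (row' i X))))).
  by apply: filterS wF => y wy; rewrite wy.
apply: is_derive_bigsum => s; rewrite unlift_none.
have E : (fun j => row (s j) (row' i X)) = (fun j => row (lift i (s j)) X).
  by apply/funext => j; apply/rowP => l; rewrite !mxE.
have E' : (fun j => row match unlift ord0 (lift ord0 j) with
    | Some j' => lift i (s j') | None => i end X) = (fun j => row (lift i (s j)) X).
  by apply/funext => j; rewrite liftK.
rewrite E E'.
exact: (@is_deriveZ _ _ _ (fun y => F y (fun j => row (lift i (s j)) X))).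
Qed.

(** * The Hodge star of coframe monomials *)

Section HodgeCoframe.
Variable R : realType.

(** Multilinearity of the determinant in its first [k] rows, each of them a combination of the rows
    of [J]. *)
Lemma det_col_mx_mul n k l (e : (k + l)%N = n) (B : 'M[R]_(k, n)) (J : 'M[R]_n)
    (Z : 'M[R]_(l, n)) :
  \det (castmx (e, erefl n) (col_mx (B *m J) Z)) =
  \sum_(I : {ffun 'I_k -> 'I_n}) (\prod_a B a (I a)) *
    \det (castmx (e, erefl n) (col_mx (rowsub I J) Z)).
Proof.
case: n / e B J Z => B J Z; rewrite castmx_id.
have leibniz (T : 'M[R]_(k, k + l)) : \det (col_mx T Z) = \sum_(s : 'S_(k + l))
    (-1) ^+ s * (\prod_a T a (s (lshift l a)) * \prod_b Z b (s (rshift k b))).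
  apply: eq_bigr => s _; congr (_ * _); rewrite big_split_ord /=; congr (_ * _).
    by apply: eq_bigr => a _; rewrite col_mxEu.
  by apply: eq_bigr => a _; rewrite col_mxEd.
rewrite leibniz.
under [RHS]eq_bigr => I _ do rewrite castmx_id leibniz big_distrr/=.
rewrite exchange_big/=; apply: eq_bigr => s _.
under eq_bigr => a _ do rewrite mxE.
rewrite bigA_distr_bigA big_distrl big_distrr/=; apply: eq_bigr => I _.
rewrite big_split/= -!mulrA mulrCA; congr (_ * (_ * (_ * _))).
by apply: eq_bigr => a _; rewrite mxE.
Qed.

Lemma det_col_mx_perm n k l (e : (k + l)%N = n) (s : 'S_k) (B : 'M[R]_(k, n))
    (Z : 'M[R]_(l, n)) :
  \det (castmx (e, erefl n) (col_mx (row_perm s B) Z)) =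
  (-1) ^+ s * \det (castmx (e, erefl n) (col_mx B Z)).
Proof.
case: n / e B Z => B Z; rewrite !castmx_id row_permE.
have -> : col_mx (perm_mx s *m B) Z
    = block_mx (perm_mx s) 0 0 1%:M *m col_mx B Z.
  by rewrite mul_block_col !mul0mx mul1mx addr0 add0r.
by rewrite det_mulmx det_lblock det1 mulr1 det_perm.
Qed.

(** The columns of [J] are an orthonormal coframe. The raised components of the monomial are entries
    of [invmx J], and summing over [I] reassembles a determinant by [det_col_mx_mul]. All
    permutations in the expansion of the monomial contribute equally, which cancels the factorial in
    [hodge]. *)
Lemma hodge_coframe n k l (e : (k + l)%N = n) (J : 'M[R]_n) (c : 'I_k -> 'I_n) Y :
  0 < \det J ->
  hodge e (J *m J^T) (fun X => \det (colsub c (X *m J))) Y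
  = \det (castmx (e, erefl n) (col_mx (rowsub c 1%:M) (Y *m J))).
Proof.
move=> J0; have Ju : J \in unitmx by rewrite unitmxE unitfE gt_eqF.
rewrite /hodge det_mulmx det_tr -expr2 sqrtr_sqr gtr0_norm//.
(* Raising indices with the Gram matrix turns the coframe into the dual frame, whose vectors are the
   rows of [invmx J]. *)
have KJ : invmx (J *m J^T) *m J = (invmx J)^T.
  have Gu : J *m J^T \in unitmx by rewrite unitmx_mul unitmx_tr Ju.
  apply: (can_inj (mulKmx Gu)); rewrite mulKVmx//.
  by rewrite -mulmxA -trmx_mul mulVmx// trmx1 mulmx1.
set d := fun T => \det (castmx (e, erefl n) (col_mx T (Y *m J))).
have dJ I : \det J * \det (castmx (e, erefl n) (col_mx (rowsub I 1%:M) Y)) = d (rowsub I J).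
  rewrite mulrC -det_mulmx /d; congr (\det _).
  move: I Y @d; case: n / e J {J0 Ju KJ c} => J I Y.
  by rewrite !castmx_id mul_col_mx mul_rowsub_mx mul1mx.
have wE (I : 'I_k -> 'I_n) : \det (colsub c (rowsub I (invmx (J *m J^T)) *m J))
   = \sum_(s : 'S_k) (-1) ^+ s * \prod_a invmx J (c (s a)) (I a).
  rewrite mul_rowsub_mx KJ; apply: eq_bigr => s _; congr (_ * _).
  by apply: eq_bigr => a _; rewrite !mxE.
under eq_bigr => I _ do rewrite wE big_distrl/=.
rewrite exchange_big/= big_distrr/= -[RHS]/(d (rowsub c 1%:M)).
rewrite (eq_bigr (fun=> k`!%:R^-1 * d (rowsub c 1%:M))) => [|s _].
  by rewrite sumr_const card_Sn -[LHS]mulr_natl mulrA mulfV ?mul1r//.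
rewrite -[_ / _]mulrC -!mulrA; congr (_ * _).
rewrite big_distrr/=.
have -> : d (rowsub c 1%:M) = (-1) ^+ s * d (rowsub (c \o s) (invmx J) *m J).
  rewrite mul_rowsub_mx mulVmx// (_ : rowsub (c \o s) _ = row_perm s (rowsub c 1%:M)).
    by rewrite /d det_col_mx_perm mulrA -expr2 sqrr_sign mul1r.
  by apply/matrixP => i j; rewrite !mxE.
rewrite /d det_col_mx_mul big_distrr/=; apply: eq_bigr => I _.
rewrite -/(d _) -dJ.
have -> : \prod_a rowsub (c \o s) (invmx J) a (I a) = \prod_a invmx J (c (s a)) (I a).
  by apply: eq_bigr => a _; rewrite mxE.
by rewrite [LHS]mulrCA -[LHS]mulrA.
Qed.

Lemma hodge_sum n k l (e : (k + l)%N = n) G (I : Type) (r : seq I)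
    (a : I -> R) (w : I -> covector R n k) Y :
  hodge e G (fun X => \sum_(i <- r) a i * w i X) Y
  = \sum_(i <- r) a i * hodge e G (w i) Y.
Proof.
rewrite /hodge; under eq_bigr => I' _ do rewrite big_distrl/=.
rewrite exchange_big big_distrr/=; apply: eq_bigr => i _.
rewrite [RHS]mulrCA; congr (_ * _); rewrite big_distrr.
by apply: eq_bigr => I' _; rewrite /= mulrA.
Qed.

End HodgeCoframe.

(** * Exterior monomials with numerical indices *)

Section Monomials.
Variables (R : numFieldType) (k : nat) (m : 'I_k -> nat -> R).
Implicit Types (c : seq nat).

(** The value of [e^{c_0} /\ e^{c_1} /\ ...] on [k] vectors, with [m i j] the [j]-th component of
    the [i]-th one. Indices are natural numbers in a list, so that repetitions are detected by
    computation and reorderings by rewriting. *)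
Definition mon c : R := altsum (fun s => \prod_(i < k) m (s i) (nth 0%N c i)).

Lemma mon_perm (t : 'S_k) c c' :
  (forall i : 'I_k, nth 0%N c' i = nth 0%N c (t i)) ->
  mon c' = (-1) ^+ t * mon c.
Proof.
move=> cc'; rewrite -odd_permV -altsum_perm; apply: eq_altsum => s.
rewrite (reindex_inj (@perm_inj _ t^-1))/=; apply: eq_bigr => i _.
by rewrite cc' permKV.
Qed.

Lemma mon_eq0 c : size c = k -> ~~ uniq c -> mon c = 0.
Proof.
move=> sc /(uniqPn 0%N)[i [j [ij jc cij]]].
have jk : (j < k)%N by rewrite -sc.
have ik := ltn_trans ij jk.
have ne : Ordinal ik != Ordinal jk by rewrite -val_eqE/= ltn_eqF.
have := @mon_perm (tperm (Ordinal ik) (Ordinal jk)) c c.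
rewrite odd_tperm ne expr1 mulN1r => H.
suff /H : forall l : 'I_k, nth 0%N c l = nth 0%N c (tperm (Ordinal ik) (Ordinal jk) l).
  by move/eqP; rewrite -subr_eq0 opprK -mulr2n mulrn_eq0 => /eqP.
by move=> l; case: tpermP => [->|->|].
Qed.

Lemma mon_swap c1 a b c2 : size (c1 ++ [:: a, b & c2]) = k ->
  mon (c1 ++ [:: b, a & c2]) = - mon (c1 ++ [:: a, b & c2]).
Proof.
rewrite size_cat /= !addnS => sk.
have ik : (size c1 < k)%N by rewrite -sk ltnS -addnS leq_addr.
have jk : ((size c1).+1 < k)%N by rewrite -sk !ltnS leq_addr.
have ne : Ordinal ik != Ordinal jk by rewrite -val_eqE/= ltn_eqF.
rewrite (@mon_perm (tperm (Ordinal ik) (Ordinal jk)) (c1 ++ [:: a, b & c2])).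
  by rewrite odd_tperm ne expr1 mulN1r.
move=> l; case: tpermP => [->|->|/eqP li /eqP lj].
- by rewrite /= !nth_cat ltnn subnn ltnNge leqnSn /= subSnn.
- by rewrite /= !nth_cat ltnn subnn ltnNge leqnSn /= subSnn.
rewrite !nth_cat; case: ltnP => // cl.
have : (1 < l - size c1)%N.
  rewrite ltn_subRL addn1 ltn_neqAle eq_sym lj/= ltn_neqAle cl andbT eq_sym.
  exact: li.
by case: (l - size c1)%N => [|[|?]].
Qed.

End Monomials.

Arguments mon : simpl never.

Lemma altsum_mon4 (R : numFieldType) (m : 'I_4 -> nat -> R) a b c d :
  altsum (fun s => m (s (@Ordinal 4 0 isT)) a * m (s (@Ordinal 4 1 isT)) b
    * m (s (@Ordinal 4 2 isT)) c * m (s (@Ordinal 4 3 isT)) d)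
  = mon m [:: a; b; c; d].
Proof.
apply: eq_altsum => s; rewrite !big_ord_recl big_ord0 mulr1 -!mulrA.
by congr (m (s _) _ * (m (s _) _ * (m (s _) _ * m (s _) _))); exact: val_inj.
Qed.

Lemma altsum_mon5 (R : numFieldType) (m : 'I_5 -> nat -> R) a b c d e :
  altsum (fun s => m (s (@Ordinal 5 0 isT)) a * m (s (@Ordinal 5 1 isT)) b
    * m (s (@Ordinal 5 2 isT)) c * m (s (@Ordinal 5 3 isT)) d
    * m (s (@Ordinal 5 4 isT)) e)
  = mon m [:: a; b; c; d; e].
Proof.
apply: eq_altsum => s; rewrite !big_ord_recl big_ord0 mulr1 -!mulrA.
by congr (m (s _) _ * (m (s _) _ * (m (s _) _ * (m (s _) _ * m (s _) _)))); exact: val_inj.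
Qed.

Section UnitRows.
Variable R : comPzRingType.

Lemma det_unit_row n (T : 'M[R]_n.+1) (j0 : 'I_n.+1) :
  (forall j, T ord0 j = (j0 == j)%:R) ->
  \det T = (-1) ^+ j0 * \det (\matrix_(i, j) T (lift ord0 i) (lift j0 j)).
Proof.
move=> T0; rewrite (expand_det_row _ ord0) (bigD1 j0)//= big1 => [|j jj0].
  rewrite T0 eqxx mul1r addr0 /cofactor add0n; congr (_ * \det _).
  by apply/matrixP => i j; rewrite !mxE.
by rewrite T0 eq_sym (negbTE jj0) mul0r.
Qed.

(** Three successive expansions along unit rows. [j1] and [j2] are the columns of the second and
    third unit row, renumbered after the deletion of the earlier columns, which is why the sign
    exponent is their plain sum with the first column. *)
Lemma det_three_unit_rows (c : 'I_3 -> 'I_7) (Z : 'M[R]_(4, 7)) (j1 : 'I_6) (j2 : 'I_5) :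
  lift (c (@Ordinal 3 0 isT)) j1 = c (@Ordinal 3 1 isT) ->
  lift (c (@Ordinal 3 0 isT)) (lift j1 j2) = c (@Ordinal 3 2 isT) ->
  \det (col_mx (rowsub c 1%:M) Z : 'M[R]_7) = (-1) ^+ (c (@Ordinal 3 0 isT) + j1 + j2) *
    \det (colsub (fun j => lift (c (@Ordinal 3 0 isT)) (lift j1 (lift j2 j))) Z).
Proof.
move=> c1 c2; set c0 := c (@Ordinal 3 0 isT).
have up (a : 'I_3) j (i : 'I_7) : val i = val a ->
    (col_mx (rowsub c 1%:M) Z : 'M[R]_7) i j = (c a == j)%:R.
  move=> ia; rewrite (_ : i = lshift 4 a); last exact: val_inj.
  by rewrite (@col_mxEu _ 3 4) !mxE.
have down (a : 'I_4) j (i : 'I_7) : val i = (3 + val a)%N ->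
    (col_mx (rowsub c 1%:M) Z : 'M[R]_7) i j = Z a j.
  move=> ia; rewrite (_ : i = rshift 3 a); last exact: val_inj.
  by rewrite (@col_mxEd _ 3 4).
rewrite (@det_unit_row _ _ c0) => [|j]; last first.
  by rewrite (up (@Ordinal 3 0 isT)).
rewrite (@det_unit_row _ _ j1) => [|j]; last first.
  by rewrite mxE (up (@Ordinal 3 1 isT))// -c1 (inj_eq lift_inj).
rewrite (@det_unit_row _ _ j2) => [|j]; last first.
  by rewrite mxE mxE (up (@Ordinal 3 2 isT))// -c2 !(inj_eq lift_inj).
rewrite !mulrA -!exprD; congr (_ * \det _).
by apply/matrixP => i j; rewrite mxE mxE mxE [RHS]mxE; apply: down.
Qed.

End UnitRows.

Lemma det_mon (R : numFieldType) k n (Z : 'M[R]_(k, n.+1)) (d : 'I_k -> 'I_n.+1) (c : seq nat) :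
  (forall i : 'I_k, nth 0%N c i = d i) ->
  \det (colsub d Z) = mon (fun i j => Z i (inord j)) c.
Proof.
move=> dc; rewrite -altsum_det; apply: eq_altsum => s; apply: eq_bigr => i _.
by rewrite mxE dc inord_val.
Qed.

(** The same expansion with [lift] replaced by [bump] on numbers: for concrete indices all side
    conditions hold by computation. The [d]s are the indices complementary to the [c]s, and [sg] is
    the parity of the sign. *)
Lemma star_mon (R : numFieldType) (Z : 'M[R]_(4, 7)) (c : 'I_3 -> 'I_7)
   (c0 c1 c2 d0 d1 d2 d3 : nat) (j1 j2 : nat) (sg : bool) :
  [&& c0 < 7, j1 < 6 & j2 < 5]%N ->
  [/\ bump c0 j1 = c1, bump c0 (bump j1 j2) = c2 & odd (c0 + j1 + j2) = sg] ->
  [seq bump c0 (bump j1 (bump j2 j)) | j <- iota 0 4] = [:: d0; d1; d2; d3] ->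
  (forall i : 'I_3, nth 0%N [:: c0; c1; c2] i = c i) ->
  \det (col_mx (rowsub c 1%:M) Z : 'M[R]_7) =
  (-1) ^+ sg * mon (fun i j => Z i (inord j)) [:: d0; d1; d2; d3].
Proof.
move=> /and3P[h0 h1 h2] [e1 e2 <-] ed cE.
have [C0 C1 C2] : [/\ val (c (@Ordinal 3 0 isT)) = c0,
    val (c (@Ordinal 3 1 isT)) = c1 & val (c (@Ordinal 3 2 isT)) = c2].
  by rewrite /= -!cE.
rewrite (@det_three_unit_rows _ c Z (Ordinal h1) (Ordinal h2)); first last.
- by apply: val_inj; rewrite C2 /= C0.
- by apply: val_inj; rewrite C1 /= C0.
rewrite /= C0 signr_odd; congr (_ * _); apply: det_mon => i.
by rewrite -ed /= C0; case: i => -[|[|[|[|]]]].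
Qed.

(** * Adapted coframes *)

Section OrthonormalFrames.
Variables (R : realType) (n : nat) (G E : 'M[R]_n).
Hypotheses (G_sym : G^T = G) (EG : E *m G *m E^T = 1%:M).

Lemma frame_dual : G *m E^T *m E = 1%:M.
Proof. by apply: mulmx1C; rewrite mulmxA. Qed.

Lemma frame_mul k l (A : 'M[R]_(k, n)) (B : 'M[R]_(l, n)) :
  A *m G *m B^T = (A *m G *m E^T) *m (B *m G *m E^T)^T.
Proof.
rewrite !trmx_mul trmxK G_sym !mulmxA -(mulmxA (A *m G) E^T E).
by rewrite -(mulmxA A G (E^T *m E)) (mulmxA G E^T E) frame_dual mulmx1.
Qed.

Lemma det_frame : 0 < \det E -> Num.sqrt (\det G) * \det E = 1.
Proof.
move=> E0; have En0 := lt0r_neq0 E0.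
have detG : \det G = ((\det E)^-1) ^+ 2.
  have /(congr1 determinant) := EG; rewrite !det_mulmx det_tr det1 => h.
  by rewrite -[LHS](mulKf En0) -[X in _^-1 * X](mulfK En0) h mul1r expr2.
by rewrite detG sqrtr_sqr gtr0_norm ?invr_gt0// mulVf.
Qed.

Lemma det_frame_coord (V : 'M[R]_n) : 0 < \det E ->
  Num.sqrt (\det G) * \det V = \det (V *m G *m E^T).
Proof.
move=> E0; have := det_frame E0.
have /(congr1 determinant) := EG; rewrite !det_mulmx det_tr det1 => h1 h2.
have En0 := lt0r_neq0 E0.
have -> : Num.sqrt (\det G) = (\det E)^-1 by apply: (mulIf En0); rewrite mulVf.
have -> : \det G = (\det E)^-1 * (\det E)^-1.
  by apply: (mulIf En0); apply: (mulfI En0); rewrite mulrA h1 -mulrA mulVf// mulr1 mulfV.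
by rewrite -!mulrA mulVf// mulr1 mulrC.
Qed.

End OrthonormalFrames.

Section Coframes.
Variables (R : realType) (g : 'rV[R]_4 -> 'M[R]_4) (D : set 'rV[R]_4).
Hypothesis gD : local_metric g D.
Variables (p : 'rV[R]_(4 + 4)) (E : 'M[R]_4).
Hypotheses (Dp : D (base p)) (hE : adapted_frame g p E).

Lemma verticalE k (X : 'M[R]_(k, 4 + 4)) : vertical g p X =
  rsubmx X + lsubmx X *m (\matrix_i christoffel g (base p) (delta_mx 0 i) (taut p)).
Proof.
apply/row_matrixP => a; rewrite rowK [RHS]linearD/= row_mul; congr (_ + _).
exact: (christoffel_mxl gD (row a (lsubmx X)) (taut p) Dp).
Qed.

Lemma verticalM k l (X : 'M[R]_(k, l)) (J : 'M[R]_(l, 4 + 4)) :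
  vertical g p (X *m J) = X *m vertical g p J.
Proof.
have rE : rsubmx (X *m J) = X *m rsubmx J.
  by rewrite -[in LHS](hsubmxK J) mul_mx_row row_mxKr.
have lE : lsubmx (X *m J) = X *m lsubmx J.
  by rewrite -[in LHS](hsubmxK J) mul_mx_row row_mxKl.
by rewrite !verticalE rE lE mulmxDr mulmxA.
Qed.

Lemma horizontalM k l (X : 'M[R]_(k, l)) (J : 'M[R]_(l, 4 + 4)) :
  horizontal (X *m J) = X *m horizontal J.
Proof. by rewrite /horizontal -[in LHS](hsubmxK J) mul_mx_row row_mxKl. Qed.

Lemma coframeM k l (X : 'M[R]_(k, l)) (J : 'M[R]_(l, 4 + 4)) :
  coframe g p E (X *m J) = X *m coframe g p E J.
Proof.
rewrite /coframe verticalM horizontalM.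
apply: etrans _ (esym (@mul_mx_row _ k l 4 3 X _ _)); rewrite !mulmxA; congr row_mx.
rewrite -!mulmxA.
generalize (vertical g p J *m (g (base p) *m E^T)) => T.
rewrite -[in LHS](@hsubmxK _ l 1 3 T).
by rewrite -[X *m _]/(@mulmx R k l (1 + 3) X (row_mx _ _)) (@mul_mx_row _ k l 1 3) row_mxKr.
Qed.

Lemma row0_frame (v : 'rV[R]_4) : inner g v (taut p) (base p) = (v *m g (base p) *m E^T) 0 0.
Proof.
case: hE => E0 _ _; rewrite /inner -E0 mxE [RHS]mxE; apply: eq_bigr => j _.
by rewrite !mxE.
Qed.

(** The coframe omits the component of the vertical part along [u]. It computes the Gram matrix of
    vectors whose vertical part is orthogonal to [u], that is, of vectors tangent to the sphere
    bundle. *)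
Lemma gram_coframe k (X : 'M[R]_(k, 4 + 4)) :
  (forall a, inner g (row a (vertical g p X)) (taut p) (base p) = 0) ->
  gram g p X = coframe g p E X *m (coframe g p E X)^T.
Proof.
move=> v0; case: hE => E0 Eg Epos; have Gs := local_sym gD Dp.
rewrite /gram (frame_mul Gs Eg) [X in _ + X](frame_mul Gs Eg).
rewrite /coframe (@tr_row_mx _ k 4 3) (@mul_row_col _ k 4 3); congr (_ + _).
set V := vertical g p X *m _ *m _.
rewrite -{1 2}(@hsubmxK _ k 1 3 V) (@tr_row_mx _ k 1 3) (@mul_row_col _ k 1 3).
suff -> : @lsubmx R k 1 3 V = 0 by rewrite mul0mx add0r.
apply/matrixP => a b; rewrite mxE [RHS]mxE.
have := v0 a; rewrite row0_frame -!row_mul mxE => <-; congr (V a _).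
by apply: val_inj; rewrite /= [b]ord1.
Qed.

End Coframes.

(** * The form [phi] and its Hodge dual in an adapted coframe *)

Section PhiMonomials.
Variables (R : realType) (g : 'rV[R]_4 -> 'M[R]_4) (D : set 'rV[R]_4).
Hypothesis gD : local_metric g D.
Variables (p : 'rV[R]_(4 + 4)) (E : 'M[R]_4).
Hypotheses (Dp : D (base p)) (hE : adapted_frame g p E).

Lemma coframe_h k (X : 'M[R]_(k, 4 + 4)) a (c : nat) : (c < 4)%N ->
  coframe g p E X a (inord c) = (horizontal X *m g (base p) *m E^T) a (inord c).
Proof.
move=> c4; rewrite /coframe; set H := horizontal X *m _ *m _; set V := rsubmx _.
rewrite (_ : (inord c : 'I_7) = @lshift 4 3 (inord c)) ?(@row_mxEl _ _ 4 3)//.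
by apply: val_inj; rewrite /= !inordK// (leq_trans c4).
Qed.

Lemma coframe_v k (X : 'M[R]_(k, 4 + 4)) a (c : nat) : (0 < c < 4)%N ->
  coframe g p E X a (inord (c + 3)%N) = (vertical g p X *m g (base p) *m E^T) a (inord c).
Proof.
case/andP=> c0 c4; rewrite /coframe; set H := horizontal X *m _ *m _.
set V := vertical g p X *m _ *m _.
have c3 : (c.-1 < 3)%N by case: c c0 c4.
rewrite (_ : (inord (c + 3)%N : 'I_7) = @rshift 4 3 (Ordinal c3)).
  rewrite (@row_mxEr _ _ 4 3) mxE; congr (V a _).
  by apply: val_inj; rewrite /= inordK// add1n prednK.
apply: val_inj; rewrite /= inordK ?addnS ?addn0; first by case: c c0 {c4 c3}.
by rewrite !ltnS.
Qed.

Lemma coframe_rowsub k l (f : 'I_k -> 'I_l) (X : 'M[R]_(l, 4 + 4)) i j :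
  coframe g p E (rowsub f X) i j = coframe g p E X (f i) j.
Proof.
rewrite rowsubE (coframeM gD _ Dp) -rowsubE.
by rewrite mxE.
Qed.

Lemma mu_coframe (Y : 'M[R]_(1, 4 + 4)) : mu g p Y = coframe g p E Y 0 (inord 0).
Proof.
rewrite coframe_h//; have := row0_frame hE (horizontal Y).
rewrite (inner_sym gD _ _ Dp) /inner /mu => ->.
by congr (_ 0 _); apply: val_inj; rewrite /= inordK.
Qed.

(** Orthogonality of the vertical parts to [u], the frame vector of index 0: the linearization of
    [<u, u> = 1]. *)
Definition tangential k (X : 'M[R]_(k, 4 + 4)) : Prop := forall a,
  (vertical g p X *m g (base p) *m E^T) a (inord 0) = 0.

Lemma tangentialM k l (Y : 'M[R]_(l, k)) (X : 'M[R]_(k, 4 + 4)) :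
  tangential X -> tangential (Y *m X).
Proof.
move=> tX a; rewrite (verticalM gD Dp) -!mulmxA mxE big1// => i _.
by rewrite mulmxA tX mulr0.
Qed.

Lemma hv_coframe k (X : 'M[R]_(k, 4 + 4)) a b : tangential X ->
  (horizontal X *m g (base p) *m (vertical g p X)^T) a b =
  \sum_(c < 3) coframe g p E X a (inord c.+1) * coframe g p E X b (inord (c.+1 + 3)%N).
Proof.
move=> tX; case: hE => _ Eg _.
rewrite (frame_mul (local_sym gD Dp) Eg) mxE big_ord_recl.
rewrite [X in _ * X]mxE.
have -> : (vertical g p X *m g (base p) *m E^T) b ord0 = 0.
  by rewrite -(tX b); congr (_ b _); apply: val_inj; rewrite /= inordK.
rewrite mulr0 add0r; apply: eq_bigr => c _; rewrite [X in _ * X = _]mxE.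
have c4 : (c.+1 < 4)%N by exact: ltn_ord c.
rewrite (@coframe_h _ X a c.+1 c4) (@coframe_v _ X b c.+1 c4).
by rewrite (_ : lift ord0 c = inord c.+1)//; apply: val_inj; rewrite /= inordK.
Qed.

Lemma phi_form_mon (X : 'M[R]_(3, 4 + 4)) : tangential X ->
  let m := mon (fun i c => coframe g p E X i (inord c)) in
  phi_form g p X = m [:: 4; 5; 6]%N
   + (m [:: 0; 1; 4]%N + m [:: 0; 2; 5]%N + m [:: 0; 3; 6]%N)
   - (m [:: 1; 2; 6]%N + m [:: 2; 3; 4]%N + m [:: 3; 1; 5]%N).
Proof.
move=> tX m; rewrite /phi_form (alpha2_coframe _ hE); congr (_ + _ - _).
- rewrite /alpha (volume_coframe _ hE).
  transitivity (\det (colsub (fun i : 'I_3 => inord (i + 4)%N) (coframe g p E X))); last first.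
    by apply: det_mon => -[[|[|[|]]]]//= _; rewrite inordK.
  congr (\det _); apply/matrixP => a b; rewrite mxE [RHS]mxE.
  have -> : (b + 4 = b.+1 + 3)%N by rewrite addSn addnS.
  rewrite (@coframe_v _ X a b.+1 (ltn_ord b : (0 < b.+1 < 4)%N)).
  rewrite (_ : rshift 1 b = inord b.+1)//; apply: val_inj.
  by rewrite /= inordK// ltnS.
- rewrite /wedge.
  (* The factor is the inverse of [1! * 2!] from [wedge]. Each product in [beta] comes with its
     transpose, the two agree after antisymmetrization, and the resulting 2 cancels the factor. *)
  transitivity ((1 * 2)%:R^-1 * altsum (fun s : 'I_3 -> 'I_3 =>
    coframe g p E X (s ord0) (inord 0) *
    \sum_(c < 3) (coframe g p E X (s (@Ordinal 3 1 isT)) (inord c.+1)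
                  * coframe g p E X (s (@Ordinal 3 2 isT)) (inord (c.+1 + 3)%N)
     - coframe g p E X (s (@Ordinal 3 2 isT)) (inord c.+1)
                  * coframe g p E X (s (@Ordinal 3 1 isT)) (inord (c.+1 + 3)%N)))).
    congr (_ * _); apply: eq_bigr => s _; rewrite -mulrA; congr (_ * (_ * _)).
      rewrite mu_coframe usubmxEsub row_permEsub -rowsub_comp coframe_rowsub/=.
      by rewrite (_ : lshift 2 0 = ord0)//; apply: val_inj.
    rewrite /beta !hv_coframe; do ?by rewrite dsubmxEsub row_permEsub -rowsub_comp rowsubE; exact: tangentialM.
    rewrite -sumrB dsubmxEsub row_permEsub -rowsub_comp.
    rewrite (_ : @Ordinal 3 1 isT = rshift 1 0); last exact: val_inj.
    rewrite (_ : @Ordinal 3 2 isT = rshift 1 1); last exact: val_inj.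
    by apply: eq_bigr => c _; congr (_ * _ - _ * _); exact: coframe_rowsub.
  set co := coframe g p E X.
  have mon3 a b c : altsum (fun s => co (s (@Ordinal 3 0 isT)) (inord a)
       * co (s (@Ordinal 3 1 isT)) (inord b) * co (s (@Ordinal 3 2 isT)) (inord c))
       = m [:: a; b; c].
    apply: eq_altsum => s; rewrite !big_ord_recl big_ord0 mulr1 -!mulrA.
    by congr (co (s _) _ * (co (s _) _ * co (s _) _)); exact: val_inj.
  have sw a b : m [:: 0; a; b]%N = - m [:: 0; b; a]%N by exact: (@mon_swap _ _ _ [:: 0%N]).
  have -> : altsum (fun s : 'I_3 -> 'I_3 => co (s ord0) (inord 0) *
      \sum_(c < 3) (co (s (@Ordinal 3 1 isT)) (inord c.+1)
                  * co (s (@Ordinal 3 2 isT)) (inord (c.+1 + 3)%N)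
     - co (s (@Ordinal 3 2 isT)) (inord c.+1)
                  * co (s (@Ordinal 3 1 isT)) (inord (c.+1 + 3)%N))) =
     \sum_(c < 3) (m [:: 0; c.+1; c.+1 + 3]%N + (-1) * m [:: 0; c.+1 + 3; c.+1]%N).
    under [RHS]eq_bigr => c _ do rewrite -!mon3 -altsumZ -altsumD.
    rewrite -altsum_sum; apply: eq_altsum => s; rewrite big_distrr/=.
    apply: eq_bigr => c _; rewrite (_ : ord0 = @Ordinal 3 0 isT); last exact: val_inj.
    by ring.
  under eq_bigr => c _ do rewrite (sw (c.+1 + 3)%N c.+1) mulN1r opprK -mulr2n.
  rewrite !big_ord_recl big_ord0 addr0 /= /bump /= !add1n !addn3 -!mulrnDl mul1n.
  by rewrite -[X in _ * X]mulr_natl mulrA mulVf ?mul1r ?pnatr_eq0// addrA.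
- rewrite /coframe_monomial; congr (_ + _ + _);
    apply: det_mon => i; rewrite (tnth_nth ord0);
    by case: i => -[|[|[|]]]//= _; rewrite inordK.
Qed.

End PhiMonomials.

Section HodgePhi.
Variables (R : realType) (g : 'rV[R]_4 -> 'M[R]_4) (D : set 'rV[R]_4).
Hypothesis gD : local_metric g D.
Variables (p : 'rV[R]_(4 + 4)) (E : 'M[R]_4).
Hypotheses (Dp : D (base p)) (hE : adapted_frame g p E).

Lemma gram_tangential k (X : 'M[R]_(k, 4 + 4)) : tangential g p E X ->
  gram g p X = coframe g p E X *m (coframe g p E X)^T.
Proof.
move=> tX; apply: (gram_coframe gD Dp hE) => a.
rewrite (row0_frame hE) -!row_mul mxE -(tX a); congr (_ a _).
by apply: val_inj; rewrite /= inordK.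
Qed.

Lemma hodge_mon (J : 'M[R]_7) (c : 'I_3 -> 'I_7) (Y : 'M[R]_(4, 7))
   (c0 c1 c2 d0 d1 d2 d3 : nat) (j1 j2 : nat) (sg : bool) :
  0 < \det J ->
  [&& c0 < 7, j1 < 6 & j2 < 5]%N ->
  [/\ bump c0 j1 = c1, bump c0 (bump j1 j2) = c2 & odd (c0 + j1 + j2) = sg] ->
  [seq bump c0 (bump j1 (bump j2 j)) | j <- iota 0 4] = [:: d0; d1; d2; d3] ->
  (forall i : 'I_3, nth 0%N [:: c0; c1; c2] i = c i) ->
  hodge (erefl : (3 + 4 = 7)%N) (J *m J^T)
    (fun X => mon (fun i c => (X *m J) i (inord c)) [:: c0; c1; c2]) Y =
  (-1) ^+ sg * mon (fun i c => (Y *m J) i (inord c)) [:: d0; d1; d2; d3].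
Proof.
move=> J0 h1 h2 h3 h4; rewrite -(star_mon (Y *m J) h1 h2 h3 h4).
have := hodge_coframe (erefl : (3 + 4 = 7)%N) c Y J0.
rewrite castmx_id => <-; congr hodge; apply/funext => X.
by rewrite (det_mon _ h4).
Qed.

Lemma hodge_phi_form (X : 'M[R]_(7, 4 + 4)) (Y : 'M[R]_(4, 7)) : tangential g p E X ->
  0 < \det (coframe g p E X) ->
  let n := mon (fun i c => (Y *m coframe g p E X) i (inord c)) in
  hodge (erefl : (3 + 4 = 7)%N) (gram g p X) (fun Z => phi_form g p (Z *m X)) Y =
  n [:: 0; 1; 2; 3]%N
    + (n [:: 2; 3; 5; 6]%N + n [:: 1; 3; 4; 6]%N + n [:: 1; 2; 4; 5]%N)
    - (n [:: 0; 3; 4; 5]%N + n [:: 0; 1; 5; 6]%N - n [:: 0; 2; 4; 6]%N).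
Proof.
move=> tX J0 n; rewrite (gram_tangential tX).
set J := coframe g p E X in J0 n *.
pose w (c : seq nat) (Z : 'M[R]_(3, 7)) := mon (fun i j => (Z *m J) i (inord j)) c.
pose L := [:: (1, [:: 4; 5; 6]%N); (1, [:: 0; 1; 4]%N); (1, [:: 0; 2; 5]%N);
  (1, [:: 0; 3; 6]%N); (-1, [:: 1; 2; 6]%N); (-1, [:: 2; 3; 4]%N); (-1 : R, [:: 3; 1; 5]%N)].
transitivity (hodge (erefl : (3 + 4 = 7)%N) (J *m J^T)
    (fun Z => \sum_(l <- L) l.1 * w l.2 Z) Y).
  congr hodge; apply/funext => Z.
  rewrite (phi_form_mon gD Dp hE (tangentialM gD Dp Z tX)).
  rewrite (_ : (fun i c => _) = (fun i c => (Z *m J) i (inord c))); last first.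
    by apply/funext => i; apply/funext => c; rewrite (coframeM gD _ Dp).
  rewrite -/(w _ Z) /L !big_cons big_nil /=.
  by rewrite -![mon _ _]/(w _ Z); ring.
rewrite hodge_sum /L !big_cons big_nil /= /w.
have cI (c0 c1 c2 : nat) : (c0 < 7)%N -> (c1 < 7)%N -> (c2 < 7)%N ->
    forall i : 'I_3, nth 0%N [:: c0; c1; c2] i =
      (fun i : 'I_3 => inord (nth 0%N [:: c0; c1; c2] i) : 'I_7) i.
  by move=> h0 h1 h2 [[|[|[|]]]]//= _; rewrite inordK.
(* In each of these rewrites: the indices of the monomial, the complementary indices, the renumbered
   positions of the second and third index, and the parity of the sum of positions. Only
   [[:: 3; 1; 5]], whose indices are not increasing, gives an odd sum. *)
rewrite (@hodge_mon J _ Y 4 5 6 0 1 2 3 4 4 false J0 isT (And3 erefl erefl erefl) erefl (cI 4 5 6 isT isT isT)).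
rewrite (@hodge_mon J _ Y 0 1 4 2 3 5 6 0 2 false J0 isT (And3 erefl erefl erefl) erefl (cI 0 1 4 isT isT isT)).
rewrite (@hodge_mon J _ Y 0 2 5 1 3 4 6 1 3 false J0 isT (And3 erefl erefl erefl) erefl (cI 0 2 5 isT isT isT)).
rewrite (@hodge_mon J _ Y 0 3 6 1 2 4 5 2 4 false J0 isT (And3 erefl erefl erefl) erefl (cI 0 3 6 isT isT isT)).
rewrite (@hodge_mon J _ Y 1 2 6 0 3 4 5 1 4 false J0 isT (And3 erefl erefl erefl) erefl (cI 1 2 6 isT isT isT)).
rewrite (@hodge_mon J _ Y 2 3 4 0 1 5 6 2 2 false J0 isT (And3 erefl erefl erefl) erefl (cI 2 3 4 isT isT isT)).
rewrite (@hodge_mon J _ Y 3 1 5 0 2 4 6 1 3 true J0 isT (And3 erefl erefl erefl) erefl (cI 3 1 5 isT isT isT)).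
rewrite -/n; ring.
Qed.

End HodgePhi.

(** * The integrand of *phi *)

Definition rows4 (R : realType) (a b c d : 'rV[R]_4) : 'M[R]_4 :=
  \matrix_i nth 0 [:: a; b; c; d] i.

Section FrameCoordinates.
Variables (R : realType) (g : 'rV[R]_4 -> 'M[R]_4) (D : set 'rV[R]_4).
Hypothesis gD : local_metric g D.
Variables (p : 'rV[R]_(4 + 4)) (E : 'M[R]_4).
Hypotheses (Dp : D (base p)) (hE : adapted_frame g p E).
Implicit Types (a b c d v : 'rV[R]_4).

Definition crd v (j : nat) : R := (v *m g (base p) *m E^T) 0 (inord j).

Lemma crdD j a b : crd (a + b) j = crd a j + crd b j.
Proof. by rewrite /crd !mulmxDl !mxE. Qed.

Lemma crdZ j k a : crd (k *: a) j = k * crd a j.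
Proof. by rewrite /crd -!scalemxAl mxE. Qed.

Lemma crd_inner v (j : nat) : (j < 4)%N -> crd v j = inner g v (row (inord j) E) (base p).
Proof.
by move=> j4; rewrite /crd /inner mxE [RHS]mxE; apply: eq_bigr => i _; rewrite !mxE.
Qed.

Lemma crd_taut (j : nat) : (j < 4)%N -> crd (taut p) j = (j == 0%N)%:R.
Proof.
move=> j4; case: hE => E0 Eg _; rewrite /crd -E0 -!row_mul Eg !mxE.
by rewrite -val_eqE /= inordK// eq_sym.
Qed.

Lemma crd_inner_taut v : inner g (taut p) v (base p) = crd v 0.
Proof.
rewrite (inner_sym gD _ _ Dp) (row0_frame hE) /crd.
by congr (_ 0 _); apply: val_inj; rewrite /= inordK.
Qed.

Lemma crd_expand v : v = \sum_(j < 4) crd v j *: row j E.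
Proof.
case: hE => _ Eg _.
rewrite -{1}[v]mulmx1 -(frame_dual Eg) !mulmxA mulmx_sum_row.
by apply: eq_bigr => j _; rewrite /crd inord_val.
Qed.

Lemma inner_crd a b : inner g a b (base p) = \sum_(j < 4) crd a j * crd b j.
Proof.
case: hE => _ Eg _; rewrite /inner (frame_mul (local_sym gD Dp) Eg) mxE.
by apply: eq_bigr => j _; rewrite /crd inord_val [X in _ * X]mxE.
Qed.

Lemma volume_crd (V : 'I_4 -> 'rV[R]_4) : volume g (base p) (\matrix_i V i) =
  \det (\matrix_(i, j) crd (V i) j).
Proof.
case: hE => _ Eg E0; rewrite /volume (det_frame_coord Eg _ E0); congr (\det _).
apply/matrixP => i j; rewrite [RHS]mxE /crd inord_val.
by rewrite -[V i in RHS](rowK V i) -!row_mul [RHS]mxE.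
Qed.

Lemma volume_taut a b c : volume g (base p) (rows4 (taut p) a b c) =
  crd a 1 * (crd b 2 * crd c 3 - crd b 3 * crd c 2)
  - crd a 2 * (crd b 1 * crd c 3 - crd b 3 * crd c 1)
  + crd a 3 * (crd b 1 * crd c 2 - crd b 2 * crd c 1).
Proof.
rewrite volume_crd (expand_det_row _ ord0) (bigD1 ord0)//= big1 => [|j j0]; last first.
  by rewrite mxE /= crd_taut// (negbTE (j0 : val j != 0%N)) mul0r.
rewrite addr0 mxE /= crd_taut//= mul1r /cofactor expr0 mul1r.
pose f (i j : nat) := crd (nth 0 [:: taut p; a; b; c] i.+1) j.+1.
have -> : row' ord0 (col' ord0 (\matrix_(i < 4, j < 4)
    crd (nth 0 [:: taut p; a; b; c] i) j)) = \matrix_(i < 3, j < 3) f i j.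
  by apply/matrixP => i j; rewrite !mxE.
rewrite (expand_det_row _ 0) !big_ord_recl big_ord0 /cofactor.
rewrite !(expand_det_row _ 0) !big_ord_recl !big_ord0 /cofactor !det_mx11.
rewrite !mxE /= /bump /= /f /=; ring.
Qed.

(** Among the four vectors only [b] can have a component along [u], and bringing it to the first
    place takes one transposition. *)
Lemma volume_perp a b c d : crd a 0 = 0 -> crd c 0 = 0 -> crd d 0 = 0 ->
  volume g (base p) (rows4 a b c d) =
  - (crd b 0 * volume g (base p) (rows4 (taut p) a c d)).
Proof.
move=> a0 c0 d0; rewrite !volume_crd (expand_det_col _ ord0) !big_ord_recl big_ord0.
rewrite !mxE /= a0 c0 d0 !mul0r !(addr0, add0r) -mulrN; congr (_ * _).
rewrite (expand_det_row _ ord0) (bigD1 ord0)//= big1 => [|j j0]; last first.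
  by rewrite mxE /= crd_taut// (negbTE (j0 : val j != 0%N)) mul0r.
rewrite addr0 mxE /= crd_taut//= mul1r /cofactor /= expr0 mul1r addn0 expr1 mulN1r.
congr (- \det _); apply/matrixP => i j; rewrite !mxE; congr (crd _ _).
by case: i => -[|[|[|]]].
Qed.

End FrameCoordinates.

Notation "''o4_' k" := (@Ordinal 4 k isT) (at level 0, k at level 0).
Notation "''o5_' k" := (@Ordinal 5 k isT) (at level 0, k at level 0).

(** Reduces an antisymmetrization to monomials: [L] lists the expansion of the summand into products
    of components, and the hypothesis becomes a polynomial identity within reach of [ring]. *)
Lemma altsum_list4 (R : numFieldType) (m : 'I_4 -> nat -> R)
    (L : seq (R * (nat * nat * nat * nat))) (F : ('I_4 -> 'I_4) -> R) :
  (forall s : 'S_4, F s = \sum_(l <- L) l.1 *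
     (m (s 'o4_0) l.2.1.1.1 * m (s 'o4_1) l.2.1.1.2 * m (s 'o4_2) l.2.1.2 * m (s 'o4_3) l.2.2)) ->
  altsum F = \sum_(l <- L) l.1 * mon m [:: l.2.1.1.1; l.2.1.1.2; l.2.1.2; l.2.2].
Proof.
move=> FE; under [RHS]eq_bigr => l _ do rewrite -altsum_mon4 -altsumZ.
rewrite -altsum_sum; exact: eq_altsum.
Qed.

Lemma altsum_list5 (R : numFieldType) (m : 'I_5 -> nat -> R)
    (L : seq (R * (nat * nat * nat * nat * nat))) (F : ('I_5 -> 'I_5) -> R) :
  (forall s : 'S_5, F s = \sum_(l <- L) l.1 *
     (m (s 'o5_0) l.2.1.1.1.1 * m (s 'o5_1) l.2.1.1.1.2 * m (s 'o5_2) l.2.1.1.2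
      * m (s 'o5_3) l.2.1.2 * m (s 'o5_4) l.2.2)) ->
  altsum F = \sum_(l <- L) l.1 *
    mon m [:: l.2.1.1.1.1; l.2.1.1.1.2; l.2.1.1.2; l.2.1.2; l.2.2].
Proof.
move=> FE; under [RHS]eq_bigr => l _ do rewrite -altsum_mon5 -altsumZ.
rewrite -altsum_sum; exact: eq_altsum.
Qed.

Section StarPhi.
Variables (R : realType) (g : 'rV[R]_4 -> 'M[R]_4) (D : set 'rV[R]_4).
Hypothesis gD : local_metric g D.
Variables (p : 'rV[R]_(4 + 4)) (E : 'M[R]_4).
Hypotheses (Dp : D (base p)) (hE : adapted_frame g p E).
Variables (k : nat) (X : 'M[R]_(k, 4 + 4)).
Hypothesis tX : tangential g p E X.

Let th i := row i (horizontal X).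
Let nu i := row i (vertical g p X).
Let m i (c : nat) : R := coframe g p E X i (inord c).

Lemma crd_h i (c : nat) : (c < 4)%N -> crd g p E (th i) c = m i c.
Proof.
move=> c4; rewrite /m (coframe_h g p E X i c4) /crd /th -!row_mul mxE; done.
Qed.

Lemma crd_v i (c : nat) : (0 < c < 4)%N -> crd g p E (nu i) c = m i (c + 3)%N.
Proof.
by move=> c4; rewrite /m (coframe_v g p E X i c4) /crd /nu -!row_mul mxE.
Qed.

Lemma crd_v0 i : crd g p E (nu i) 0 = 0.
Proof. by rewrite /crd /nu -!row_mul mxE tX. Qed.

Lemma inner_hv i j : inner g (th i) (nu j) (base p) =
  m i 1%N * m j 4%N + m i 2%N * m j 5%N + m i 3%N * m j 6%N.
Proof.
rewrite (inner_crd gD Dp hE) !big_ord_recl big_ord0 crd_v0 mulr0 add0r addr0.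
by rewrite /= !crd_h// !crd_v// addrA.
Qed.

Lemma inner_taut_h i : inner g (taut p) (th i) (base p) = m i 0%N.
Proof. by rewrite (crd_inner_taut gD Dp hE) crd_h. Qed.

Lemma volume_hhh i j l : volume g (base p) (rows4 (taut p) (th i) (nu j) (nu l)) =
  m i 1%N * (m j 5%N * m l 6%N - m j 6%N * m l 5%N)
  - m i 2%N * (m j 4%N * m l 6%N - m j 6%N * m l 4%N)
  + m i 3%N * (m j 4%N * m l 5%N - m j 5%N * m l 4%N).
Proof. by rewrite (volume_taut hE) !crd_h// !crd_v. Qed.

End StarPhi.

Section StarPhi4.
Variables (R : realType) (g : 'rV[R]_4 -> 'M[R]_4) (D : set 'rV[R]_4).
Hypothesis gD : local_metric g D.
Variables (p : 'rV[R]_(4 + 4)) (E : 'M[R]_4).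
Hypotheses (Dp : D (base p)) (hE : adapted_frame g p E).
Variables (X : 'M[R]_(4, 4 + 4)).
Hypothesis tX : tangential g p E X.

Let th i := row i (horizontal X).
Let nu i := row i (vertical g p X).
Let m i (c : nat) : R := coframe g p E X i (inord c).

(** Origin of the constants: [volume] is already alternating, so antisymmetrization repeats it 4! =
    24 times. Each [e^{a,a+3,b,b+3}] with [a != b] arises from both orders of the two factors
    [<th, nu>], and each monomial of the last term from both orders of the two [nu], whence the
    factors [2^-1]. The sign of the middle term is absorbed when [a+3] and [b] are exchanged. *)
Lemma star_phi_altsum :
  mon m [:: 0; 1; 2; 3]%N
    + (mon m [:: 2; 3; 5; 6]%N + mon m [:: 1; 3; 4; 6]%N + mon m [:: 1; 2; 4; 5]%N)
    - (mon m [:: 0; 3; 4; 5]%N + mon m [:: 0; 1; 5; 6]%N - mon m [:: 0; 2; 4; 6]%N) =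
  altsum (fun s => 24^-1 * volume g (base p) (\matrix_i th (s i))
    - 2^-1 * (inner g (th (s 'o4_0)) (nu (s 'o4_1)) (base p)
              * inner g (th (s 'o4_2)) (nu (s 'o4_3)) (base p))
    - 2^-1 * (inner g (taut p) (th (s 'o4_0)) (base p)
       * volume g (base p) (rows4 (taut p) (th (s 'o4_1)) (nu (s 'o4_2)) (nu (s 'o4_3))))).
Proof.
have vol : altsum (fun s => 24^-1 * volume g (base p) (\matrix_i th (s i)))
   = mon m [:: 0; 1; 2; 3]%N.
  rewrite /altsum (eq_bigr (fun=> 24^-1 * volume g (base p) (\matrix_i th i))).
    rewrite sumr_const card_Sn -[LHS]mulr_natl mulrA mulfV ?mul1r//.
    rewrite (volume_crd hE) (_ : (\matrix_(i, j) _) =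
        colsub (fun j : 'I_4 => inord j : 'I_7) (coframe g p E X)).
      by apply: det_mon => -[[|[|[|[|]]]]]//= _; rewrite inordK.
    by apply/matrixP => i j; rewrite [LHS]mxE [RHS]mxE crd_h ?ltn_ord.
  move=> s _; rewrite mulrCA; congr (_ * _).
  rewrite (_ : \matrix_i th (s i) = row_perm s (\matrix_i th i)).
    by rewrite /volume row_permE det_mulmx det_perm mulrCA (mulrA (_ ^+ _)) -expr2 sqrr_sign mul1r.
  by apply/matrixP => i j; rewrite !mxE.
pose A (s : 'I_4 -> 'I_4) := 24^-1 * volume g (base p) (\matrix_i th (s i)).
pose B (s : 'I_4 -> 'I_4) :=
    - (2^-1 * (inner g (th (s 'o4_0)) (nu (s 'o4_1)) (base p)
              * inner g (th (s 'o4_2)) (nu (s 'o4_3)) (base p)))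
    - 2^-1 * (inner g (taut p) (th (s 'o4_0)) (base p)
       * volume g (base p) (rows4 (taut p) (th (s 'o4_1)) (nu (s 'o4_2)) (nu (s 'o4_3)))).
transitivity (altsum (fun s => A s + B s)); last by apply: eq_altsum => s; rewrite /A /B !addrA.
rewrite altsumD -addrA; congr (_ + _); first by rewrite vol.
pose h : R := 2^-1.
(* Nine products from [<th, nu> <th, nu>], of which the three squares have repeated indices, and six
   from [<u, th> Vol (u, th, nu, nu)]. *)
pose L : seq (R * (nat * nat * nat * nat)) :=
  [:: (-h, (1,4,1,4)); (-h, (1,4,2,5)); (-h, (1,4,3,6));
      (-h, (2,5,1,4)); (-h, (2,5,2,5)); (-h, (2,5,3,6));
      (-h, (3,6,1,4)); (-h, (3,6,2,5)); (-h, (3,6,3,6));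
      (-h, (0,1,5,6)); (h, (0,1,6,5)); (h, (0,2,4,6)); (-h, (0,2,6,4));
      (-h, (0,3,4,5)); (h, (0,3,5,4))]%N.
rewrite (@altsum_list4 _ m L) => [|s]; last first.
  rewrite /B.
  rewrite !(inner_hv gD Dp hE tX) (inner_taut_h gD Dp hE) (volume_hhh hE) -!/(m _ _).
  rewrite /L !big_cons big_nil /= -/h.
  move: (m (s 'o4_0)) (m (s 'o4_1)) (m (s 'o4_2)) (m (s 'o4_3)) => m0 m1 m2 m3.
  ring.
rewrite /L !big_cons big_nil /=.
have z c : size c = 4%N -> ~~ uniq c -> mon m c = 0 by exact: mon_eq0.
rewrite (z [:: 1; 4; 1; 4]%N erefl isT) (z [:: 2; 5; 2; 5]%N erefl isT) (z [:: 3; 6; 3; 6]%N erefl isT).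
have sw0 a b c d : mon m [:: b; a; c; d] = - mon m [:: a; b; c; d].
  by rewrite (@mon_swap _ _ m [::] a b).
have sw1 a b c d : mon m [:: a; c; b; d] = - mon m [:: a; b; c; d].
  by rewrite (@mon_swap _ _ m [:: a] b c).
have sw2 a b c d : mon m [:: a; b; d; c] = - mon m [:: a; b; c; d].
  by rewrite (@mon_swap _ _ m [:: a; b] c d).
rewrite (sw1 1 2 4 5)%N (sw1 1 3 4 6)%N.
rewrite (sw1 2 1 5 4)%N (sw0 1 2 5 4)%N (sw2 1 2 4 5)%N (sw1 2 3 5 6)%N.
rewrite (sw1 3 1 6 4)%N (sw0 1 3 6 4)%N (sw2 1 3 4 6)%N.
rewrite (sw1 3 2 6 5)%N (sw0 2 3 6 5)%N (sw2 2 3 5 6)%N.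
rewrite (sw2 0 1 5 6)%N (sw2 0 2 4 6)%N (sw2 0 3 4 5)%N.
rewrite /h.
move: (mon m [:: 2; 3; 5; 6]%N) (mon m [:: 1; 3; 4; 6]%N) (mon m [:: 1; 2; 4; 5]%N)
  (mon m [:: 0; 3; 4; 5]%N) (mon m [:: 0; 1; 5; 6]%N) (mon m [:: 0; 2; 4; 6]%N).
by move=> *; field.
Qed.

End StarPhi4.

(** * The exterior derivative of *phi *)

Lemma addrr3_eq0 (R : realFieldType) (a : R) : a + a + a = 0 -> a = 0.
Proof. lra. Qed.

Section FiveForm.
Variables (R : realType) (g : 'rV[R]_4 -> 'M[R]_4) (D : set 'rV[R]_4).
Hypothesis gD : local_metric g D.
Variables (p : 'rV[R]_(4 + 4)) (E : 'M[R]_4).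
Hypotheses (Dp : D (base p)) (hE : adapted_frame g p E).
Variables (X : 'M[R]_(5, 4 + 4)).
Hypothesis tX : tangential g p E X.

Let x := base p.
Let u := taut p.
Let th i := row i (horizontal X).
Let nu i := row i (vertical g p X).
Let m i (c : nat) : R := coframe g p E X i (inord c).
Let vol a b c d := volume g x (rows4 a b c d).
Let ip a b := inner g a b x.
Let rm i j := riem g x (th i) (th j) u.

Lemma ipBr c a b : ip c (a - b) = ip c a - ip c b.
Proof.
rewrite /ip /inner (_ : (a - b)^T = a^T - b^T); last exact: linearB.
by rewrite mulmxBr !mxE.
Qed.

Lemma ip0 c : ip c 0 = 0.
Proof. by rewrite /ip /inner trmx0 mulmx0 mxE. Qed.

Lemma mon5_eq0 c : size c = 5%N -> ~~ uniq c -> mon m c = 0.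
Proof. exact: mon_eq0. Qed.

(** Up to a factor this is the product of [beta] with [e^{156} + e^{264} + e^{345}]. The index pair
    [c], [c+3] from the first factor always meets one of the second, since the latter involves each
    of the residues 1, 2, 3 either as [a] or as [a+3]. *)
Lemma altsum_beta_alpha1 : altsum (fun s => ip (nu (s 'o5_0)) (th (s 'o5_1)) *
  vol u (th (s 'o5_2)) (nu (s 'o5_3)) (nu (s 'o5_4))) = 0.
Proof.
pose L : seq (R * (nat * nat * nat * nat * nat)) :=
  [seq (l.1, (c + 3, c, l.2.1.1, l.2.1.2, l.2.2)%N) | c <- [:: 1; 2; 3]%N,
   l <- [:: (1, (1, 5, 6)%N); (-1, (1, 6, 5)%N); (-1, (2, 4, 6)%N); (1, (2, 6, 4)%N);
            (1, (3, 4, 5)%N); (-1 : R, (3, 5, 4)%N)]].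
rewrite (@altsum_list5 _ m L) => [|s]; last first.
  rewrite /vol /ip (inner_sym gD _ _ Dp) (inner_hv gD Dp hE tX) (volume_hhh hE) -!/(m _ _).
  rewrite /L !big_cons big_nil /=.
  move: (m (s 'o5_0)) (m (s 'o5_1)) (m (s 'o5_2)) (m (s 'o5_3)) (m (s 'o5_4)) => m0 m1 m2 m3 m4.
  ring.
rewrite /L !big_cons big_nil /=.
by do !(rewrite mon5_eq0; [|by []|by []]); ring.
Qed.

(** By [volume_perp] the volume contains another factor [<u, th>]; the product of the two such
    factors is symmetric in slots 1 and 2. *)
Lemma altsum_perp : altsum (fun s => ip u (th (s 'o5_1)) *
  vol (nu (s 'o5_0)) (th (s 'o5_2)) (nu (s 'o5_3)) (nu (s 'o5_4))) = 0.
Proof.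
apply: (@altsum_eq0 _ _ 'o5_1 'o5_2) => // s /=.
rewrite tpermL tpermR !tpermD//.
have E' i j k l : vol (nu i) (th j) (nu k) (nu l) =
    - (ip u (th j) * vol u (nu i) (nu k) (nu l)).
  by rewrite /vol (volume_perp hE)// ?(crd_v0 tX)// -(crd_inner_taut gD Dp hE).
by rewrite !E' !mulrN mulrCA.
Qed.

(** Skewness moves the curvature from [u] onto the [th] in the first slot, after which the first
    Bianchi identity applies. *)
Lemma ip_riem_cyclic i j k : ip (th i) (rm j k) + ip (th j) (rm k i) + ip (th k) (rm i j) = 0.
Proof.
have B : riem g x (th i) (th j) (th k) + riem g x (th j) (th k) (th i)
    + riem g x (th k) (th i) (th j) = 0 := riem_bianchi gD (th i) (th j) (th k) Dp.
have e a b c : ip (th a) (rm b c) = - ip (riem g x (th b) (th c) (th a)) u.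
  apply: etrans (inner_sym gD (th a) _ Dp) _.
  apply: etrans (riem_skew gD (th b) (th c) u (th a) Dp) _; congr (- _).
  exact: (inner_sym gD _ _ Dp).
rewrite !e -!opprD.
move: B; generalize (riem g x (th i) (th j) (th k))
  (riem g x (th j) (th k) (th i)) (riem g x (th k) (th i) (th j)).
move=> r1 r2 r3 r0; have : ip (r1 + r2 + r3) u = 0 by rewrite r0 /ip /inner !mul0mx mxE.
rewrite /ip !innerDl => ir0.
move: ir0; generalize (inner g r1 u x) (inner g r2 u x) (inner g r3 u x).
by move=> a b c; lra.
Qed.

(** Stands for the covariant derivative of [nu j] along the [i]-th vector, known only through its
    antisymmetric part. *)
Variable N : 'I_5 -> 'I_5 -> 'rV[R]_4.
Hypothesis N_rm : forall i j, N i j - N j i = rm i j.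

(** Exchanging slots [i] and [l] shows that twice the sum is the one with [rm] in place of [N]. As
    [f] is invariant under permutations of the three slots, that sum equals its two cyclic shifts,
    and the total of the three vanishes by [ip_riem_cyclic]. *)
Lemma altsum_hN (f : ('I_5 -> 'I_5) -> R) (i j l : 'I_5) :
  i != j -> i != l -> j != l ->
  (forall s, f (s \o tperm i j) = f s) -> (forall s, f (s \o tperm i l) = f s) ->
  altsum (fun s => ip (th (s j)) (N (s i) (s l)) * f s) = 0.
Proof.
move=> ij il jl fij fil.
have lj : l != j by rewrite eq_sym.
pose F (s : 'I_5 -> 'I_5) := ip (th (s j)) (N (s i) (s l)) * f s.
have swap (G : ('I_5 -> 'I_5) -> R) (t1 t2 : 'I_5) : t1 != t2 ->
    altsum G = altsum (fun s => -1 * G (s \o tperm t1 t2)).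
  by move=> t12; rewrite altsumZ altsum_tperm// mulN1r opprK.
have antisym : altsum F * 2 = altsum (fun s => ip (th (s j)) (rm (s i) (s l)) * f s).
  rewrite mulr2n mulrDr mulr1 {2}(swap F i l il) -altsumD; apply: eq_altsum => s.
  rewrite /F fil /= tpermL tpermR (tpermD ij lj) mulN1r -mulNr -mulrDl; congr (_ * _).
  rewrite -N_rm; generalize (N (s i) (s l)) (N (s l) (s i)) => n1 n2.
  by rewrite ipBr.
suff rm0 : altsum (fun s => ip (th (s j)) (rm (s i) (s l)) * f s) = 0.
  have : altsum F * 2 = 0 by rewrite antisym rm0.
  by move/eqP; rewrite mulf_eq0 pnatr_eq0 orbF => /eqP.
have rmN a b c : ip c (rm a b) = - ip c (rm b a).
  have -> : rm a b = - rm b a by exact: (riemN gD (th a) (th b) u Dp).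
  generalize (rm b a) => r.
  by rewrite -[- r]sub0r ipBr ip0 sub0r.
set A := altsum _.
have AB : altsum (fun s => ip (th (s i)) (rm (s l) (s j)) * f s) = A.
  rewrite [RHS](swap _ i j ij); apply: eq_altsum => s.
  by rewrite fij /= tpermL tpermR (tpermD il jl) [in RHS]rmN mulN1r mulNr opprK.
have AC : altsum (fun s => ip (th (s l)) (rm (s j) (s i)) * f s) = A.
  rewrite -AB [RHS](swap _ i l il); apply: eq_altsum => s.
  by rewrite fil /= tpermL tpermR (tpermD ij lj) [in RHS]rmN mulN1r mulNr opprK.
have : A + altsum (fun s => ip (th (s i)) (rm (s l) (s j)) * f s)
    + altsum (fun s => ip (th (s l)) (rm (s j) (s i)) * f s) = 0.
  rewrite -!altsumD (eq_altsum (G := fun=> 0)) => [|s].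
    by rewrite /altsum; apply: big1 => s _; exact: mulr0.
  by rewrite -!mulrDl; apply: etrans (congr1 (fun t => t * f s) (ip_riem_cyclic _ _ _)) (mul0r _).
move=> sum0; apply: addrr3_eq0.
exact: etrans (esym (congr2 (fun a b => A + a + b) AB AC)) sum0.
Qed.

End FiveForm.

(** [M] vanishes on repeated indices, so [a] and [b] must be the two indices left over by [0] and
    [i], namely [j] and [k] in some order. Both orders contribute the same, because [rho] and [M]
    change sign together. *)
Lemma alternating_contraction (R : comPzRingType) (rho : nat -> nat -> nat -> R)
    (M : nat -> nat -> nat -> nat -> nat -> R) i j k :
  (forall a b c, rho a b c = - rho b a c) ->
  (forall a b c d e, ~~ uniq [:: a; b; c; d; e] -> M a b c d e = 0) ->
  (forall a b c d e, M d b c a e = - M a b c d e) ->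
  (i, j, k) \in
    [:: (1, 2, 3); (1, 3, 2); (2, 1, 3); (2, 3, 1); (3, 1, 2); (3, 2, 1)]%N ->
  \sum_(a < 4) \sum_(b < 4) rho a b j * M a 0%N i b (k + 3)%N =
  2 * (rho j k j * M j 0%N i k (k + 3)%N).
Proof.
move=> rN z sw ijk; pose r (a b : nat) := rho a b j * M a 0%N i b (k + 3)%N.
(* The terms are hidden behind an opaque [q] guarded by [uniq], so that simplification discards the
   vanishing ones among the sixteen. *)
have [q qE] : exists q : nat -> nat -> R, forall a b : nat,
    r a b = if uniq [:: a; 0%N; i; b; (k + 3)%N] then q a b else 0.
  by exists r => a b; case: ifPn => // /z zr; rewrite /r zr mulr0.
have rs : r k j = r j k by rewrite /r rN sw mulrNN.
rewrite -[RHS]/(2 * r j k) mulr_natl mulr2n -{2}rs.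
transitivity (\sum_(a < 4) \sum_(b < 4) r a b); first by [].
under eq_bigr => a _ do under eq_bigr => b _ do rewrite qE.
rewrite !qE; move: ijk; rewrite !big_ord_recl !big_ord0 /= /bump /= {r rs qE}.
by rewrite !inE => /or4P[|||/or3P[]] /eqP[-> -> ->] /=; rewrite !(addr0, add0r) // addrC.
Qed.

Section CurvatureTerm.
Variables (R : realType) (g : 'rV[R]_4 -> 'M[R]_4) (D : set 'rV[R]_4).
Hypothesis gD : local_metric g D.
Variables (p : 'rV[R]_(4 + 4)) (E : 'M[R]_4).
Hypotheses (Dp : D (base p)) (hE : adapted_frame g p E).
Variables (X : 'M[R]_(5, 4 + 4)).
Hypothesis tX : tangential g p E X.

Let x := base p.
Let u := taut p.
Let th i := row i (horizontal X).
Let nu i := row i (vertical g p X).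
Let m i (c : nat) : R := coframe g p E X i (inord c).
Let vol a b c d := volume g x (rows4 a b c d).
Let ip a b := inner g a b x.
Let rm i j := riem g x (th i) (th j) u.
Let ez (i : nat) : 'rV[R]_4 := row (inord i) E.
Let rho (a b c : nat) : R := crd g p E (riem g x (ez a) (ez b) u) c.
Let W (k : nat) := mon m [:: 0; 1; 2; 3; k]%N.
Let rc (k : nat) := ricci g x u (ez k).

Lemma crd_rm i j c : crd g p E (rm i j) c =
  \sum_(a < 4) \sum_(b < 4) rho a b c * (m i a * m j b).
Proof.
have expand l : th l = \sum_(a < 4) m l a *: ez a.
  rewrite {1}(crd_expand hE (th l)); apply: eq_bigr => a _.
  by rewrite (crd_h g p E X l (ltn_ord a)) /ez inord_val.
have crd_sum (r : seq 'I_4) (a : 'I_4 -> R) (e : 'I_4 -> 'rV_4) :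
    crd g p E (\sum_(l <- r) a l *: e l) c = \sum_(l <- r) a l * crd g p E (e l) c.
  elim/big_rec2: _ => [|l y z _ <-]; first by rewrite /crd !mul0mx mxE.
  by rewrite crdD crdZ.
have -> : rm i j = \sum_(a < 4) m i a *: \sum_(b < 4) m j b *: riem g x (ez a) (ez b) u.
  rewrite /rm (expand i) (expand j).
  apply: etrans (riem_suml gD _ _ _ _ _ Dp) _; apply: eq_bigr => a _; congr (_ *: _).
  exact: (riem_sumr gD _ _ _ _ _ Dp).
rewrite crd_sum; apply: eq_bigr => a _; rewrite crd_sum big_distrr/=.
by apply: eq_bigr => b _; rewrite -/(rho a b c) mulrA mulrC.
Qed.

Lemma rhoN a b c : rho a b c = - rho b a c.
Proof.
rewrite /rho; have -> : riem g x (ez a) (ez b) u = - riem g x (ez b) (ez a) u.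
  exact: (riemN gD _ _ _ Dp).
by rewrite -scaleN1r crdZ mulN1r.
Qed.

Lemma rho_diag a c : rho a a c = 0.
Proof. by have := rhoN a a c; lra. Qed.

Lemma rho0 k : rho 0 k 0 = 0.
Proof.
have e0 : ez 0 = u.
  case: hE => E0 _ _; rewrite /u -E0 /ez; congr (row _ E).
  by apply: val_inj; rewrite /= inordK.
rewrite /rho -(crd_inner_taut gD Dp hE) e0.
have := riem_skew gD u (ez k) u u Dp.
have E1 := inner_sym gD (riem g x u (ez k) u) u Dp.
move=> H; have := etrans (esym E1) H; rewrite -/u -/x.
by move: (inner g u _ x) => y; lra.
Qed.

(** In [rho] the vector [u] is the argument on which the curvature acts, so the trace computes
    [ricci (ez k) u]; symmetry of the Ricci tensor turns this into [rc k]. *)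
Lemma ricci_rho k : (k < 4)%N -> rc k = rho 0 k 0 + rho 1 k 1 + rho 2 k 2 + rho 3 k 3.
Proof.
move=> k4; case: (hE) => _ Eg _.
apply: etrans (ricciC gD u (ez k) Dp Eg) _.
apply: etrans (ricci_orthonormal gD (ez k) u Dp Eg) _.
have rE (l : 'I_4) : inner g (riem g x (row l E) (ez k) u) (row l E) x = rho l k l.
  by rewrite /rho crd_inner// /ez inord_val.
by rewrite (eq_bigr (fun l : 'I_4 => rho l k l)) ?(fun l _ => rE l)// !big_ord_recl big_ord0 addr0 !addrA.
Qed.

Lemma W_swap0 a b c d e : mon m [:: b; a; c; d; e] = - mon m [:: a; b; c; d; e].
Proof. by rewrite (@mon_swap _ _ m [::] a b). Qed.

Lemma W_swap1 a b c d e : mon m [:: a; c; b; d; e] = - mon m [:: a; b; c; d; e].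
Proof. by rewrite (@mon_swap _ _ m [:: a] b c). Qed.

Lemma W_swap2 a b c d e : mon m [:: a; b; d; c; e] = - mon m [:: a; b; c; d; e].
Proof. by rewrite (@mon_swap _ _ m [:: a; b] c d). Qed.

(** Expanding the volume gives six signed triples: the component of [th], that of the curvature, and
    that of [nu]. By [alternating_contraction] a triple [(i, j, k)] contributes twice [rho j k j]
    times a reordering of [e^{0123} /\ e^{k+3}]. For fixed [k] the two triples supply all of [rc k],
    as [rho 0 k 0] and [rho k k k] vanish. *)
Lemma altsum_curvature : altsum (fun s => ip u (th (s 'o5_1)) *
    vol u (th (s 'o5_2)) (rm (s 'o5_0) (s 'o5_3)) (nu (s 'o5_4))) =
  2 * (rc 1 * W 4 + rc 2 * W 5 + rc 3 * W 6).
Proof.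
pose L : seq (R * (nat * nat * nat)) :=
  [:: (1, (1, 2, 3)%N); (-1, (1, 3, 2)%N); (-1, (2, 1, 3)%N); (1, (2, 3, 1)%N);
      (1, (3, 1, 2)%N); (-1, (3, 2, 1)%N)].
have FE (s : 'I_5 -> 'I_5) : ip u (th (s 'o5_1)) *
    vol u (th (s 'o5_2)) (rm (s 'o5_0) (s 'o5_3)) (nu (s 'o5_4)) =
    \sum_(l <- L) l.1 * \sum_(a < 4) \sum_(b < 4) rho a b l.2.1.2 *
      (m (s 'o5_0) a * m (s 'o5_1) 0%N * m (s 'o5_2) l.2.1.1 * m (s 'o5_3) b
       * m (s 'o5_4) (l.2.2 + 3)%N).
  rewrite /ip /vol (inner_taut_h gD Dp hE) (volume_taut hE).
  rewrite !(crd_h g p E X _ (isT : (1 < 4)%N)) !(crd_h g p E X _ (isT : (2 < 4)%N)).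
  rewrite !(crd_h g p E X _ (isT : (3 < 4)%N)) !(crd_v g p E X _ (isT : (0 < 1 < 4)%N)).
  rewrite !(crd_v g p E X _ (isT : (0 < 2 < 4)%N)) !(crd_v g p E X _ (isT : (0 < 3 < 4)%N)).
  rewrite -/(rm _ _) -!/(m _ _).
  under eq_bigr => l _.
    rewrite (_ : \sum_(a < 4) _ = m (s 'o5_1) 0%N * m (s 'o5_2) l.2.1.1 *
      m (s 'o5_4) (l.2.2 + 3)%N * crd g p E (rm (s 'o5_0) (s 'o5_3)) l.2.1.2); last first.
      rewrite crd_rm big_distrr; apply: eq_bigr => a _ /=.
      rewrite big_distrr; apply: eq_bigr => b _ /=.
      generalize (rho a b l.2.1.2) (m (s 'o5_0) a) (m (s 'o5_1) 0%N) (m (s 'o5_2) l.2.1.1)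
        (m (s 'o5_3) b) (m (s 'o5_4) (l.2.2 + 3)%N).
      by move=> *; ring.
    over.
  rewrite /L !big_cons big_nil /= !addSn !add0n; ring.
apply: etrans (congr1 (@altsum _ _) (funext FE)) _; rewrite altsum_sum.
under eq_bigr => l _.
  rewrite altsumZ altsum_sum.
  under eq_bigr => a _.
    rewrite altsum_sum; under eq_bigr => b _ do rewrite altsumZ altsum_mon5; over.
  over.
have sw a b c d e : mon m [:: d; b; c; a; e] = - mon m [:: a; b; c; d; e].
  by rewrite W_swap0 W_swap1 W_swap2 W_swap1 W_swap0 !opprK.
have z a b c d e : ~~ uniq [:: a; b; c; d; e] -> mon m [:: a; b; c; d; e] = 0.
  exact: mon5_eq0.
have C i j k ijk := @alternating_contraction R rho
  (fun a b c d e => mon m [:: a; b; c; d; e]) i j k rhoN z sw ijk.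
rewrite /L !big_cons big_nil /=.
rewrite !C//.
rewrite -[(3 + 3)%N]/6%N !ricci_rho// !rho0 !rho_diag /W !(W_swap0 0%N).
rewrite (W_swap1 0 1 2 3 6)%N (W_swap1 0 1 3 2 5)%N (W_swap2 0 1 2 3 5)%N.
rewrite (W_swap1 0 2 3 1 4)%N (W_swap2 0 2 1 3 4)%N (W_swap1 0 1 2 3 4)%N.
generalize (mon m [:: 0; 1; 2; 3; 4]%N) (mon m [:: 0; 1; 2; 3; 5]%N) (mon m [:: 0; 1; 2; 3; 6]%N).
generalize (rho 1 2 1) (rho 1 3 1) (rho 2 1 2) (rho 2 3 2) (rho 3 1 3) (rho 3 2 3).
by clear; move=> *; ring.
Qed.

Lemma wedge_vol_ric : wedge (base_volume g p) (ric_flat g p) X =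
  rc 1 * W 4 + rc 2 * W 5 + rc 3 * W 6.
Proof.
have ricE i : ricci g x u (nu i) = \sum_(k < 3) rc k.+1 * m i (k.+1 + 3)%N.
  have sumr (r : seq 'I_4) (a : 'I_4 -> R) (e : 'I_4 -> 'rV_4) :
      ricci g x u (\sum_(l <- r) a l *: e l) = \sum_(l <- r) a l * ricci g x u (e l).
    elim/big_rec2: _ => [|l y z _ <-].
      by have := ricciZr gD 0 0 u Dp; rewrite scale0r mul0r.
    apply: etrans (ricciDr gD _ _ _ Dp) _; congr (_ + _); exact: (ricciZr gD _ _ _ Dp).
  rewrite [in LHS](crd_expand hE (nu i)) sumr big_ord_recl (crd_v0 tX) mul0r add0r.
  apply: eq_bigr => k _.
  have kk : lift ord0 k = inord k.+1 :> 'I_4.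
    by apply: val_inj; rewrite /= inordK// ltnS.
  apply: etrans (mulrC _ _) _; apply: (congr2 *%R).
    by rewrite /rc /ez -kk.
  exact: (crd_v g p E X i (ltn_ord k : (0 < k.+1 < 4)%N)).
have volE (s : 'S_5) : volume g x (\matrix_(i < 4) th (s (@lshift 4 1 i))) =
    \sum_(t : 'S_4) (-1) ^+ t * \prod_i m (s (@lshift 4 1 i)) (t i).
  rewrite (volume_crd hE); apply: eq_bigr => t _; congr (_ * _).
  by apply: eq_bigr => i _; rewrite mxE crd_h.
have monE' k (t : 'S_4) : mon m (rcons [seq val (t i) | i : 'I_4] k) = (-1) ^+ t * W k.
  have sz : size [seq val (t i) | i : 'I_4] = 4%N by rewrite size_map size_enum_ord.
  rewrite /W (@mon_perm _ _ m (lift_perm ord_max ord_max t) [:: 0; 1; 2; 3; k]%N).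
    by rewrite odd_lift_perm addbb.
  move=> i; case: (unliftP ord_max i) => [j|] ->; last first.
    by rewrite lift_perm_id /= nth_rcons sz ltnn eqxx.
  rewrite lift_perm_lift /= !/(bump 4 _) leqNgt ltn_ord add0n leqNgt ltn_ord add0n.
  rewrite nth_rcons sz ltn_ord (nth_map j) ?size_enum_ord// nth_ord_enum.
  by case: (t j) => -[|[|[|[|]]]].
(* Expanding the volume by the Leibniz formula over ['S_4] gives 24 signed monomials, each equal to
   [W] after reordering; this cancels the 4! of [wedge]. *)
transitivity ((4`! * 1`!)%:R^-1 * \sum_(k < 3) rc k.+1 * \sum_(t : 'S_4) (-1) ^+ t *
    mon m (rcons [seq val (t i) | i : 'I_4] (k.+1 + 3)%N)); last first.
  under eq_bigr => k _ do under eq_bigr => t _ do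
    rewrite monE' mulrA -expr2 sqrr_sign mul1r.
  under eq_bigr => k _ do rewrite sumr_const card_Sn -mulr_natl mulrCA.
  rewrite -big_distrr/= mulrA muln1 mulVf ?mul1r ?pnatr_eq0//.
  by rewrite !big_ord_recl big_ord0 /= /bump /= addr0 addrA.
congr (_ * _).
have monE2 k (t : 'S_4) : mon m (rcons [seq val (t i) | i : 'I_4] k) =
    \sum_(s : 'S_5) (-1) ^+ s * ((\prod_i m (s (@lshift 4 1 i)) (t i)) * m (s (@rshift 4 1 0)) k).
  have sz : size [seq val (t i) | i : 'I_4] = 4%N by rewrite size_map size_enum_ord.
  apply: eq_bigr => s _; congr (_ * _); rewrite big_ord_recr /=; congr (_ * m (s _) _).
  - apply: eq_bigr => i _; rewrite nth_rcons sz ltn_ord (nth_map i) ?size_enum_ord// nth_ord_enum.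
    by congr (m (s _) _); apply: val_inj.
  - by apply: val_inj.
  - by rewrite nth_rcons sz ltnn eqxx.
under [RHS]eq_bigr => k _.
  under eq_bigr => t _ do rewrite monE2 big_distrr/=.
  rewrite exchange_big big_distrr/=.
  over.
rewrite exchange_big/=; apply: eq_bigr => s _.
have -> : base_volume g p (usubmx (row_perm s X)) =
    \sum_(t : 'S_4) (-1) ^+ t * \prod_i m (s (@lshift 4 1 i)) (t i).
  rewrite -volE /base_volume; congr (volume _ _ _).
  by apply/matrixP => i j; rewrite !mxE.
have -> : ric_flat g p (dsubmx (row_perm s X)) =
    \sum_(k < 3) rc k.+1 * m (s (@rshift 4 1 0)) (k.+1 + 3)%N.
  rewrite -ricE -(ric_ricci gD _ _ Dp) /ric_flat; congr ((_ *m _^T) 0 0).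
  rewrite dsubmxEsub row_permEsub -rowsub_comp rowsubE (verticalM gD Dp) -rowsubE.
  by apply/rowP => j; rewrite !mxE.
rewrite [LHS]mulrC big_distrl/=; apply: eq_bigr => k _.
rewrite -mulrA; congr (_ * _); rewrite mulrA mulrC big_distrl/=.
apply: eq_bigr => t _; rewrite -mulrA; congr (_ * _).
by rewrite [in LHS]mulrA [LHS]mulrC.
Qed.

End CurvatureTerm.

Section FiveFormDerivative.
Variables (R : realType) (g : 'rV[R]_4 -> 'M[R]_4) (D : set 'rV[R]_4).
Hypothesis gD : local_metric g D.
Variables (p : 'rV[R]_(4 + 4)) (E : 'M[R]_4).
Hypotheses (Dp : D (base p)) (hE : adapted_frame g p E).
Variables (X : 'M[R]_(5, 4 + 4)).
Hypothesis tX : tangential g p E X.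

Let x := base p.
Let u := taut p.
Let th i := row i (horizontal X).
Let nu i := row i (vertical g p X).
Let vol a b c d := volume g x (rows4 a b c d).
Let ip a b := inner g a b x.
Let rm i j := riem g x (th i) (th j) u.

(** [S i j] and [N i j] stand for the covariant derivatives of [th j] and [nu j] along the [i]-th
    vector. The two hypotheses record torsion freeness and the commutator formula. *)
Variables (S N : 'I_5 -> 'I_5 -> 'rV[R]_4).
Hypothesis S_sym : forall i j, S i j = S j i.
Hypothesis N_rm : forall i j, N i j - N j i = rm i j.

Lemma vol_swap34 a b c : vol u a c b = - vol u a b c.
Proof. by rewrite /vol !(volume_taut hE); ring. Qed.

Lemma vol_subr3 a b b' c : vol u a (b - b') c = vol u a b c - vol u a b' c.
Proof.
by rewrite /vol !(volume_taut hE) -scaleN1r !crdD !crdZ; ring.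
Qed.

Lemma altsum_hess_vol : altsum (fun s => \sum_(k < 4) volume g x
   (\matrix_(i < 4) if i == k then S (s ord0) (s (lift ord0 i)) else th (s (lift ord0 i)))) = 0.
Proof.
rewrite altsum_sum; apply: big1 => k _.
apply: (@altsum_eq0 _ _ ord0 (lift ord0 k)) => // s; congr (volume g x _).
apply/row_matrixP => i; rewrite !rowK /= tpermL.
case: eqP => [->|/eqP ik]; first by rewrite tpermR S_sym.
by rewrite tpermD// (inj_eq lift_inj) eq_sym.
Qed.

(** Exchanging slots 3 and 4 identifies the two terms; exchanging slots 0 and 3 in one copy then
    produces the antisymmetric part of [N]. *)
Lemma altsum_NN : altsum (fun s => ip u (th (s 'o5_1)) *
    (vol u (th (s 'o5_2)) (N (s 'o5_0) (s 'o5_3)) (nu (s 'o5_4))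
     + vol u (th (s 'o5_2)) (nu (s 'o5_3)) (N (s 'o5_0) (s 'o5_4)))) =
  altsum (fun s => ip u (th (s 'o5_1)) *
    vol u (th (s 'o5_2)) (rm (s 'o5_0) (s 'o5_3)) (nu (s 'o5_4))).
Proof.
pose F1 (s : 'I_5 -> 'I_5) := ip u (th (s 'o5_1)) *
  vol u (th (s 'o5_2)) (N (s 'o5_0) (s 'o5_3)) (nu (s 'o5_4)).
pose F2 (s : 'I_5 -> 'I_5) := ip u (th (s 'o5_1)) *
  vol u (th (s 'o5_2)) (nu (s 'o5_3)) (N (s 'o5_0) (s 'o5_4)).
have swap (G : ('I_5 -> 'I_5) -> R) (t1 t2 : 'I_5) : t1 != t2 ->
    altsum G = altsum (fun s => -1 * G (s \o tperm t1 t2)).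
  by move=> t12; rewrite altsumZ altsum_tperm// mulN1r opprK.
have F21 : altsum F2 = altsum F1.
  rewrite (swap F2 'o5_3 'o5_4)//; apply: eq_altsum => s; rewrite /F2 /=.
  rewrite tpermL tpermR !tpermD// vol_swap34 mulrN mulN1r opprK.
  by [].
transitivity (altsum (fun s => F1 s + F2 s)).
  by apply: eq_altsum => s; rewrite mulrDr.
rewrite altsumD F21 {2}(swap F1 'o5_0 'o5_3)// -altsumD; apply: eq_altsum => s.
rewrite /F1 /= tpermL tpermR !tpermD// mulN1r -mulrBr -vol_subr3 N_rm.
by [].
Qed.

(** The Leibniz rule applied to the summand of [star_phi_altsum], slot 0 being the direction of
    differentiation and the old slots shifted by one. *)
Definition star_phi_deriv (s : 'I_5 -> 'I_5) : R :=
  24^-1 * \sum_(k < 4) volume g x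
   (\matrix_(i < 4) if i == k then S (s ord0) (s (lift ord0 i)) else th (s (lift ord0 i)))
  - 2^-1 * ((ip (S (s 'o5_0) (s 'o5_1)) (nu (s 'o5_2))
             + ip (th (s 'o5_1)) (N (s 'o5_0) (s 'o5_2))) * ip (th (s 'o5_3)) (nu (s 'o5_4))
            + ip (th (s 'o5_1)) (nu (s 'o5_2)) *
              (ip (S (s 'o5_0) (s 'o5_3)) (nu (s 'o5_4))
               + ip (th (s 'o5_3)) (N (s 'o5_0) (s 'o5_4))))
  - 2^-1 * ((ip (nu (s 'o5_0)) (th (s 'o5_1)) + ip u (S (s 'o5_0) (s 'o5_1))) *
              vol u (th (s 'o5_2)) (nu (s 'o5_3)) (nu (s 'o5_4))
            + ip u (th (s 'o5_1)) *
              (vol (nu (s 'o5_0)) (th (s 'o5_2)) (nu (s 'o5_3)) (nu (s 'o5_4))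
               + vol u (S (s 'o5_0) (s 'o5_2)) (nu (s 'o5_3)) (nu (s 'o5_4))
               + vol u (th (s 'o5_2)) (N (s 'o5_0) (s 'o5_3)) (nu (s 'o5_4))
               + vol u (th (s 'o5_2)) (nu (s 'o5_3)) (N (s 'o5_0) (s 'o5_4)))).

Lemma altsum_star_phi_deriv :
  altsum star_phi_deriv = - wedge (base_volume g p) (ric_flat g p) X.
Proof.
(* The first summand has coefficient 1/24, the others -1/2. Summands 0, 1, 3, 6, 8 vanish by
   symmetry of [S], summands 2 and 4 by Bianchi, summand 5 by repeated indices, summand 7 by the
   repeated factor [<u, th>]. Only the last survives. *)
pose f (i : nat) (s : 'I_5 -> 'I_5) : R := nth 0 [::
   \sum_(k < 4) volume g x
   (\matrix_(i < 4) if i == k then S (s ord0) (s (lift ord0 i)) else th (s (lift ord0 i)));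
   ip (S (s 'o5_0) (s 'o5_1)) (nu (s 'o5_2)) * ip (th (s 'o5_3)) (nu (s 'o5_4));
   ip (th (s 'o5_1)) (N (s 'o5_0) (s 'o5_2)) * ip (th (s 'o5_3)) (nu (s 'o5_4));
   ip (S (s 'o5_0) (s 'o5_3)) (nu (s 'o5_4)) * ip (th (s 'o5_1)) (nu (s 'o5_2));
   ip (th (s 'o5_3)) (N (s 'o5_0) (s 'o5_4)) * ip (th (s 'o5_1)) (nu (s 'o5_2));
   ip (nu (s 'o5_0)) (th (s 'o5_1)) * vol u (th (s 'o5_2)) (nu (s 'o5_3)) (nu (s 'o5_4));
   ip u (S (s 'o5_0) (s 'o5_1)) * vol u (th (s 'o5_2)) (nu (s 'o5_3)) (nu (s 'o5_4));
   ip u (th (s 'o5_1)) * vol (nu (s 'o5_0)) (th (s 'o5_2)) (nu (s 'o5_3)) (nu (s 'o5_4));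
   ip u (th (s 'o5_1)) * vol u (S (s 'o5_0) (s 'o5_2)) (nu (s 'o5_3)) (nu (s 'o5_4));
   ip u (th (s 'o5_1)) *
    (vol u (th (s 'o5_2)) (N (s 'o5_0) (s 'o5_3)) (nu (s 'o5_4))
     + vol u (th (s 'o5_2)) (nu (s 'o5_3)) (N (s 'o5_0) (s 'o5_4)))] i.
have fE : star_phi_deriv = (fun s => 24^-1 * f 0%N s + \sum_(1 <= i < 10) - 2^-1 * f i s).
  apply/funext => s; rewrite /star_phi_deriv /f unlock /=.
  by ring.
have f0 : altsum (f 0%N) = 0 by exact: altsum_hess_vol.
have fi i : (0 < i < 9)%N -> altsum (f i) = 0.
  case: i => [|[|[|[|[|[|[|[|[|]]]]]]]]]// _.
  - apply: (@altsum_eq0 _ _ 'o5_0 'o5_1) => // s; rewrite /f /=.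
    by rewrite tpermL tpermR !tpermD// S_sym.
  - apply: (altsum_hN gD Dp (i := 'o5_0) N_rm) => // s /=; by rewrite !tpermD.
  - apply: (@altsum_eq0 _ _ 'o5_0 'o5_3) => // s; rewrite /f /=.
    by rewrite tpermL tpermR !tpermD// S_sym.
  - apply: (altsum_hN gD Dp (i := 'o5_0) N_rm) => // s /=; by rewrite !tpermD.
  - exact: (altsum_beta_alpha1 gD Dp hE tX).
  - apply: (@altsum_eq0 _ _ 'o5_0 'o5_1) => // s; rewrite /f /=.
    by rewrite tpermL tpermR !tpermD// S_sym.
  - exact: (altsum_perp gD Dp hE tX).
  - apply: (@altsum_eq0 _ _ 'o5_0 'o5_2) => // s; rewrite /f /=.
    by rewrite tpermL tpermR !tpermD// S_sym.
have f9 : altsum (f 9%N) = 2 * wedge (base_volume g p) (ric_flat g p) X.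
  have E9 : altsum (f 9%N) = _ := altsum_NN.
  apply: etrans E9 _; have A := altsum_curvature gD Dp hE X.
  apply: etrans A _; congr (_ * _); exact: esym (wedge_vol_ric gD Dp hE tX).
rewrite fE altsumD altsumZ f0 mulr0 add0r altsum_sum big_nat_recr//= big_nat.
rewrite big1 => [|i /fi fi0]; last by rewrite altsumZ fi0 mulr0.
by rewrite add0r altsumZ f9 mulrA mulNr mulVf ?pnatr_eq0// mulN1r.
Qed.

End FiveFormDerivative.

(** * Position and tautological vector in a direct parametrization *)

Section SphereParam.
Variables (R : realType) (g : 'rV[R]_4 -> 'M[R]_4) (D : set 'rV[R]_4).
Hypothesis gD : local_metric g D.
Variables (P : set 'rV[R]_7) (c : 'rV[R]_7 -> 'rV[R]_(4 + 4)).
Hypotheses (P_open : open P) (c_smooth : smooth_on P c).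
Hypothesis c_base : forall z, P z -> D (base (c z)).
Hypothesis c_unit : forall z, P z -> inner g (taut (c z)) (taut (c z)) (base (c z)) = 1.
Implicit Types (y z : 'rV[R]_7).

Let x y := base (c y).
Let u y := taut (c y).

Lemma nearP z : P z -> \forall y \near z, P y.
Proof. by move=> Pz; exact: open_nbhs_nbhs (conj P_open Pz). Qed.

Lemma param_diff z : P z -> differentiable c z.
Proof. by move=> Pz; exact: (c_smooth [::] Pz). Qed.

Lemma param_diff2 z v : P z -> differentiable ('D_v c) z.
Proof. by move=> Pz; exact: (c_smooth [:: v] Pz). Qed.

Lemma base_diff z : P z -> differentiable x z.
Proof.
move=> Pz; apply: (@differentiable_comp _ _ _ _ c (@lsubmx R 1 4 4)).
  exact: param_diff.
exact: differentiable_lsubmx.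
Qed.

Lemma taut_diff z : P z -> differentiable u z.
Proof.
move=> Pz; apply: (@differentiable_comp _ _ _ _ c (@rsubmx R 1 4 4)).
  exact: param_diff.
exact: differentiable_rsubmx.
Qed.

Lemma derive_base z v : P z -> 'D_v x z = lsubmx ('D_v c z).
Proof.
move=> Pz; apply: derive_val; apply: is_derive_mx => i j.
rewrite mxE (_ : (fun y => x y i j) = (fun y => c y i (lshift 4 j))).
  exact: is_derive_entry (is_derive_diff v (param_diff Pz)).
by apply/funext => y; rewrite /x mxE.
Qed.

Lemma derive_taut z v : P z -> 'D_v u z = rsubmx ('D_v c z).
Proof.
move=> Pz; apply: derive_val; apply: is_derive_mx => i j.
rewrite mxE (_ : (fun y => u y i j) = (fun y => c y i (rshift 4 j))).
  exact: is_derive_entry (is_derive_diff v (param_diff Pz)).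
by apply/funext => y; rewrite /u mxE.
Qed.

Lemma base_diff2 z v : P z -> differentiable ('D_v x) z.
Proof.
move=> Pz; apply: (@near_eq_differentiable _ _ _ (fun y => lsubmx ('D_v c y))).
  by apply: filterS (nearP Pz) => y Py; exact: esym (derive_base v Py).
apply: (@differentiable_comp _ _ _ _ ('D_v c) (@lsubmx R 1 4 4)).
  exact: param_diff2.
exact: differentiable_lsubmx.
Qed.

Lemma taut_diff2 z v : P z -> differentiable ('D_v u) z.
Proof.
move=> Pz; apply: (@near_eq_differentiable _ _ _ (fun y => rsubmx ('D_v c y))).
  by apply: filterS (nearP Pz) => y Py; exact: esym (derive_taut v Py).
apply: (@differentiable_comp _ _ _ _ ('D_v c) (@rsubmx R 1 4 4)).
  exact: param_diff2.
exact: differentiable_rsubmx.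
Qed.

Lemma row_jacobian k (X : 'M[R]_(k, 7)) z a : P z ->
  row a (X *m jacobian c z) = 'D_(row a X) c z.
Proof. by move=> Pz; rewrite row_mul deriveEjacobian//; exact: param_diff. Qed.

Lemma horizontal_jacobian k (X : 'M[R]_(k, 7)) z a : P z ->
  row a (horizontal (X *m jacobian c z)) = 'D_(row a X) x z.
Proof.
move=> Pz; apply: etrans _ (esym (derive_base _ Pz)).
have := congr1 lsubmx (row_jacobian X a Pz).
by rewrite /horizontal => <-; apply/rowP => j; rewrite !mxE.
Qed.

Lemma vertical_jacobian k (X : 'M[R]_(k, 7)) z a : P z ->
  row a (vertical g (c z) (X *m jacobian c z)) = cov g x u (row a X) z.
Proof.
move=> Pz; rewrite rowK /cov.
have -> : row a (lsubmx (X *m jacobian c z)) = 'D_(row a X) x z.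
  exact: horizontal_jacobian.
congr (_ + _); apply: etrans _ (esym (derive_taut _ Pz)).
have := congr1 rsubmx (row_jacobian X a Pz).
by move=> <-; apply/rowP => j; rewrite !mxE.
Qed.

(** Differentiate [<u, u> = 1] with the metric connection. *)
Lemma cov_taut_orth z v : P z -> inner g (cov g x u v z) (u z) (x z) = 0.
Proof.
move=> Pz; have dx := base_diff Pz; have du := taut_diff Pz.
have H := is_derive_inner gD v dx (c_base Pz) du du.
have E : 'D_v (fun y => inner g (u y) (u y) (x y)) z = 0.
  apply: (@etrans _ _ ('D_v (cst (1 : R)) z)); last exact: derive_cst.
  by apply: near_eq_derive; apply: filterS (nearP Pz) => y Py; exact: c_unit.
have := etrans (esym (@derive_val _ _ _ _ _ _ _ H)) E.
have : inner g (u z) (cov g x u v z) (x z) = inner g (cov g x u v z) (u z) (x z).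
  exact: (inner_sym gD (u z) (cov g x u v z) (c_base Pz)).
generalize (inner g (cov g x u v z) (u z) (x z)) (inner g (u z) (cov g x u v z) (x z)).
by move=> a b ->; lra.
Qed.

Lemma jacobian_tangential z E : P z -> adapted_frame g (c z) E ->
  tangential g (c z) E (jacobian c z).
Proof.
move=> Pz hE a; have := cov_taut_orth (row a 1%:M) Pz.
rewrite -(vertical_jacobian _ _ Pz) mul1mx (row0_frame hE) -!row_mul mxE => <-.
by congr (_ a _); apply: val_inj; rewrite /= inordK.
Qed.

End SphereParam.

Section DStarPhi.
Variables (R : realType) (g : 'rV[R]_4 -> 'M[R]_4) (D : set 'rV[R]_4).
Hypothesis gD : local_metric g D.
Variables (P : set 'rV[R]_7) (c : 'rV[R]_7 -> 'rV[R]_(4 + 4)).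
Hypotheses (P_open : open P) (c_smooth : smooth_on P c).
Hypothesis c_base : forall z, P z -> D (base (c z)).
Hypothesis c_unit : forall z, P z -> inner g (taut (c z)) (taut (c z)) (base (c z)) = 1.
Hypothesis c_direct : forall z, P z -> exists2 E, adapted_frame g (c z) E &
  0 < \det (coframe g (c z) E (jacobian c z)).
Implicit Types (y z v : 'rV[R]_7) (Y : 'I_4 -> 'rV[R]_7).

Let x y := base (c y).
Let u y := taut (c y).

Definition star_phi_integrand y Y : R :=
  24^-1 * volume g (x y) (\matrix_i 'D_(Y i) x y)
  - 2^-1 * (inner g ('D_(Y 'o4_0) x y) (cov g x u (Y 'o4_1) y) (x y)
            * inner g ('D_(Y 'o4_2) x y) (cov g x u (Y 'o4_3) y) (x y))
  - 2^-1 * (inner g (u y) ('D_(Y 'o4_0) x y) (x y) * volume g (x y)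
      (rows4 (u y) ('D_(Y 'o4_1) x y) (cov g x u (Y 'o4_2) y) (cov g x u (Y 'o4_3) y))).

(** The adapted frame at [y] is used to verify the identity there and disappears from the result, so
    the right-hand side can be differentiated in [y]. *)
Lemma star_phiE y (Z : 'M[R]_(4, 7)) : P y ->
  hodge (erefl : (3 + 4 = 7)%N) (gram g (c y) (jacobian c y))
    (pullback c (phi_form g) y) Z =
  altsum (fun s => star_phi_integrand y (fun i => row (s i) Z)).
Proof.
move=> Py; have [E hE J0] := c_direct Py; have Dy := c_base Py.
have tJ := jacobian_tangential gD P_open c_smooth c_base c_unit Py hE.
apply: etrans (hodge_phi_form gD Dy hE Z tJ J0) _.
have tZ := tangentialM gD Dy Z tJ.
have H := star_phi_altsum gD Dy hE tZ.
rewrite (_ : (fun i c => _) = (fun i (k : nat) => coframe g (c y) E (Z *m jacobian c y) i (inord k))).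
  apply: etrans H _; apply: eq_altsum => s; rewrite /star_phi_integrand.
  have h a := horizontal_jacobian c_smooth Z a Py.
  have v a := vertical_jacobian g c_smooth Z a Py.
  rewrite !h !v; congr (_ * volume _ _ _ - _ - _).
  by apply/row_matrixP => i; rewrite !rowK h.
by apply/funext => i; apply/funext => k; rewrite (coframeM gD _ Dy).
Qed.

End DStarPhi.

Lemma wedge_pullback (R : realType) (m n k l : nat) (h : 'rV[R]_m -> 'rV[R]_n)
    (a : 'rV[R]_n -> covector R n k) (b : 'rV[R]_n -> covector R n l) z X :
  wedge (pullback h a z) (pullback h b z) X = wedge (a (h z)) (b (h z)) (X *m jacobian h z).
Proof.
rewrite /wedge; congr (_ * _); apply: eq_bigr => s _.
by rewrite /pullback !usubmxEsub !dsubmxEsub !row_permEsub -!rowsub_comp !mul_rowsub_mx.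
Qed.

Lemma is_derive_volume4 (R : realType) (g : 'rV[R]_4 -> 'M[R]_4) (D : set 'rV[R]_4)
    (gD : local_metric g D) (V : normedModType R) (x a b c d : V -> 'rV[R]_4) v z :
  differentiable x z -> D (x z) -> differentiable a z -> differentiable b z ->
  differentiable c z -> differentiable d z ->
  is_derive z v (fun y => volume g (x y) (rows4 (a y) (b y) (c y) (d y)))
   (volume g (x z) (rows4 (cov g x a v z) (b z) (c z) (d z))
    + volume g (x z) (rows4 (a z) (cov g x b v z) (c z) (d z))
    + volume g (x z) (rows4 (a z) (b z) (cov g x c v z) (d z))
    + volume g (x z) (rows4 (a z) (b z) (c z) (cov g x d v z))).
Proof.
move=> dx Dx da db dc dd.
pose r (i : 'I_4) : V -> 'rV[R]_4 := nth (cst 0) [:: a; b; c; d] i.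
have rd i : differentiable (r i) z by case: i => -[|[|[|[|]]]].
have H := is_derive_volume gD v dx Dx rd.
have rE y : \matrix_i r i y = rows4 (a y) (b y) (c y) (d y).
  by apply/row_matrixP => -[[|[|[|[|]]]]]//= h; rewrite !rowK.
rewrite (_ : (fun y => volume g (x y) _) = (fun y => volume g (x y) (\matrix_i r i y))); last first.
  by apply/funext => y; rewrite rE.
apply: (is_derive_eq H); rewrite !big_ord_recl big_ord0 addr0 !addrA.
by congr (_ + _ + _ + _); congr (volume g (x z) _);
  apply/row_matrixP => -[[|[|[|[|]]]]]//= h; rewrite !rowK.
Qed.

Section DStarPhiDerivative.
Variables (R : realType) (g : 'rV[R]_4 -> 'M[R]_4) (D : set 'rV[R]_4).
Hypothesis gD : local_metric g D.
Variables (P : set 'rV[R]_7) (c : 'rV[R]_7 -> 'rV[R]_(4 + 4)).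
Hypotheses (P_open : open P) (c_smooth : smooth_on P c).
Hypothesis c_base : forall z, P z -> D (base (c z)).
Hypothesis c_unit : forall z, P z -> inner g (taut (c z)) (taut (c z)) (base (c z)) = 1.
Hypothesis c_direct : forall z, P z -> exists2 E, adapted_frame g (c z) E &
  0 < \det (coframe g (c z) E (jacobian c z)).
Implicit Types (y z v : 'rV[R]_7) (Y : 'I_4 -> 'rV[R]_7).

Let x y := base (c y).
Let u y := taut (c y).

Definition star_phi_integrand_deriv v Y z : R :=
  let th a := 'D_a x z in let nu a := cov g x u a z in
  let S a := cov g x ('D_a x) v z in let N a := cov g x (cov g x u a) v z in
  let ip a b := inner g a b (x z) in
  let vol a b c d := volume g (x z) (rows4 a b c d) in
  24^-1 * (\sum_(k < 4) volume g (x z)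
    (\matrix_i if i == k then S (Y i) else th (Y i)))
  - 2^-1 * ((ip (S (Y 'o4_0)) (nu (Y 'o4_1)) + ip (th (Y 'o4_0)) (N (Y 'o4_1)))
              * ip (th (Y 'o4_2)) (nu (Y 'o4_3))
            + ip (th (Y 'o4_0)) (nu (Y 'o4_1))
              * (ip (S (Y 'o4_2)) (nu (Y 'o4_3)) + ip (th (Y 'o4_2)) (N (Y 'o4_3))))
  - 2^-1 * ((ip (nu v) (th (Y 'o4_0)) + ip (u z) (S (Y 'o4_0)))
              * vol (u z) (th (Y 'o4_1)) (nu (Y 'o4_2)) (nu (Y 'o4_3))
            + ip (u z) (th (Y 'o4_0)) *
              (vol (nu v) (th (Y 'o4_1)) (nu (Y 'o4_2)) (nu (Y 'o4_3))
               + vol (u z) (S (Y 'o4_1)) (nu (Y 'o4_2)) (nu (Y 'o4_3))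
               + vol (u z) (th (Y 'o4_1)) (N (Y 'o4_2)) (nu (Y 'o4_3))
               + vol (u z) (th (Y 'o4_1)) (nu (Y 'o4_2)) (N (Y 'o4_3)))).

Lemma is_derive_star_phi_integrand v Y z : P z ->
  is_derive z v (fun y => star_phi_integrand g c y Y) (star_phi_integrand_deriv v Y z).
Proof.
move=> Pz; have Dx := c_base Pz.
have dx := base_diff c_smooth Pz; have du := taut_diff c_smooth Pz.
have dth a : differentiable ('D_a x) z by exact: (base_diff2 P_open c_smooth a Pz).
have dnu a : differentiable (cov g x u a) z.
  by apply: (cov_differentiable gD) => //; exact: (taut_diff2 P_open c_smooth a Pz).
have Zscale (f : 'rV[R]_7 -> R) df k : is_derive z v f df ->
    is_derive z v (fun y => k * f y) (k * df).
  by move=> hf; apply: (@is_deriveZ _ _ _ f).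
apply: is_deriveB; first apply: is_deriveB.
- by apply: Zscale; apply: (is_derive_volume gD).
- apply: Zscale; apply: is_deriveM'.
    exact: (is_derive_inner gD v dx Dx (dth _) (dnu _)).
  exact: (is_derive_inner gD v dx Dx (dth _) (dnu _)).
- apply: Zscale; apply: is_deriveM'.
    exact: (is_derive_inner gD v dx Dx du (dth _)).
  exact: (is_derive_volume4 gD v dx Dx du (dth _) (dnu _) (dnu _)).
Qed.

Theorem d_star_phi z (X : 'M[R]_(5, 7)) : P z ->
  ext_d (fun y => hodge (erefl : (3 + 4 = 7)%N) (gram g (c y) (jacobian c y))
    (pullback c (phi_form g) y)) z X =
  - wedge (pullback c (base_volume g) z) (pullback c (ric_flat g) z) X.
Proof.
move=> Pz; have Dx := c_base Pz; have [E hE J0] := c_direct Pz.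
have dx := base_diff c_smooth Pz; have du := taut_diff c_smooth Pz.
have dth a : differentiable ('D_a x) z by exact: (base_diff2 P_open c_smooth a Pz).
have dua a : differentiable ('D_a u) z by exact: (taut_diff2 P_open c_smooth a Pz).
have ndx : \forall y \near z, differentiable x y.
  by apply: filterS (nearP P_open Pz) => y Py; exact: (base_diff c_smooth Py).
have ndu : \forall y \near z, differentiable u y.
  by apply: filterS (nearP P_open Pz) => y Py; exact: (taut_diff c_smooth Py).
have starE : \forall y \near z, forall Z, hodge (erefl : (3 + 4 = 7)%N)
    (gram g (c y) (jacobian c y)) (pullback c (phi_form g) y) Z =
    altsum (fun s => star_phi_integrand g c y (fun i => row (s i) Z)).
  by apply: filterS (nearP P_open Pz) => y Py Z; exact: (star_phiE gD P_open c_smooth).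
apply: etrans (ext_d_altsum X starE (fun v Y => is_derive_star_phi_integrand v Y Pz)) _.
have tJ := jacobian_tangential gD P_open c_smooth c_base c_unit Pz hE.
(* The arrays of the algebraic part, now as actual derivatives. [S] is symmetric by [Schwarz_mx] and
   [christoffelC]; the relation for [N] is [curvature_along] applied to the section [u]. *)
pose S (i j : 'I_5) := cov g x ('D_(row j X) x) (row i X) z.
pose N (i j : 'I_5) := cov g x (cov g x u (row j X)) (row i X) z.
have S_sym i j : S i j = S j i.
  rewrite /S /cov; have := Schwarz_mx ndx (dth (row i X)) (dth (row j X)).
  have := christoffelC gD ('D_(row i X) x z) ('D_(row j X) x z) Dx.
  by move=> e1 e2; exact: (congr2 +%R e2 e1).
set XJ := X *m jacobian c z.
have h a : 'D_(row a X) x z = row a (horizontal XJ).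
  exact: esym (horizontal_jacobian c_smooth X a Pz).
have v a : cov g x u (row a X) z = row a (vertical g (c z) XJ).
  exact: esym (vertical_jacobian g c_smooth X a Pz).
have N_rm i j : N i j - N j i =
    riem g (base (c z)) (row i (horizontal XJ)) (row j (horizontal XJ)) (taut (c z)).
  rewrite -!h; exact: (@curvature_along _ _ _ _ gD _ x u _ _ z Dx ndx ndu
    (dth _) (dth _) (dua _) (dua _)).
have tX := tangentialM gD Dx X tJ.
have W : @wedge R 7 4 1 (pullback c (base_volume g) z) (pullback c (ric_flat g) z) X
    = @wedge R (4 + 4) 4 1 (base_volume g (c z)) (ric_flat g (c z)) XJ.
  exact: wedge_pullback.
apply: etrans _ (congr1 -%R (esym W)).
apply: etrans _ (altsum_star_phi_deriv gD Dx hE tX S_sym N_rm).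
apply: eq_altsum => s.
rewrite /star_phi_integrand_deriv /star_phi_deriv.
have o4E (k : nat) (k4 : (k < 4)%N) (k5 : (k.+1 < 5)%N) :
    lift ord0 (Ordinal k4) = Ordinal k5 by exact: val_inj.
rewrite !(o4E 0 isT isT) !(o4E 1 isT isT) !(o4E 2 isT isT) !(o4E 3 isT isT).
rewrite (_ : ord0 = 'o5_0); last exact: val_inj.
rewrite -!h -!v.
congr (_ * _ - _ - _); apply: eq_bigr => k _; congr (volume g _ _).
by apply/row_matrixP => i; rewrite !rowK; case: ifP => // _; rewrite h.
Qed.

End DStarPhiDerivative.

(** * Adapted frames and direct parametrizations *)

Section GramSchmidt.
Variables (R : rcfType) (n : nat) (G : 'M[R]_n).
Hypothesis G_sym : G^T = G.
Hypothesis G_pos : forall v : 'rV[R]_n, v != 0 -> 0 < (v *m G *m v^T) 0 0.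

(** Gram-Schmidt by rank: while [k < n], the kernel of [G *m F^T] contains a nonzero vector, which
    is normalized and adjoined to [F]. *)
Lemma orthonormal_extension m k (F : 'M[R]_(k, n)) : (k + m)%N = n ->
  F *m G *m F^T = 1%:M ->
  exists F' : 'M[R]_(m, n), F' *m G *m F'^T = 1%:M /\ F' *m G *m F^T = 0.
Proof.
elim: m k F => [|m IH] k F kmn FG.
  by exists 0; split; apply/matrixP => -[].
have [w w0 wF] : exists2 w : 'rV[R]_n, w != 0 & w *m G *m F^T = 0.
  have rk : (\rank (G *m F^T) < n)%N.
    by rewrite (leq_ltn_trans (rank_leq_col _))// -kmn addnS ltnS leq_addr.
  have : kermx (G *m F^T) != 0.
    by rewrite -mxrank_eq0 mxrank_ker subn_eq0 -ltnNge.
  case/rowV0Pn => w /sub_kermxP wk w0; exists w => //.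
  by rewrite -mulmxA.
pose q := (w *m G *m w^T) 0 0; have q0 : 0 < q by exact: G_pos.
pose e := (Num.sqrt q)^-1 *: w.
have eE : e *m G *m e^T = 1%:M.
  rewrite [e *m G *m e^T]mx11_scalar; congr (_%:M).
  rewrite /e (_ : (_ *: w)^T = (Num.sqrt q)^-1 *: w^T); last exact: linearZ.
  rewrite -!(scalemxAl, scalemxAr) scalerA mxE -/q -expr2 exprVn sqr_sqrtr ?ltW//.
  by rewrite mulVf// gt_eqF.
have eF : e *m G *m F^T = 0 by rewrite /e -!scalemxAl wF scaler0.
have Fe : F *m G *m e^T = 0.
  have := congr1 trmx eF; rewrite !trmx_mul trmxK G_sym trmx0 => <-.
  by rewrite mulmxA.
have F1G : col_mx F e *m G *m (col_mx F e)^T = 1%:M.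
  rewrite mul_col_mx tr_col_mx mul_col_row FG eE Fe eF.
  by rewrite -scalar_mx_block.
have [|F'' [F''G F''F]] := IH (k + 1)%N (col_mx F e) _ F1G.
  by rewrite addn1 addSnnS.
move: F''F; rewrite tr_col_mx mul_mx_row -[0]row_mx0 => /eq_row_mx [F''F F''e].
exists (@col_mx R 1 m n e F''); split.
  have eF'' : e *m G *m F''^T = 0.
    have := congr1 trmx F''e; rewrite !trmx_mul trmxK G_sym trmx0 => <-.
    by rewrite mulmxA.
  rewrite (@mul_col_mx _ 1 m) (@tr_col_mx _ 1 m) (@mul_col_row _ 1 m n 1 m) eE F''G F''e eF''.
  by rewrite -(@scalar_mx_block _ 1 m).
by rewrite !(@mul_col_mx _ 1 m) eF F''F (@col_mx0 _ 1 m).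
Qed.

Lemma orthonormal_basis : exists E : 'M[R]_n, E *m G *m E^T = 1%:M.
Proof.
have [|F [FG _]] := @orthonormal_extension n 0 (0 : 'M[R]_(0, n)) (add0n n).
  by apply/matrixP => -[].
by exists F.
Qed.

(** An orthonormal basis [E] gives [det E ^+ 2 * det G = 1]. *)
Lemma posdef_det : 0 < \det G.
Proof.
have [E /(congr1 determinant)] := orthonormal_basis.
rewrite !det_mulmx det_tr det1 => EG.
have E0 : \det E != 0.
  by apply: contra_eq_neq EG => ->; rewrite mulr0 eq_sym oner_neq0.
have E2 : 0 < \det E ^+ 2 by rewrite exprn_even_gt0.
by rewrite -(pmulr_lgt0 _ E2) expr2 mulrA [\det G * _]mulrC EG ltr01.
Qed.

End GramSchmidt.

Lemma adapted_frame_exists (R : realType) (g : 'rV[R]_4 -> 'M[R]_4) (p : 'rV[R]_(4 + 4)) :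
  (g (base p))^T = g (base p) ->
  (forall v : 'rV[R]_4, v != 0 -> 0 < (v *m g (base p) *m v^T) 0 0) ->
  inner g (taut p) (taut p) (base p) = 1 ->
  exists E, adapted_frame g p E.
Proof.
move=> Gs Gpos u1; set G := g (base p) in Gs Gpos *; set u := taut p.
have uG : u *m G *m u^T = 1%:M by rewrite [u *m G *m _]mx11_scalar [X in X%:M]u1.
have [F [FG Fu]] := orthonormal_extension Gs Gpos (erefl : (1 + 3 = 4)%N) uG.
have uF : u *m G *m F^T = 0.
  have := congr1 trmx Fu; rewrite !trmx_mul trmxK Gs trmx0 => <-.
  by rewrite mulmxA.
(* The sign [s] is free to adjust the orientation: it multiplies the determinant by [s ^+ 3] and
   leaves the first row equal to [u]. *)
have frame (s : R) : s * s = 1 -> let E := col_mx u (s *: F) : 'M[R]_(1 + 3, 4) in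
    E *m G *m E^T = 1%:M /\ row 0 E = u.
  move=> ss E; split; last first.
    apply/rowP => j; rewrite [LHS]mxE.
    apply: etrans _ (@col_mxEu _ 1 3 _ u (s *: F) 0 j).
    by congr (E _ j); exact: val_inj.
  rewrite /E (@mul_col_mx _ 1 3) (@tr_col_mx _ 1 3) (@mul_col_row _ 1 3 4 1 3) uG.
  rewrite (_ : (s *: F)^T = s *: F^T); last exact: linearZ.
  rewrite -!(scalemxAl, scalemxAr) uF Fu FG !scaler0 scalerA ss scale1r.
  by rewrite -(@scalar_mx_block _ 1 3).
pose E s := col_mx u (s *: F) : 'M[R]_(1 + 3, 4).
have detE s : \det (E s : 'M[R]_4) = s ^+ 3 * \det (E 1 : 'M[R]_4).
  have -> : (E s : 'M[R]_4) = (@block_mx R 1 3 1 3 1%:M 0 0 (s%:M)) *m (E 1 : 'M[R]_4).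
    rewrite /E -[RHS]/(@mulmx R (1 + 3) (1 + 3) 4 _ _) (@mul_block_col _ 1 3 1 3).
    by rewrite !mul0mx mul1mx addr0 add0r mul_scalar_mx scale1r.
  by rewrite det_mulmx (@det_ublock _ 1 3) det1 mul1r det_scalar.
have nz : \det (E 1 : 'M[R]_4) != 0.
  have [/(congr1 determinant) + _] := frame 1 (mulr1 1); rewrite !det_mulmx det1 => EG.
  by apply: contra_eq_neq EG => ->; rewrite !mul0r eq_sym oner_neq0.
case: (ltrgtP (\det (E 1 : 'M[R]_4)) 0) => [neg|pos|/eqP]; last by rewrite (negbTE nz).
  have [e1 e2] := frame (-1) ltac:(by rewrite mulrNN mulr1).
  exists (E (-1) : 'M[R]_4); split => //; rewrite detE -signr_odd /= expr1 mulN1r oppr_gt0.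
  exact: neg.
have [e1 e2] := frame 1 (mulr1 1).
by exists (E 1 : 'M[R]_4); split.
Qed.

Lemma atlas_local_metric (R : realType) (M : topologicalType) (n : nat)
    (A : oriented_atlas R M n) (g : riemannian_metric A) i :
  local_metric (g i) (chart_img (A i)).
Proof.
split.
- exact: chart_img_open.
- exact: (metric_smooth g).
- by move=> x Dx; exact: (Defs.metric_sym g Dx).
- by move=> x Dx; apply: posdef_det => [|v v0]; [exact: (Defs.metric_sym g Dx)|exact: (metric_pos g Dx v0)].
Qed.

(** * Smoothness through algebras of functions stable under derivatives *)

Section SmoothClosure.
Variables (R : realType) (V : normedModType R) (P : set V).
Hypothesis P_open : open P.

(* Smoothness is coinductive: a class of differentiable functions stable, on
   [P], under directional derivatives consists of smooth functions. *)
Lemma smooth_on_closed (W : normedModType R) (S : set (V -> W)) :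
  (forall f z, S f -> P z -> differentiable f z) ->
  (forall f v, S f -> exists2 f', S f' & forall z, P z -> 'D_v f z = f' z) ->
  forall f, S f -> smooth_on P f.
Proof.
move=> Sd SD f Sf vs z Pz.
have near_P y : P y -> \forall t \near y, P t.
  by move=> Py; exact: open_nbhs_nbhs (conj P_open Py).
have [h Sh hE] : exists2 h, S h &
    forall z, P z -> foldr (fun v (h : V -> W) y => 'D_v h y) f vs z = h z.
  elim: vs => [|v vs [h Sh hE]]; first by exists f.
  have [h' Sh' h'E] := SD h v Sh; exists h' => // y Py.
  rewrite -h'E//; apply: near_eq_derive.
  by apply: filterS (near_P _ Py) => t; exact: hE.
apply: (@near_eq_differentiable _ _ _ h); last exact: Sd.
by apply: filterS (near_P _ Pz) => t Pt; rewrite hE.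
Qed.

(** The real algebra generated by [B]. If the derivatives of the generators agree on [P] with
    elements of it, the product rule extends this to the whole algebra, and [smooth_on_closed]
    applies. *)
Inductive algebra_gen (B : set (V -> R)) : (V -> R) -> Prop :=
| AlgGen f : B f -> algebra_gen B f
| AlgCst a : algebra_gen B (cst a)
| AlgAdd f h : algebra_gen B f -> algebra_gen B h -> algebra_gen B (fun z => f z + h z)
| AlgMul f h : algebra_gen B f -> algebra_gen B h -> algebra_gen B (fun z => f z * h z).

Lemma algebra_gen_sub (B B' : set (V -> R)) f : B `<=` B' ->
  algebra_gen B f -> algebra_gen B' f.
Proof.
move=> BB'; elim=> [h Bh|a|h k _ Bh _ Bk|h k _ Bh _ Bk].
- exact: AlgGen (BB' _ Bh).
- exact: AlgCst.
- exact: AlgAdd.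
- exact: AlgMul.
Qed.

Lemma algebra_gen_sum (B : set (V -> R)) (I : Type) (r : seq I) (f : I -> V -> R) :
  (forall i, algebra_gen B (f i)) -> algebra_gen B (fun z => \sum_(i <- r) f i z).
Proof.
move=> Bf; elim: r => [|i r IH].
  rewrite (_ : (fun z => _) = cst 0); first exact: AlgCst.
  by apply/funext => z; rewrite big_nil.
rewrite (_ : (fun z => _) = (fun z => f i z + \sum_(j <- r) f j z)); first exact: AlgAdd.
by apply/funext => z; rewrite big_cons.
Qed.

Variable B : set (V -> R).
Hypothesis B_diff : forall f z, B f -> P z -> differentiable f z.
Hypothesis B_derive : forall f v, B f ->
  exists2 f', algebra_gen B f' & forall z, P z -> 'D_v f z = f' z.

Lemma algebra_gen_diff f z : algebra_gen B f -> P z -> differentiable f z.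
Proof.
move=> Bf Pz; elim: Bf => [h Bh|a|h k _ dh _ dk|h k _ dh _ dk].
- exact: B_diff.
- exact: differentiable_cst.
- exact: differentiableD.
- exact: differentiableM.
Qed.

Lemma algebra_gen_derive f v : algebra_gen B f ->
  exists2 f', algebra_gen B f' & forall z, P z -> 'D_v f z = f' z.
Proof.
elim=> [h Bh|a|h k Bh [h' Bh' hE] Bk [k' Bk' kE]|h k Bh [h' Bh' hE] Bk [k' Bk' kE]].
- exact: B_derive.
- by exists (cst 0) => [|z _]; [exact: AlgCst|exact: derive_cst].
- exists (fun z => h' z + k' z) => [|z Pz]; first exact: AlgAdd.
  rewrite -hE// -kE//; apply: derive_val; apply: is_deriveD;
    by apply: is_derive_diff; exact: algebra_gen_diff.
- exists (fun z => h' z * k z + h z * k' z) => [|z Pz].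
    by apply: AlgAdd; exact: AlgMul.
  rewrite -hE// -kE//; apply: derive_val; apply: is_deriveM';
    by apply: is_derive_diff; exact: algebra_gen_diff.
Qed.

Lemma smooth_on_algebra m n (f : V -> 'M[R]_(m, n)) :
  (forall i j, algebra_gen B (fun z => f z i j)) -> smooth_on P f.
Proof.
move=> Bf; apply: (smooth_on_closed (S := [set f : V -> 'M[R]_(m, n) |
    forall i j, algebra_gen B (fun z => f z i j)])) => // {f Bf}.
  by move=> f z Sf Pz; apply: differentiable_mx => i j; exact: algebra_gen_diff.
move=> f v Sf.
have /choice[h hP] (ij : 'I_m * 'I_n) : exists h, algebra_gen B h /\
    forall z, P z -> 'D_v (fun z => f z ij.1 ij.2) z = h z.
  by have [h Bh hE] := algebra_gen_derive v (Sf ij.1 ij.2); exists h.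
exists (fun z => \matrix_(i, j) h (i, j) z) => [i j|z Pz].
  rewrite (_ : (fun z => _) = h (i, j)); first exact: (hP (i, j)).1.
  by apply/funext => z; rewrite mxE.
rewrite derive_mx; last first.
  by apply: diff_derivable; apply: differentiable_mx => i j; exact: algebra_gen_diff.
by apply/matrixP => i j; rewrite !mxE -(hP (i, j)).2.
Qed.

End SmoothClosure.

(** * A direct parametrization through a given unit vector *)

Section LocalSection.
Variables (R : realType) (g : 'rV[R]_4 -> 'M[R]_4) (D : set 'rV[R]_4).
Hypothesis gD : local_metric g D.
Hypothesis g_pos : forall x (v : 'rV[R]_4), D x -> v != 0 -> 0 < (v *m g x *m v^T) 0 0.
Variable E0 : 'M[R]_4.
Hypothesis E0_det : 0 < \det E0.

Local Notation V7 := 'rV[R]_(4 + 3).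
Let x (z : V7) : 'rV[R]_4 := lsubmx z.
Let w (z : V7) : 'rV[R]_4 := (row_mx (1%:M : 'M[R]_1) (rsubmx z) : 'rV[R]_(1 + 3)) *m E0.
Let q (z : V7) : R := inner g (w z) (w z) (x z).
Let N (z : V7) : R := (Num.sqrt (q z))^-1.
Let P : set V7 := [set z | D (x z)].

(* [(x, y)] is sent to the unit vector at [x] along [E_0 + \sum_a y_a E_a]. *)
Definition sphere_chart (z : V7) : 'rV[R]_(4 + 4) := row_mx (x z) (N z *: w z).

Definition sphere_chart_dom : set V7 := P.

Lemma sphere_chart_open : open sphere_chart_dom.
Proof.
apply: open_comp; last exact: (local_open gD).
by move=> z _; exact: continuous_lsubmx.
Qed.

Let B : 'M[R]_(3, 4) := dsubmx (E0 : 'M[R]_(1 + 3, 4)).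

(** [w z] differs from the first row of [E0] by a combination of the other three rows, which are
    those of [B]. *)
Lemma w_det z : \det (col_mx (w z) B : 'M[R]_4) = \det E0.
Proof.
have -> : (col_mx (w z) B : 'M[R]_(1 + 3)) =
    @block_mx R 1 3 1 3 1%:M (rsubmx z) 0 1%:M *m E0.
  rewrite -[E0 in RHS](@vsubmxK _ 1 3) (@mul_block_col _ 1 3 1 3 4).
  rewrite mul0mx add0r !mul1mx; congr col_mx.
  by rewrite /w -[E0 in LHS](@vsubmxK _ 1 3) (@mul_row_col _ 1 1 3) mul1mx.
by rewrite det_mulmx (@det_ublock _ 1 3) !det1 !mul1r.
Qed.

Lemma w_neq0 z : w z != 0.
Proof.
apply/eqP => w0; have := w_det z; rewrite w0 => d0.
have : \det (col_mx 0 B : 'M[R]_(1 + 3)) = 0.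
  have -> : (col_mx 0 B : 'M[R]_(1 + 3)) = @block_mx R 1 3 1 3 0 0 0 1%:M *m E0.
    rewrite -[E0 in RHS](@vsubmxK _ 1 3) (@mul_block_col _ 1 3 1 3 4).
    by rewrite !mul0mx !add0r mul1mx.
  by rewrite det_mulmx (@det_ublock _ 1 3) det_mx11 mxE !mul0r.
by rewrite d0 => E00; move: E0_det; rewrite E00 ltxx.
Qed.

Lemma q_gt0 z : P z -> 0 < q z.
Proof. by move=> Pz; apply: g_pos => //; exact: w_neq0. Qed.

Lemma N_gt0 z : P z -> 0 < N z.
Proof. by move=> Pz; rewrite invr_gt0 sqrtr_gt0 q_gt0. Qed.

Lemma N_sqr z : P z -> N z * N z * q z = 1.
Proof.
move=> Pz; rewrite -expr2 exprVn sqr_sqrtr ?mulVf ?ltW ?q_gt0//.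
by rewrite gt_eqF// q_gt0.
Qed.

Lemma sphere_chart_base z : base (sphere_chart z) = x z.
Proof. exact: row_mxKl. Qed.

Lemma sphere_chart_dom_base z : sphere_chart_dom z -> D (base (sphere_chart z)).
Proof. by move=> Pz; rewrite sphere_chart_base. Qed.

Lemma sphere_chart_taut z : taut (sphere_chart z) = N z *: w z.
Proof. exact: row_mxKr. Qed.

Lemma sphere_chart_unit z : P z ->
  inner g (taut (sphere_chart z)) (taut (sphere_chart z)) (base (sphere_chart z)) = 1.
Proof.
move=> Pz; rewrite sphere_chart_base sphere_chart_taut /inner.
rewrite (_ : (N z *: w z)^T = N z *: (w z)^T); last exact: linearZ.
by rewrite -!(scalemxAl, scalemxAr) scalerA mxE; exact: N_sqr.
Qed.

Lemma sphere_chart_inj y z : P y -> P z -> sphere_chart y = sphere_chart z -> y = z.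
Proof.
move=> Py Pz yz.
have ex : x y = x z by rewrite -sphere_chart_base yz sphere_chart_base.
have : N y *: w y = N z *: w z by rewrite -sphere_chart_taut yz sphere_chart_taut.
have E0u : E0 \in unitmx by rewrite unitmxE unitfE gt_eqF.
rewrite /w !scalemxAl => /(can_inj (mulmxK E0u)).
rewrite !scale_row_mx => H; have [Nyz Nr] := @eq_row_mx _ 1 1 3 _ _ _ _ H.
have NN : N y = N z.
  by have /matrixP/(_ 0 0) := Nyz; rewrite !mxE !mulr1.
have er : rsubmx y = rsubmx z :> 'rV[R]_3.
  apply: (@scalerI _ _ (N z)); first by rewrite gt_eqF// N_gt0.
  by rewrite -{1}NN.
by rewrite -[y](@hsubmxK _ 1 4 3) -[z](@hsubmxK _ 1 4 3) er -/(x y) -/(x z) ex.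
Qed.

Let metric_jet (vs : seq 'rV[R]_4) := foldr (fun v (h : 'rV[R]_4 -> 'M[R]_4) y => 'D_v h y) g vs.

(** Coordinates have constant derivatives, and the derivative of an iterated derivative of [g] is
    again one, in one more direction. The squared length [q] lies in this algebra. *)
Let gens1 : set (V7 -> R) := [set f |
  (exists k, f = (fun z : V7 => z 0 k)) \/
  (exists vs i j, f = (fun z : V7 => metric_jet vs (x z) i j))].

(** Adjoining [N], the inverse square root of [q], keeps the algebra stable: its derivative is
    [- N ^+ 3 / 2] times that of [q]. The smaller algebra has to be handled beforehand, since it
    supplies the derivative of [q]. *)
Let gens2 : set (V7 -> R) := gens1 `|` [set N].

Lemma x_diff z : differentiable x z.
Proof. exact: differentiable_lsubmx. Qed.

Lemma derive_x z v : 'D_v x z = lsubmx v.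
Proof.
apply: derive_val; apply: is_derive_mx => a b; rewrite mxE.
rewrite (_ : (fun y => _) = (fun y : V7 => y a (lshift 3 b))).
  exact: (is_derive_entry a (lshift 3 b) (is_derive_id z v)).
by apply/funext => y; rewrite /x mxE.
Qed.

Lemma gens1_diff f z : gens1 f -> P z -> differentiable f z.
Proof.
move=> [[k ->]|[vs [i [j ->]]]] Pz; first exact: differentiable_coord.
apply: (@differentiable_entry _ _ _ _ (fun z => metric_jet vs (x z))).
apply: (@differentiable_comp _ _ _ _ x (metric_jet vs)); first exact: x_diff.
exact: (local_smooth gD).
Qed.

Lemma gens1_derive f v : gens1 f ->
  exists2 f', algebra_gen gens1 f' & forall z, P z -> 'D_v f z = f' z.
Proof.
move=> [[k ->]|[vs [i [j ->]]]].
  exists (cst (v 0 k)) => [|z _]; first exact: AlgCst.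
  by apply: derive_val; exact: (is_derive_entry 0 k (is_derive_id z v)).
exists (fun z => metric_jet (lsubmx v :: vs) (x z) i j) => [|z Pz].
  by apply: AlgGen; right; exists (lsubmx v :: vs), i, j.
apply: derive_val; apply: is_derive_entry.
have vE := derive_x z v.
rewrite -[metric_jet (_ :: _) (x z)]/('D_(lsubmx v) (metric_jet vs) (x z)) -vE.
apply: is_derive_comp_diff; first exact: x_diff.
exact: (local_smooth gD).
Qed.

Lemma alg_x (B' : set (V7 -> R)) j : gens1 `<=` B' -> algebra_gen B' (fun z => x z 0 j).
Proof.
move=> gB; rewrite (_ : (fun z => _) = (fun z : V7 => z 0 (lshift 3 j))).
  by apply: AlgGen; apply: gB; left; exists (lshift 3 j).
by apply/funext => z; rewrite mxE.
Qed.

Lemma alg_w (B' : set (V7 -> R)) j : gens1 `<=` B' -> algebra_gen B' (fun z => w z 0 j).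
Proof.
move=> gB; pose r (z : V7) : 'rV[R]_(1 + 3) := row_mx (1%:M : 'M[R]_1) (rsubmx z).
rewrite (_ : (fun z => _) = (fun z : V7 => \sum_(k < 1 + 3) r z 0 k * E0 k j)); last first.
  by apply/funext => z; rewrite mxE.
apply: algebra_gen_sum => k; apply: (AlgMul (f := fun z : V7 => r z 0 k) (h := cst (E0 k j))).
  rewrite -[k]splitK; case: fintype.split => a /=.
    rewrite (_ : (fun z => _) = cst ((1%:M : 'M[R]_1) 0 a)); first exact: AlgCst.
    by apply/funext => z; rewrite /r row_mxEl.
  rewrite (_ : (fun z => _) = (fun z : V7 => z 0 (rshift 4 a))).
    by apply: AlgGen; apply: gB; left; exists (rshift 4 a).
  by apply/funext => z; rewrite /r row_mxEr mxE.
exact: AlgCst.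
Qed.

Lemma alg_q : algebra_gen gens1 q.
Proof.
rewrite (_ : q = (fun z => \sum_j (\sum_i w z 0 i * metric_jet [::] (x z) i j) * w z 0 j)).
  apply: algebra_gen_sum => j; apply: AlgMul; last exact: alg_w.
  apply: algebra_gen_sum => i; apply: AlgMul; first exact: alg_w.
  by apply: AlgGen; right; exists [::], i, j.
apply/funext => z; rewrite /q /inner mxE; apply: eq_bigr => j _.
by rewrite mxE [(w z)^T _ _]mxE.
Qed.

Lemma is_derive_N z v : P z ->
  is_derive z v N (- 2^-1 * (N z * N z * N z) * 'D_v q z).
Proof.
move=> Pz; have q0 := q_gt0 Pz.
have dq : differentiable q z by exact: algebra_gen_diff gens1_diff _ _ alg_q Pz.
have dF : is_derive (q z) 1 (fun t : R => (Num.sqrt t)^-1)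
    (- 2^-1 * (N z * N z * N z)).
  have ds := is_derive1_sqrt q0.
  have s0 : Num.sqrt (q z) != 0 by rewrite gt_eqF// sqrtr_gt0.
  have sd : derivable (Num.sqrt : R -> R) (q z) 1 := @ex_derive _ _ _ _ _ _ _ ds.
  apply: DeriveDef; first exact: (derivableV s0 sd).
  apply: etrans (deriveV s0 sd) _.
  rewrite (@derive_val _ _ _ _ _ _ _ ds) /GRing.scale/= /N.
  by move: s0; generalize (Num.sqrt (q z)) => s s0; field.
have Fd : differentiable (fun t : R => (Num.sqrt t)^-1) (q z).
  by apply/derivable1_diffP; exact: (@ex_derive _ _ _ _ _ _ _ dF).
have H := is_derive_comp_diff v dq Fd.
apply: (is_derive_eq H); rewrite deriveE// -['D_v q z]mulr1 linearZ/= -deriveE//.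
by rewrite (@derive_val _ _ _ _ _ _ _ dF) /GRing.scale/= mulr1 mulrC.
Qed.

Lemma gens2_diff f z : gens2 f -> P z -> differentiable f z.
Proof.
case=> [Bf Pz|-> Pz]; first exact: gens1_diff.
have dq : differentiable q z by exact: algebra_gen_diff gens1_diff _ _ alg_q Pz.
apply: (@differentiable_comp _ _ _ _ q (fun t : R => (Num.sqrt t)^-1)) => //.
have q0 := q_gt0 Pz; have s0 : Num.sqrt (q z) != 0 by rewrite gt_eqF// sqrtr_gt0.
apply/derivable1_diffP; apply: (derivableV s0).
exact: (@ex_derive _ _ _ _ _ _ _ (is_derive1_sqrt q0)).
Qed.

Lemma gens2_derive f v : gens2 f ->
  exists2 f', algebra_gen gens2 f' & forall z, P z -> 'D_v f z = f' z.
Proof.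
have sub : gens1 `<=` gens2 by move=> h; left.
case=> [Bf|->].
  have [f' Bf' f'E] := gens1_derive v Bf; exists f' => //.
  exact: algebra_gen_sub sub Bf'.
have [q' Bq' q'E] := algebra_gen_derive gens1_diff gens1_derive v alg_q.
exists (fun z => - 2^-1 * (N z * N z * N z) * q' z) => [|z Pz].
  apply: AlgMul; last exact: algebra_gen_sub sub Bq'.
  apply: (AlgMul (f := cst (- 2^-1))); first exact: AlgCst.
  by apply: AlgMul; [apply: AlgMul|]; apply: AlgGen; right.
by rewrite -q'E//; apply: derive_val; exact: is_derive_N.
Qed.

Lemma sphere_chart_smooth : smooth_on sphere_chart_dom sphere_chart.
Proof.
have sub : gens1 `<=` gens2 by move=> h; left.
apply: (smooth_on_algebra sphere_chart_open gens2_diff gens2_derive) => i j.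
rewrite [i]ord1 -[j]splitK; case: fintype.split => a /=.
  rewrite (_ : (fun z => _) = (fun z => x z 0 a)); first exact: alg_x.
  by apply/funext => z; rewrite row_mxEl.
rewrite (_ : (fun z => _) = (fun z => N z * w z 0 a)).
  by apply: AlgMul; [apply: AlgGen; right|exact: alg_w].
by apply/funext => z; rewrite row_mxEr mxE.
Qed.

Lemma derive_w z v : 'D_v w z = rsubmx v *m B.
Proof.
apply: derive_val.
have dr : is_derive z v (fun y : V7 => row_mx (1%:M : 'M[R]_1) (rsubmx y) : 'rV[R]_(1 + 3))
    (row_mx 0 (rsubmx v) : 'rV[R]_(1 + 3)).
  apply: is_derive_mx => i k; rewrite [i]ord1 -[k]splitK; case: fintype.split => a /=.
    rewrite row_mxEl mxE (_ : (fun y => _) = cst ((1%:M : 'M[R]_1) 0 a)).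
      exact: is_derive_cst.
    by apply/funext => y; rewrite row_mxEl.
  rewrite row_mxEr mxE (_ : (fun y => _) = (fun y : V7 => y 0 (rshift 4 a))).
    exact: (is_derive_entry 0 (rshift 4 a) (is_derive_id z v)).
  by apply/funext => y; rewrite row_mxEr mxE.
apply: (is_derive_eq (is_derive_mulmx dr (is_derive_cst E0 z v))).
rewrite mulmx0 addr0 -[E0 in LHS](@vsubmxK _ 1 3).
by rewrite (@mul_row_col _ 1 1 3) mul0mx add0r.
Qed.

Lemma sphere_chart_horizontal k (X : 'M[R]_(k, 4 + 3)) z : P z ->
  horizontal (X *m jacobian sphere_chart z) = lsubmx X.
Proof.
move=> Pz; apply/row_matrixP => a.
apply: etrans (horizontal_jacobian sphere_chart_smooth X a Pz) _.
rewrite (_ : (fun y => base (sphere_chart y)) = x); last first.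
  by apply/funext => y; exact: sphere_chart_base.
by rewrite derive_x; apply/rowP => j; rewrite !mxE.
Qed.

(** Along the last three coordinates the base point does not move, so the covariant derivative of
    [N *: w] is the ordinary one. The column [a] collects the derivatives of [N]. *)
Lemma sphere_chart_vertical z : P z -> exists a : 'cV[R]_3,
  vertical g (sphere_chart z) (row_mx 0 1%:M *m jacobian sphere_chart z) =
  a *m w z + N z *: B.
Proof.
move=> Pz; exists (\col_i 'D_(row i (row_mx 0 1%:M : 'M[R]_(3, 4 + 3))) N z).
apply/row_matrixP => a; set v := row a (row_mx 0 1%:M : 'M[R]_(3, 4 + 3)).
apply: etrans (vertical_jacobian g sphere_chart_smooth _ a Pz) _.
rewrite /cov (_ : (fun y => base (sphere_chart y)) = x); last first.
  by apply/funext => y; exact: sphere_chart_base.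
rewrite -/v derive_x (_ : lsubmx v = 0); last first.
  by apply/rowP => j; rewrite mxE mxE row_mxEl !mxE.
have -> : christoffel g (base (sphere_chart z)) 0 (taut (sphere_chart z)) = 0.
  by apply: (christoffel0l gD); rewrite sphere_chart_base.
rewrite addr0 (_ : (fun y => taut (sphere_chart y)) = (fun y => N y *: w y)); last first.
  by apply/funext => y; exact: sphere_chart_taut.
have dN := is_derive_diff v (gens2_diff (or_intror erefl : gens2 N) Pz).
have dw : differentiable w z.
  apply: differentiable_mx => i j; rewrite [i]ord1.
  exact: (algebra_gen_diff gens1_diff (alg_w _ (fun f Bf => Bf)) Pz).
apply: (@etrans _ _ ('D_v N z *: w z + N z *: 'D_v w z)).
  apply: derive_val; apply: is_derive_mx => i j.
  rewrite (_ : (fun y => _) = (fun y => N y * w y i j)).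
    apply: (is_derive_eq (is_deriveM' dN (is_derive_entry i j (is_derive_diff v dw)))).
    by rewrite !mxE.
  by apply/funext => y; rewrite mxE.
rewrite derive_w [RHS]linearD/= row_mul linearZ/=; congr (_ + _ *: _).
  rewrite (_ : row a _ = ('D_v N z)%:M) ?mul_scalar_mx//.
  by apply/matrixP => i j; rewrite !ord1 !mxE eqxx mulr1n.
have -> : rsubmx v = row a 1%:M.
  by apply/rowP => j; rewrite mxE mxE row_mxEr !mxE.
by rewrite -row_mul mul1mx.
Qed.

(** The coframe matrix is block triangular, since the last three coordinates have no horizontal
    part. The first diagonal block is [g *m E^T]; the second is [N] times the matrix whose
    determinant is the volume of [u] and the rows of [B], positive because [w] and [B] have
    determinant [det E0]. *)
Lemma sphere_chart_direct z : P z -> exists2 E, adapted_frame g (sphere_chart z) E &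
  0 < \det (coframe g (sphere_chart z) E (jacobian sphere_chart z)).
Proof.
move=> Pz; have Dx : D (base (sphere_chart z)) by rewrite sphere_chart_base.
have [E hE] := adapted_frame_exists (local_sym gD Dx) (fun v => g_pos Dx (v := v))
  (sphere_chart_unit Pz).
exists E => //; set J := coframe _ _ _ _.
have [a va] := sphere_chart_vertical Pz.
have Nz := N_gt0 Pz; have [E1 Eg Epos] := hE.
have [C upJ] : exists C : 'M[R]_(4, 3),
    @usubmx R 4 3 7 J = row_mx (g (base (sphere_chart z)) *m E^T) C.
  have -> : @usubmx R 4 3 7 J = (row_mx 1%:M 0 : 'M[R]_(4, 4 + 3)) *m J.
    by rewrite -[J in RHS](@vsubmxK _ 4 3) (@mul_row_col _ 4 4 3) mul1mx mul0mx addr0.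
  rewrite /J -(coframeM gD E Dx) /coframe.
  rewrite (sphere_chart_horizontal _ Pz) row_mxKl mul1mx.
  by eexists.
have dnJ : @dsubmx R 4 3 7 J = row_mx (0 : 'M[R]_(3, 4)) (N z *: @rsubmx R 3 1 3
     (B *m g (base (sphere_chart z)) *m E^T)).
  have -> : @dsubmx R 4 3 7 J = (row_mx 0 1%:M : 'M[R]_(3, 4 + 3)) *m J.
    by rewrite -[J in RHS](@vsubmxK _ 4 3) (@mul_row_col _ 3 4 3) mul1mx mul0mx add0r.
  rewrite /J -(coframeM gD E Dx) /coframe.
  rewrite (sphere_chart_horizontal _ Pz) row_mxKl !mul0mx va.
  apply: (congr2 (@row_mx R 3 4 3) erefl).
  (* [w] is parallel to [u], the first vector of [E]; hence the summand [a *m w z] only affects the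
     component that the coframe omits. *)
  have w0 : w z *m g (base (sphere_chart z)) *m E^T = (N z)^-1 *: row 0 1%:M.
    rewrite -Eg !row_mul E1 sphere_chart_taut -!scalemxAl scalerA mulVf ?gt_eqF//.
    by rewrite scale1r.
  rewrite !mulmxDl -!scalemxAl -2!(mulmxA a) w0.
  apply/matrixP => i j; rewrite !mxE big1 ?add0r // => k _.
  by rewrite !mxE /= mulr0 mulr0.
rewrite -[J](@vsubmxK _ 4 3) upJ dnJ -[\det _]/(\det (@block_mx R 4 3 4 3 _ _ _ _)).
rewrite (@det_ublock _ 4 3) det_mulmx det_tr; apply: mulr_gt0.
  by apply: mulr_gt0 => //; exact: (local_det gD Dx).
rewrite detZ; apply: mulr_gt0; first exact: exprn_gt0.
rewrite -(volume_coframe B hE) /volume; apply: mulr_gt0.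
  by rewrite sqrtr_gt0; exact: (local_det gD Dx).
rewrite sphere_chart_taut.
have -> : (col_mx (N z *: w z) B : 'M[R]_(1 + 3)) =
    @block_mx R 1 3 1 3 (N z)%:M 0 0 1%:M *m col_mx (w z) B.
  by rewrite (@mul_block_col _ 1 3 1 3 4) !mul0mx addr0 add0r mul1mx mul_scalar_mx.
by rewrite det_mulmx (@det_ublock _ 1 3) det1 mulr1 det_scalar1 w_det mulr_gt0.
Qed.

Lemma sphere_chart_center x0 : inner g (row 0 E0) (row 0 E0) x0 = 1 ->
  sphere_chart (row_mx x0 0) = row_mx x0 (row 0 E0).
Proof.
move=> e1; rewrite /sphere_chart.
have xE : x (row_mx x0 0) = x0 by rewrite /x row_mxKl.
have wE : w (row_mx x0 0) = row 0 E0.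
  rewrite /w row_mxKr -[E0 in LHS](@vsubmxK _ 1 3) (@mul_row_col _ 1 1 3).
  rewrite mul1mx mul0mx addr0; apply/rowP => j; rewrite !mxE.
  by congr (E0 _ j); exact: val_inj.
by rewrite xE /N /q xE wE e1 sqrtr1 invr1 scale1r.
Qed.

End LocalSection.

(** * Change of chart *)

(** Uniqueness of the torsion-free metric connection in algebraic form: with [K v w b] in the role
    of [<nabla_v w, b>], the three metric identities inside [koszul] combine so that symmetry leaves
    one term. *)
Lemma koszul_unique (R : realType) (n : nat) (d : 'rV[R]_n -> 'M[R]_n)
    (K : 'rV[R]_n -> 'rV[R]_n -> 'rV[R]_n -> R) v w b :
  (forall v a b, (a *m d v *m b^T) 0 0 = K v a b + K v b a) ->
  (forall v w b, K v w b = K w v b) -> koszul d v w b = K v w b.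
Proof.
move=> dK Ksym; rewrite /koszul !dK (Ksym w v b) (Ksym b v w) (Ksym b w v).
by field.
Qed.

Section ChangeOfChart.
Variables (R : realType) (n : nat) (g h : 'rV[R]_n -> 'M[R]_n) (O D : set 'rV[R]_n).
Variable tau : 'rV[R]_n -> 'rV[R]_n.
Hypotheses (gO : local_metric g O) (hD : local_metric h D).
Hypothesis tau_smooth : smooth_on O tau.
Hypothesis tauD : forall x, O x -> D (tau x).
Hypothesis tau_unit : forall x, O x -> jacobian tau x \in unitmx.
Hypothesis compat : forall x, O x ->
  g x = jacobian tau x *m h (tau x) *m (jacobian tau x)^T.
Implicit Types (x v w a b : 'rV[R]_n).

Lemma tau_diff x : O x -> differentiable tau x.
Proof. by move=> Ox; exact: (tau_smooth [::] Ox). Qed.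

Lemma tau_diff2 x v : O x -> differentiable ('D_v tau) x.
Proof. by move=> Ox; exact: (tau_smooth [:: v] Ox). Qed.

Lemma tau_diff3 x v w : O x -> differentiable ('D_w ('D_v tau)) x.
Proof. by move=> Ox; exact: (tau_smooth [:: w; v] Ox). Qed.

Lemma tauE x v : O x -> 'D_v tau x = v *m jacobian tau x.
Proof. by move=> Ox; exact: deriveEjacobian (tau_diff Ox). Qed.

Lemma inner_compat x a b : O x ->
  inner g a b x = inner h ('D_a tau x) ('D_b tau x) (tau x).
Proof. by move=> Ox; rewrite /inner compat// !tauE// trmx_mul !mulmxA. Qed.

Lemma derive_inner_compat x v a b : O x -> 'D_v (inner g a b) x =
  inner h (cov h tau ('D_a tau) v x) ('D_b tau x) (tau x)
  + inner h ('D_a tau x) (cov h tau ('D_b tau) v x) (tau x).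
Proof.
move=> Ox; apply: etrans (near_eq_derive v
  (filterS (fun y Oy => inner_compat a b Oy) (nearD gO Ox))) _.
apply: derive_val.
exact: (is_derive_inner hD v (tau_diff Ox) (tauD Ox) (tau_diff2 a Ox) (tau_diff2 b Ox)).
Qed.

Lemma hessian_sym x v w : O x -> cov h tau ('D_w tau) v x = cov h tau ('D_v tau) w x.
Proof.
move=> Ox; have nd : \forall y \near x, differentiable tau y.
  by apply: filterS (nearD gO Ox) => y; exact: tau_diff.
have e1 := Schwarz_mx nd (tau_diff2 v Ox) (tau_diff2 w Ox).
have e2 := christoffelC hD ('D_v tau x) ('D_w tau x) (tauD Ox).
exact: (congr2 +%R e1 e2).
Qed.

(** The transformation law of the Christoffel symbols, deduced from uniqueness instead of a
    computation with inverse matrices: [<nabla_v (dtau w), dtau b>] is symmetric in [v], [w] and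
    satisfies the metric identity for [g], the pullback of [h]. *)
Lemma christoffel_compat x v w : O x ->
  christoffel g x v w *m jacobian tau x = cov h tau ('D_w tau) v x.
Proof.
move=> Ox; have Dx := tauD Ox.
apply: (inner_eqP hD Dx) => c.
pose b := c *m invmx (jacobian tau x).
have cE : c = 'D_b tau x by rewrite tauE// mulmxKV// tau_unit.
rewrite cE.
apply: etrans (_ : _ = inner g (christoffel g x v w) b x) _.
  apply: etrans _ (esym (inner_compat _ _ Ox)).
  by congr (inner h _ _ _); rewrite tauE.
apply: etrans (christoffel_koszul gO v w b Ox) _.
pose K v w b := inner h (cov h tau ('D_w tau) v x) ('D_b tau x) (tau x).
have Dinner v' a' b' : (a' *m 'D_v' g x *m b'^T) 0 0 = K v' a' b' + K v' b' a'.
  apply: etrans (esym (derive_inner gO v' a' b' Ox)) _.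
  apply: etrans (derive_inner_compat v' a' b' Ox) _; congr (_ + _).
  exact: (inner_sym hD _ _ Dx).
have Ksym v' w' b' : K v' w' b' = K w' v' b'.
  exact: (congr1 (fun t => inner h t ('D_b' tau x) (tau x)) (hessian_sym v' w' Ox)).
exact: (@koszul_unique _ _ (fun e => 'D_e g x) K v w b Dinner Ksym).
Qed.

(** Naturality of the connection under the isometry [tau]. Expanding [Y] in the constant basis
    fields reduces it to [christoffel_compat]. *)
Lemma cov_pushforward x v (Y : 'rV[R]_n -> 'rV[R]_n) : O x -> differentiable Y x ->
  cov h tau (fun y => Y y *m jacobian tau y) v x =
  ('D_v Y x + christoffel g x v (Y x)) *m jacobian tau x.
Proof.
move=> Ox dY; have Dx := tauD Ox.
have nE : \forall y \near x, Y y *m jacobian tau y =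
    \sum_k Y y 0 k *: 'D_(delta_mx 0 k) tau y.
  apply: filterS (nearD gO Ox) => y Oy; rewrite mulmx_sum_row.
  by apply: eq_bigr => k _; rewrite tauE// -rowE.
have sE := nbhs_singleton nE.
rewrite /cov (near_eq_derive v nE) sE.
have dS : is_derive x v (fun y => \sum_k Y y 0 k *: 'D_(delta_mx 0 k) tau y)
   (\sum_k ('D_v Y x 0 k *: 'D_(delta_mx 0 k) tau x
     + Y x 0 k *: 'D_v ('D_(delta_mx 0 k) tau) x)).
  apply: is_derive_bigsum => k; apply: is_derive_mx => i j.
  have dk := is_derive_entry 0 k (is_derive_diff v dY).
  have dt := is_derive_entry i j (is_derive_diff v (tau_diff2 (delta_mx 0 k) Ox)).
  rewrite (_ : (fun y => _) = (fun y => Y y 0 k * 'D_(delta_mx 0 k) tau y i j)).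
    by apply: (is_derive_eq (is_deriveM' dk dt)); rewrite !mxE.
  by apply/funext => y; rewrite mxE.
have -> := @derive_val _ _ _ _ _ _ _ dS.
have -> : christoffel h (tau x) ('D_v tau x) (\sum_k Y x 0 k *: 'D_(delta_mx 0 k) tau x)
   = \sum_k Y x 0 k *: christoffel h (tau x) ('D_v tau x) ('D_(delta_mx 0 k) tau x).
  apply: etrans (christoffel_sumr hD _ _ _ _ Dx) _; apply: eq_bigr => k _.
  exact: (christoffelZr hD _ _ _ Dx).
rewrite big_split/= -addrA -big_split/=.
rewrite mulmxDl; congr (_ + _).
  by rewrite mulmx_sum_row; apply: eq_bigr => k _; rewrite tauE// -rowE.
have cE : christoffel g x v (Y x) = \sum_k Y x 0 k *: christoffel g x v (delta_mx 0 k).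
  apply: etrans (congr1 (christoffel g x v) (row_sum_delta (Y x))) _.
  apply: etrans (christoffel_sumr gO _ _ _ _ Ox) _; apply: eq_bigr => k _.
  exact: (christoffelZr gO _ _ _ Ox).
rewrite cE mulmx_suml; apply: eq_bigr => k _; rewrite -scalemxAl -scalerDr.
by congr (_ *: _); exact: esym (christoffel_compat _ _ Ox).
Qed.

(** [curvature_along] for the map [tau] and the section ['D_a tau] expresses the left side by
    covariant derivatives along [tau]; by naturality these are pushed forward from the derivatives
    in the first chart. *)
Lemma riem_compat x v w a : O x ->
  riem h (tau x) ('D_v tau x) ('D_w tau x) ('D_a tau x) =
  riem g x v w a *m jacobian tau x.
Proof.
move=> Ox; have Dx := tauD Ox.
have nd : \forall y \near x, differentiable tau y.
  by apply: filterS (nearD gO Ox) => y; exact: tau_diff.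
have nda : \forall y \near x, differentiable ('D_a tau) y.
  by apply: filterS (nearD gO Ox) => y; exact: tau_diff2.
apply: etrans (esym (@curvature_along _ _ _ _ hD _ tau ('D_a tau) v w x Dx nd nda
  (tau_diff2 w Ox) (tau_diff2 v Ox) (tau_diff3 a w Ox) (tau_diff3 a v Ox))) _.
have covE b c : cov h tau (cov h tau ('D_a tau) b) c x =
    ('D_c (fun q => christoffel g q b a) x + christoffel g x c (christoffel g x b a))
      *m jacobian tau x.
  have nE : \forall y \near x, cov h tau ('D_a tau) b y =
      christoffel g y b a *m jacobian tau y.
    by apply: filterS (nearD gO Ox) => y Oy; exact: esym (christoffel_compat b a Oy).
  apply: etrans _ (@cov_pushforward x c (fun q => christoffel g q b a) Ox
    (christoffel_diff gO b a Ox)).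
  exact: (congr2 (fun s t => s + christoffel h (tau x) ('D_c tau x) t)
    (near_eq_derive c nE) (nbhs_singleton nE)).
apply: etrans (congr2 (fun s t => s - t) (covE w v) (covE v w)) _.
apply: etrans (esym (mulmxBl _ _ _)) _.
exact: (congr1 (fun r => r *m jacobian tau x) (esym (riemE gO v w a Ox))).
Qed.

Lemma ricci_compat x v w : O x ->
  ricci g x v w = ricci h (tau x) ('D_v tau x) ('D_w tau x).
Proof.
move=> Ox; rewrite !ricciE; set J := jacobian tau x.
have E : ricci_mx g x v w *m J = J *m ricci_mx h (tau x) ('D_v tau x) ('D_w tau x).
  apply/row_matrixP => k; rewrite !row_mul rowK.
  apply: etrans (esym (riem_compat _ _ _ Ox)) _.
  apply: etrans _ (riem_mx hD _ _ _ (tauD Ox)).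
  by rewrite (tauE (delta_mx 0 k) Ox) -rowE.
have Ju := tau_unit Ox.
by rewrite -[ricci_mx g x v w](mulmxK Ju) E mxtrace_mulC mulmxA mulVmx// mul1mx.
Qed.

End ChangeOfChart.

(** * Co-calibrated and Einstein *)

Lemma det_rowsub1_neq0 (R : comNzRingType) n (f : 'I_n -> 'I_n) : injective f ->
  \det (rowsub f 1%:M : 'M[R]_n) != 0.
Proof.
move=> f_inj; have -> : rowsub f 1%:M = perm_mx (perm f_inj) :> 'M[R]_n.
  by apply/matrixP => i j; rewrite !mxE permE.
by rewrite det_perm signr_eq0.
Qed.

(** * Independence of the Hodge duals of three 5-forms *)

Section FiveForms.
Variable R : realType.

(* Selects the coframe monomial [e^{0123} /\ e^{k+4}]. *)
Definition base_and (k : 'I_3) (i : 'I_5) : 'I_7 :=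
  match fintype.split (i : 'I_(4 + 1)) with
  | inl a => @lshift 4 3 a
  | inr _ => @rshift 4 3 k
  end.

(** The coefficient of index [k0] is isolated by evaluating on the two vertical frame vectors other
    than the one of index [k0]. There the dual of its monomial is the determinant of a permutation
    matrix, while every other monomial already contains one of these two indices. *)
Lemma hodge_base_and_eq0 (e : (5 + 2 = 7)%N) (J : 'M[R]_7) (a : 'I_3 -> R) :
  0 < \det J ->
  (forall Y : 'M[R]_(2, 7), hodge e (J *m J^T)
     (fun Z : 'M[R]_(5, 7) => \sum_k a k * \det (colsub (base_and k) (Z *m J))) Y = 0) ->
  forall k, a k = 0.
Proof.
move=> J0 H k0; have Ju : J \in unitmx by rewrite unitmxE unitfE gt_eqF.
pose h (b : 'I_2) : 'I_7 := @rshift 4 3 (lift k0 b).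
pose f k (i : 'I_7) : 'I_7 :=
  match fintype.split (i : 'I_(5 + 2)) with inl b => base_and k b | inr b => h b end.
have fl k b : f k (@lshift 5 2 b) = base_and k b.
  by rewrite /f; have := unsplitK (inl b : 'I_5 + 'I_2) => /= ->.
have fr k b : f k (@rshift 5 2 b) = h b.
  by rewrite /f; have := unsplitK (inr b : 'I_5 + 'I_2) => /= ->.
have bl k b : base_and k (@lshift 4 1 b) = @lshift 4 3 b.
  by rewrite /base_and; have := unsplitK (inl b : 'I_4 + 'I_1) => /= ->.
have br k b : base_and k (@rshift 4 1 b) = @rshift 4 3 k.
  by rewrite /base_and; have := unsplitK (inr b : 'I_4 + 'I_1) => /= ->.
have termE k : \det (castmx (e, erefl 7)
    (col_mx (rowsub (base_and k) 1%:M) (rowsub h 1%:M))) = \det (rowsub (f k) 1%:M : 'M[R]_7).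
  rewrite (eq_irrelevance e erefl) castmx_id; congr (\det _).
  apply/matrixP => i j; rewrite -[i](@splitK 5 2); case: fintype.split => b /=.
    by rewrite [LHS](@col_mxEu _ 5 2 7) [LHS]mxE [RHS]mxE fl.
  by rewrite [LHS](@col_mxEd _ 5 2 7) [LHS]mxE [RHS]mxE fr.
have lr (b : 'I_4) (k : 'I_3) : @lshift 4 3 b = @rshift 4 3 k -> False.
  by move=> /(congr1 val)/= E; have := ltn_ord b; rewrite E ltnNge leq_addr.
have f_inj : injective (f k0).
  move=> i j; rewrite -[i](@splitK 5 2) -[j](@splitK 5 2).
  case: (@fintype.split 5 2 i) => b; case: (@fintype.split 5 2 j) => c /=; rewrite ?fl ?fr.
  - rewrite -[b](@splitK 4 1) -[c](@splitK 4 1).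
    case: (@fintype.split 4 1 b) => {}b; case: (@fintype.split 4 1 c) => {}c /=.
    + by rewrite !bl => /(@lshift_inj 4 3 _ _) ->.
    + by rewrite bl br => /lr [].
    + by rewrite bl br => /esym/lr [].
    + by rewrite !ord1.
  - rewrite -[b](@splitK 4 1); case: (@fintype.split 4 1 b) => {}b /=.
      by rewrite bl => /lr [].
    by rewrite br /h => /(@rshift_inj 4 3 _ _)/eqP; rewrite (negPf (neq_lift _ _)).
  - rewrite -[c](@splitK 4 1); case: (@fintype.split 4 1 c) => {}c /=.
      by rewrite bl => /esym/lr [].
    by rewrite br /h => /(@rshift_inj 4 3 _ _)/esym/eqP; rewrite (negPf (neq_lift _ _)).
  - by rewrite /h => /(@rshift_inj 4 3 _ _)/(@lift_inj _ _ _ _) ->.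
(* The rows of [invmx J] are the frame dual to the coframe [J]; [h] selects the two vertical
   vectors. *)
have := H (rowsub h 1%:M *m invmx J); rewrite hodge_sum.
rewrite (bigD1 k0)//= big1 => [|k kk0].
  rewrite addr0 hodge_coframe// mulmxKV// termE => /eqP.
  by rewrite mulf_eq0 (negPf (det_rowsub1_neq0 _ f_inj)) orbF => /eqP.
rewrite hodge_coframe// mulmxKV// termE.
have [b kE] : exists b, k = lift k0 b.
  by have := unliftP k0 k; case=> [b ->|kE]; [exists b|rewrite kE eqxx in kk0].
rewrite (@determinant_alternate _ _ _ (@lshift 5 2 (@rshift 4 1 ord0)) (@rshift 5 2 b)).
- by rewrite mulr0.
- by rewrite (@eq_lrshift 5 2).
- by move=> j; rewrite !mxE fl fr br kE.
Qed.

End FiveForms.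

Section SphereBundleForms.
Variables (R : realType) (M : topologicalType) (A : oriented_atlas R M 4).
Variables (g : riemannian_metric A) (c : sphere_param g) (z : 'rV[R]_7).
Hypothesis Pz : sp_dom c z.
Let h := g (sp_index c).
Let p := c z.
Let J := jacobian c z.

Lemma param_local_metric : local_metric h (chart_img (A (sp_index c))).
Proof. exact: atlas_local_metric. Qed.

Lemma param_base : chart_img (A (sp_index c)) (base p).
Proof. exact: sp_base. Qed.

Lemma d_star_phi_param (X : 'M[R]_(5, 7)) :
  sform_d (sform_star (erefl : (3 + 4 = 7)%N) (phi g)) c z X =
  - wedge (base_volume h p) (ric_flat h p) (X *m J).
Proof.
apply: etrans (d_star_phi param_local_metric (@sp_open _ _ _ _ c) (@sp_smooth _ _ _ _ c)
  (@sp_base _ _ _ _ c) (@sp_unit _ _ _ _ c) (@sp_direct _ _ _ _ c) X Pz) _.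
exact: (congr1 -%R (wedge_pullback _ _ _ _ _)).
Qed.

Lemma param_tangential E : adapted_frame h p E -> tangential h p E J.
Proof.
exact: (jacobian_tangential param_local_metric (@sp_open _ _ _ _ c) (@sp_smooth _ _ _ _ c)
  (@sp_base _ _ _ _ c) (@sp_unit _ _ _ _ c) Pz).
Qed.

Lemma wedge_vol_ric_param E (X : 'M[R]_(5, 7)) : adapted_frame h p E ->
  wedge (base_volume h p) (ric_flat h p) (X *m J) =
  \sum_(k < 3) ricci h (base p) (taut p) (row (lift ord0 k) E) *
    \det (colsub (base_and k) (X *m coframe h p E J)).
Proof.
move=> hE; have gD := param_local_metric; have Dp := param_base.
have tX := tangentialM gD Dp X (param_tangential hE).
apply: etrans (wedge_vol_ric gD Dp hE tX) _.
rewrite (coframeM gD E Dp) !big_ord_recl big_ord0 addr0 addrA.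
have rowE (k : 'I_3) : inord k.+1 = lift ord0 k :> 'I_4.
  by apply: val_inj; rewrite /= inordK// ltnS ltn_ord.
have monE k : \det (colsub (base_and k) (X *m coframe h p E J)) =
    mon (fun i d => (X *m coframe h p E J) i (inord d)) [:: 0; 1; 2; 3; (k + 4)]%N.
  apply: det_mon => i; rewrite /base_and -[i](@splitK 4 1) unsplitK.
  case: (@fintype.split 4 1 i) => a /=; last by rewrite ord1 addnC.
  by case: a => [[|[|[|[|]]]]].
rewrite !monE -!rowE; congr (_ * _ + _ * _ + _ * _).
Qed.

Lemma cocalibrated_ricci E : cocalibrated g -> adapted_frame h p E ->
  0 < \det (coframe h p E J) ->
  forall k : 'I_3, ricci h (base p) (taut p) (row (lift ord0 k) E) = 0.
Proof.
(* The coefficients in the derivative of [*phi] are the opposites of the Ricci values, so the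
   vanishing is proved for these. *)
move=> cc hE J0 k; apply/eqP; rewrite -oppr_eq0; apply/eqP; move: k.
apply: (hodge_base_and_eq0 (e := codiff_degree (erefl : (3 + 4 = 7)%N)) J0) => Y.
have := cc c z Pz Y; rewrite /sform_codiff /sform0 => /eqP.
rewrite mulf_eq0 signr_eq0 /= => /eqP; rewrite /sform_star -/h -/p -/J.
rewrite (gram_tangential param_local_metric param_base hE (param_tangential hE)).
move=> H; apply: etrans _ H; congr (hodge _ _ _ _); apply/funext => X.
apply: etrans _ (esym (d_star_phi_param X)).
rewrite (wedge_vol_ric_param X hE) -sumrN; apply: eq_bigr => k _.
by rewrite mulNr.
Qed.

Lemma einstein_codiff : (exists s, ric h (base p) = s%:M) ->
  sform_codiff (erefl : (3 + 4 = 7)%N) (phi g) c z =1 fun _ => 0.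
Proof.
case=> s rs Y; have [E hE _] := sp_direct Pz.
rewrite /sform_codiff /sform_star -/h -/p -/J.
have -> : sform_d (sform_star (erefl : (3 + 4 = 7)%N) (phi g)) c z = fun X => 0.
  apply/funext => X; apply: etrans (d_star_phi_param X) _.
  rewrite (wedge_vol_ric_param X hE) big1 ?oppr0// => k _.
  rewrite -(ric_ricci param_local_metric _ _ param_base) rs mul_mx_scalar -!scalemxAl mxE.
  have [E1 Eg _] := hE; rewrite -E1.
  have -> : (row 0 E *m h (base p) *m (row (lift ord0 k) E)^T) 0 0 = 0.
    transitivity ((E *m h (base p) *m E^T) 0 (lift ord0 k)); last by rewrite Eg mxE.
    by rewrite -row_mul [LHS]mxE [RHS]mxE; apply: eq_bigr => j _; rewrite !mxE.
  by rewrite mulr0 mul0r.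
by rewrite /hodge big1 ?mulr0// => I _; rewrite mul0r.
Qed.

End SphereBundleForms.

(** Basis vectors being eigenvectors makes [N] diagonal; the vector with all entries 1 makes the
    diagonal constant. *)
Lemma eigenvectors_scalar (F : fieldType) n (N : 'M[F]_n.+1) :
  (forall v : 'rV[F]_n.+1, exists a, v *m N = a *: v) -> N = (N 0 0)%:M.
Proof.
move=> Neig; have N0 i j : i != j -> N i j = 0.
  have [a /rowP/(_ j)] := Neig (delta_mx 0 i : 'rV[F]_n.+1).
  by rewrite -rowE !mxE eqxx => -> /negPf; rewrite eq_sym => ->; rewrite mulr0.
have [a aE] := Neig (const_mx 1 : 'rV[F]_n.+1).
have Na j : N j j = a.
  have /rowP/(_ j) := aE; rewrite !mxE (bigD1 j)//= big1 => [|i ij].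
    by rewrite addr0 mxE mul1r mulr1.
  by rewrite N0 // mulr0.
apply/matrixP => i j; rewrite [RHS]mxE; have [->|/N0->] := eqVneq i j; first by rewrite !Na.
by rewrite mulr0n.
Qed.

(** The overlap is the preimage of the second domain under [chart_inv], which is continuous on the
    open image of the first chart. *)
Lemma overlap_open (R : realType) (M : topologicalType) n (c d : chart R M n) :
  open (overlap c d).
Proof.
have -> : overlap c d = chart_img c `&` chart_inv c @^-1` chart_dom d.
  apply/seteqP; split=> [_ [q [cq dq] <-]|_ [[q cq <-]]].
    by split; [exists q|rewrite /preimage/= chartK].
  by rewrite /preimage/= chartK// => dq; exists q.
have img := @chart_img_open _ _ _ c.
apply: ((continuous_inP _ img).1 _ _ (@chart_dom_open _ _ _ d)).
by rewrite -continuous_open_subspace//; exact: chart_inv_continuous.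
Qed.

(** * From the vanishing codifferential to a scalar Ricci tensor *)

Section EinsteinCocalibrated.
Variables (R : realType) (M : topologicalType) (A : oriented_atlas R M 4).
Variable g : riemannian_metric A.
Implicit Types (i j : atlas_index A) (x u v : 'rV[R]_4).

Let gD i := atlas_local_metric g i.

(** An adapted frame [E0] at the given unit vector defines a [sphere_chart] whose centre is that
    vector, and co-calibration is read off at the centre. *)
Lemma cocalibrated_frame i x u : cocalibrated g -> chart_img (A i) x ->
  inner (g i) u u x = 1 ->
  exists2 E, adapted_frame (g i) (row_mx x u) E &
    forall k : 'I_3, ricci (g i) x u (row (lift ord0 k) E) = 0.
Proof.
move=> cc Dx u1.
have pos y (w : 'rV[R]_4) : chart_img (A i) y -> w != 0 -> 0 < (w *m g i y *m w^T) 0 0.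
  exact: (metric_pos g).
have bE : base (row_mx x u) = x by rewrite /base row_mxKl.
have tE : taut (row_mx x u) = u by rewrite /taut row_mxKr.
have [E0 hE0] : exists E, adapted_frame (g i) (row_mx x u) E.
  apply: adapted_frame_exists; rewrite ?bE ?tE//; first exact: (local_sym (gD i) Dx).
  by move=> w; exact: pos.
have [E01 _ E0pos] := hE0; rewrite tE in E01.
pose c : sphere_param g := @SphereParam _ _ _ g i _ _
  (sphere_chart_open (gD i)) (sphere_chart_smooth (gD i) pos E0pos)
  (fun z => @sphere_chart_dom_base _ (g i) _ E0 z)
  (fun z Pz => sphere_chart_unit pos E0pos Pz)
  (fun y z Py Pz => sphere_chart_inj pos E0pos Py Pz)
  (fun z Pz => sphere_chart_direct (gD i) pos E0pos Pz).
have Pz : sp_dom c (row_mx x 0) by rewrite /= /sphere_chart_dom /= row_mxKl.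
have cE : c (row_mx x 0) = row_mx x u.
  by rewrite -E01; apply: sphere_chart_center; rewrite E01.
(* This frame comes with a positive coframe determinant; it need not be the [E0] used to build the
   chart. *)
have [E hE E_det] := sp_direct Pz.
exists E; first by rewrite -cE.
move=> k; have := cocalibrated_ricci Pz cc hE E_det k.
by rewrite cE bE tE.
Qed.

(** Both sides have the same components in the frame: those along the last three vectors vanish, and
    the one along [u] is [ricci u u]. *)
Lemma cocalibrated_eigen i x u : cocalibrated g -> chart_img (A i) x ->
  inner (g i) u u x = 1 -> u *m ric (g i) x = ricci (g i) x u u *: u.
Proof.
move=> cc Dx u1; have [E hE E_ricci] := cocalibrated_frame cc Dx u1.
have [] := hE; rewrite /base /taut row_mxKl row_mxKr => E0 Eg _.
have GE : g i x *m E^T *m E = 1%:M.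
  exact: (frame_dual Eg).
suff H : u *m ric (g i) x *m g i x *m E^T = (ricci (g i) x u u *: u) *m g i x *m E^T.
  move: H; generalize (ric (g i) x) => N H.
  by rewrite -[LHS]mulmx1 -[RHS]mulmx1 -GE !mulmxA H.
apply/rowP => j.
have -> : (u *m ric (g i) x *m g i x *m E^T) 0 j = ricci (g i) x u (row j E).
  rewrite -(ric_ricci (gD i) _ _ Dx) [LHS]mxE [RHS]mxE.
  by apply: eq_bigr => k _; rewrite !mxE.
rewrite -!scalemxAl mxE.
have -> : (u *m g i x *m E^T) 0 j = (0 == j)%:R.
  by rewrite -E0 -!row_mul Eg !mxE.
have [<-|] := eqVneq 0 j; first by rewrite mulr1 E0.
by have := unliftP 0 j; case=> [k ->|->]; [rewrite E_ricci mulr0|rewrite eqxx].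
Qed.

Lemma cocalibrated_scalar i x : cocalibrated g -> chart_img (A i) x ->
  ric (g i) x = (ric (g i) x 0 0)%:M.
Proof.
move=> cc Dx; apply: eigenvectors_scalar => v.
have [->|v0] := eqVneq v 0; first by exists 0; rewrite mul0mx scale0r.
have := metric_pos g Dx v0; rewrite -/(inner (g i) v v x) => vv0.
pose a := Num.sqrt (inner (g i) v v x); have a0 : 0 < a by rewrite sqrtr_gt0.
have aa : a * a = inner (g i) v v x by rewrite -expr2 sqr_sqrtr// ltW.
have u1 : inner (g i) (a^-1 *: v) (a^-1 *: v) x = 1.
  rewrite innerZl (inner_sym (gD i) _ _ Dx) innerZl -aa.
  by move: a0 => /lt0r_neq0; clear; move=> a0; field.
exists (ricci (g i) x (a^-1 *: v) (a^-1 *: v)).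
apply: (@scalerI _ _ a^-1); first by rewrite invr_neq0// gt_eqF.
rewrite scalemxAl (cocalibrated_eigen cc Dx u1) !scalerA; congr (_ *: _).
exact: mulrC.
Qed.

Lemma transition_chart i j q : chart_dom (A i) q ->
  transition (A i) (A j) (A i q) = A j q.
Proof. by move=> iq; rewrite /transition /= chartK. Qed.

(** A single nonzero vector suffices: [ricci v v] and [<v, v>] both transform as tensors, their
    ratio is the scalar in each chart, and [<v, v>] is positive. *)
Lemma scalar_ricci_charts i j q s t : chart_dom (A i) q -> chart_dom (A j) q ->
  ric (g i) (A i q) = s%:M -> ric (g j) (A j q) = t%:M -> s = t.
Proof.
move=> iq jq rs rt; set O := overlap (A i) (A j); set tau := transition (A i) (A j).
have Oi : O `<=` chart_img (A i) by move=> _ [r [ir _] <-]; exists r.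
have tauD y : O y -> chart_img (A j) (tau y).
  by case=> r [ir jr] <-; rewrite /tau transition_chart//; exists r.
have gO : local_metric (g i) O.
  split; first exact: overlap_open.
  - by move=> vs y Oy; apply: (local_smooth (gD i)); exact: Oi.
  - by move=> y Oy; apply: (local_sym (gD i)); exact: Oi.
  - by move=> y Oy; apply: (local_det (gD i)); exact: Oi.
have tau_smooth : smooth_on O tau := @atlas_smooth _ _ _ A i j.
have tau_unit y : O y -> jacobian tau y \in unitmx.
  by move=> Oy; rewrite unitmxE unitfE gt_eqF//; exact: atlas_oriented.
have compat y : O y -> g i y = jacobian tau y *m g j (tau y) *m (jacobian tau y)^T.
  exact: metric_compat.
have Oq : O (A i q) by exists q.
have tq : tau (A i q) = A j q by exact: transition_chart.
pose v : 'rV[R]_4 := delta_mx 0 0.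
have v0 : v != 0.
  by apply/eqP => /matrixP/(_ 0 0)/eqP; rewrite !mxE !eqxx oner_eq0.
have scal k (r : R) (w : 'rV[R]_4) : chart_dom (A k) q -> ric (g k) (A k q) = r%:M ->
    ricci (g k) (A k q) w w = r * inner (g k) w w (A k q).
  move=> kq rk; rewrite -(ric_ricci (gD k)); last by exists q.
  by rewrite rk mul_mx_scalar -!scalemxAl mxE.
have := @ricci_compat _ _ _ _ _ _ _ gO (gD j) tau_smooth tauD tau_unit compat
  (A i q) v v Oq.
have := @inner_compat _ _ _ _ _ _ tau_smooth compat (A i q) v v Oq.
rewrite tq (scal i s v iq rs) (scal j t _ jq rt) => <-.
apply: mulIf; rewrite gt_eqF//; apply: (metric_pos g) v0.
exact: Oi.
Qed.

Lemma cocalibrated_einstein : cocalibrated g <-> einstein g.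
Proof.
split=> [cc|[s sE] c z Pz Y]; last first.
  apply: (einstein_codiff Pz) => //; have [q iq qE] := sp_base Pz.
  by exists (s q); rewrite -qE; exact: sE.
(* The scalar is read in one chosen chart at each point; [scalar_ricci_charts] shows that every
   other chart gives the same value. *)
pose i q := projT1 (cid (atlas_cover A q)).
have iq q : chart_dom (A (i q)) q := projT2 (cid (atlas_cover A q)).
have scal k q : chart_dom (A k) q -> ric (g k) (A k q) = (ric (g k) (A k q) 0 0)%:M.
  by move=> kq; apply: cocalibrated_scalar => //; exists q.
exists (fun q => ric (g (i q)) (A (i q) q) 0 0) => k q kq.
by rewrite scal//; congr _%:M; apply: scalar_ricci_charts kq (iq q) (scal _ _ kq) (scal _ _ (iq q)).
Qed.

End EinsteinCocalibrated.

Theorem proposition3p3 (R : realType) (M : topologicalType)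
    (M_hausdorff : hausdorff_space M) (M_countable : @second_countable M)
    (A : oriented_atlas R M 4) (g : riemannian_metric A) :
  sform_eq
    (sform_d (sform_star (erefl : (3 + 4 = 7)%N) (phi g)))
    (sform_opp (sform_wedge (pullback_vol g) (ric_taut_flat g)))
  /\ (cocalibrated g <-> einstein g).
Proof.
split; last exact: cocalibrated_einstein.
move=> c z Pz X; apply: etrans (d_star_phi_param Pz X) _.
exact: (congr1 -%R (esym (wedge_pullback _ _ _ _ _))).
Qed.
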